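(* Let $w$ and $w'$ be words over $\Omega$ of lengths $k$ and $k'$ respectively, and suppose $\mathrm{cor}(w) > \mathrm{cor}(w')$ (this forces $k \ge k'$). Then there exists an integer $N > k$ such that $h_w(n) - h_{w'}(n) \le 0$ for all $n < N$ and $h_w(n) - h_{w'}(n) > 0$ for all $n > N$.
   Context: Let $\Omega$ be a finite alphabet with $q \ge 2$ letters. A word $w$ of length $k\ge 1$ is written $w = w_k w_{k-1}\dots w_1$ with $w_i \in \Omega$. For an integer $n$, $h_w(n)$ denotes the number of strings of length $n$ over $\Omega$ whose last $k$ characters form $w$ and which contain $w$ as a block of $k$ consecutive characters nowhere else (so $h_w(n)=0$ for $n<k$, $h_w(k)=1$). Autocorrelation: for $1 \le i \le k$ let $b_i = 1$ if $w_j = w_{k-i+j}$ for all $j = 1,\dots,i$ (i.e. the suffix of length $i$ equals the prefix of length $i$), and $b_i = 0$ otherwise; so $b_k=1$. Set $\mathrm{cor}(w) = \sum_{i=1}^k b_i 2^{i-1}$ (the binary string $b_k b_{k-1}\dots b_1$ read as a base-2 integer); autocorrelations are compared as integers. (Interpretation: in a full Bernoulli shift on $q$ equiprobable symbols, e.g. an FDL dynamical system with its basic Markov partition, the cylinder coded by $w$ is first hit at time $n$ with probability $h_w(n+k)/q^{n+k}$.) *)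

(* Defs.v *)
From mathcomp Require Import all_boot all_order all_algebra.
Set Implicit Arguments. Unset Strict Implicit. Unset Printing Implicit Defensive.

(* A word/string over the alphabet Omega is a seq Omega written left to right:
   the word w = w_k w_{k-1} ... w_1 is the seq [:: w_k; ...; w_1]. *)

Definition occurs_at (Omega : eqType) (w s : seq Omega) (i : nat) : bool :=
  (i + size w <= size s) && (take (size w) (drop i s) == w).

Definition h (Omega : finType) (w : seq Omega) (n : nat) : nat :=
  #|[set s : n.-tuple Omega |
      (size w <= n) && (drop (n - size w) s == w) &&
      [forall i : 'I_n, (i < n - size w) ==> ~~ occurs_at w s i]]|.

Definition bcor (Omega : eqType) (w : seq Omega) (i : nat) : bool :=
  drop (size w - i) w == take i w.

Definition cor (Omega : eqType) (w : seq Omega) : nat :=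
  \sum_(1 <= i < (size w).+1) (bcor w i) * 2 ^ i.-1.

(* Main.v *)
Require Import Defs.
From mathcomp Require Import all_boot all_order all_algebra.
From mathcomp Require Import zify ring lra.
From Stdlib Require BinInt.
Set Implicit Arguments. Unset Strict Implicit. Unset Printing Implicit Defensive.

(** Write k = |w|.  The words of length n that start and end with w and contain it nowhere
    else number y(n) = q h(n-1) - h(n) for n > k, so with e = h_w - h_{w'} the sequence e obeys
    e(n+1) = q e(n) + y'(n+1) - y(n+1).  It suffices to find e(j) < 0 for some j and to show
    that e, once positive, stays positive: if e were nonpositive forever, the number of words
    of length n avoiding w would be at least q^(n-j), but it is o(q^n).

    If k > k', or if w' has no proper period, or if w is constant, then y(n+k) <= h(n) and
    a direct lower bound for y' give e(n+k) >= q e(n+k-1) - e(n), with (q-1) e(n-1) in place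
    of e(n) for constant w, and positivity persists.

    Otherwise let p be the first period of w that w' does not share, and call a period
    primitive when it is not a sum of smaller ones: these are the a with y(k+a) = 1.  Their
    indicator is, below k, the convolution inverse of the autocorrelation, so that y(n+k) is
    h(n) minus the sum of h(n-a) over primitive a plus a sum of y(n+k-a-b) over primitive a
    and periods b with a + b >= k.  The pairs (a, b) that are not common to w and w' are few
    by the Fine-Wilf theorem, and their contribution is dominated by the superincreasing
    property h(n) >= h(n-1) + ... + h(n-k+1).  This gives
    e(n+k) >= q e(n+k-1) - max(e(n), 0) - K max(e(j), 0 : j <= n-k) for n >= n0, hence growth
    by a factor 3/2, provided that e <= 0 up to n0 + k.  The latter is shown by an induction
    driven by the avoiding counts, except for binary words with k <= 11, where it is checked
    on all candidate sets of periods. *)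

(** Binary alphabets leave no slack: the superincreasing property of h can fail at first, because
    each primitive period of w costs one unit between k and 2k, and is secured only from 3k - 1 on.
    Hence the growth estimate starts at a multiple n0 of k, and the range below n0 + k needs its own
    argument. There three quarters of the surplus that w draws from its primitive periods, measured
    by avoiding counts, pay for the pairs (a, b); the last quarter must cover the difference of the
    avoiding counts. After summation by parts both are bounded by multiples of -e(2k - 1), and
    q^(k+1) is compared with a quadratic in k plus 5 (q^(k-p+1) - q)/(q - 1). For q = 2 this is
    available when p > 2 and k >= 12; for p = 2 the values of e are followed explicitly.

    The least period g of w selects the estimate. If g = p, no primitive period lies below p, and
    apart from primitive partners beyond p a single pair (p, b) remains. If g < p, Fine-Wilf forces
    p + g >= k + 2, so the pairs reach far back, where h is small. In both cases the term e(n - p)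
    is controlled by running the recurrence between n - p and n. *)

Section Counting.
Variable Omega : finType.
Implicit Types (P Q : pred (seq Omega)) (w s t u : seq Omega).

Definition cnt n P : nat := \sum_(s : n.-tuple Omega) (P s : nat).

Lemma cnt_le n P Q : (forall s, size s = n -> P s -> Q s) -> cnt n P <= cnt n Q.
Proof.
move=> PQ; apply: leq_sum => s _; case Ps: (P s) => //=.
by rewrite PQ ?size_tuple.
Qed.

Lemma sum_cat n m (F : seq Omega -> nat) :
  \sum_(t : (n + m).-tuple Omega) F (tval t) =
  \sum_(s : n.-tuple Omega) \sum_(u : m.-tuple Omega) F (s ++ u).
Proof.
rewrite pair_big /=.
have sz1 (t : (n + m).-tuple Omega) : size (take n t) == n.
  by rewrite size_take size_tuple; case: ltngtP => //; lia.
have sz2 (t : (n + m).-tuple Omega) : size (drop n t) == m.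
  by rewrite size_drop size_tuple addKn.
rewrite (reindex (fun p : n.-tuple Omega * m.-tuple Omega => cat_tuple p.1 p.2)) //=.
exists (fun t : (n + m).-tuple Omega => (Tuple (sz1 t), Tuple (sz2 t))) => [[s u] _|t _] /=.
  by congr (_, _); apply: val_inj; rewrite /= ?take_size_cat ?drop_size_cat ?size_tuple.
by apply: val_inj; rewrite /= cat_take_drop.
Qed.

Lemma sum_tuple1 (F : seq Omega -> nat) :
  \sum_(t : 1.-tuple Omega) F (tval t) = \sum_(c : Omega) F [:: c].
Proof.
rewrite (reindex (fun c : Omega => [tuple c])) //=.
exists (fun t : 1.-tuple Omega => thead t) => [c _|t _] //=.
by apply: val_inj; case/tupleP: t => x t /=; rewrite (tuple0 t).
Qed.

Lemma cnt_rcons n P : cnt n.+1 P = \sum_(c : Omega) cnt n (fun s => P (rcons s c)).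
Proof.
rewrite -addn1 /cnt (sum_cat _ _ (fun s => P s : nat)) exchange_big /= (sum_tuple1 (fun u => \sum_(i : n.-tuple Omega) P (i ++ u))).
by apply: eq_bigr => c _; apply: eq_bigr => s _; rewrite cats1.
Qed.

Lemma cnt_cons n P : cnt n.+1 P = \sum_(c : Omega) cnt n (fun s => P (c :: s)).
Proof.
by rewrite -add1n /cnt (sum_cat _ _ (fun s => P s : nat)) (sum_tuple1 (fun u => \sum_(s : n.-tuple Omega) P (u ++ s))).
Qed.

Lemma cnt_suffix n k P u : size u = k ->
  (forall s v, size s = n -> size v = k -> P (s ++ v) -> v = u) ->
  cnt (n + k) P = cnt n (fun s => P (s ++ u)).
Proof.
move=> /eqP szu Pu; rewrite /cnt (sum_cat _ _ (fun s => P s : nat)); apply: eq_bigr => s _.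
rewrite (bigD1 (Tuple szu)) //= big1 ?addn0 // => v ne.
case E: (P (s ++ v)) => //; case/negP: ne; apply/eqP/val_inj => /=.
by apply: Pu E; rewrite size_tuple.
Qed.

Lemma cnt_prefix n k P u : size u = k ->
  (forall s v, size s = n -> size v = k -> P (v ++ s) -> v = u) ->
  cnt (k + n) P = cnt n (fun s => P (u ++ s)).
Proof.
move=> /eqP szu Pu; rewrite /cnt (sum_cat _ _ (fun s => P s : nat)) exchange_big; apply: eq_bigr => s _.
rewrite (bigD1 (Tuple szu)) //= big1 ?addn0 // => v ne.
case E: (P (v ++ s)) => //; case/negP: ne; apply/eqP/val_inj => /=.
by apply: Pu E; rewrite size_tuple.
Qed.

(** * Avoiding words and first hits *)

Definition avd w s := all (fun i => ~~ occurs_at w s i) (iota 0 (size s)).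
Definition hit w s :=
  [&& size w <= size s, drop (size s - size w) s == w
    & all (fun i => ~~ occurs_at w s i) (iota 0 (size s - size w))].

Lemma hE w n : h w n = cnt n (hit w).
Proof.
rewrite /h cardsE -sum1_card big_mkcond; apply: eq_bigr => s _.
rewrite unfold_in /= /hit size_tuple.
have -> : all (fun i => ~~ occurs_at w s i) (iota 0 (n - size w)) =
   [forall i : 'I_n, (i < n - size w) ==> ~~ occurs_at w s i].
  apply/allP/forallP => [H i|H i].
    by apply/implyP => ilt; apply: H; rewrite mem_iota.
  rewrite mem_iota /= add0n => ilt.
  have ilt' : i < n by lia.
  by have /implyP := H (Ordinal ilt'); apply.
by rewrite andbA; case: ifP.
Qed.

Lemma occurs_at_take w s m i : i + size w <= m -> m <= size s ->
  occurs_at w (take m s) i = occurs_at w s i.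
Proof.
move=> im ms; rewrite /occurs_at size_takel // im (leq_trans im ms) /=.
by rewrite !take_drop take_takel //; lia.
Qed.

Lemma occurs_at_catl w s t i : i + size w <= size s ->
  occurs_at w (s ++ t) i = occurs_at w s i.
Proof.
move=> le; rewrite -[in RHS](take_size_cat t (erefl (size s))) occurs_at_take //.
by rewrite size_cat leq_addr.
Qed.

Lemma occurs_at_catr w u s i : occurs_at w (u ++ s) (size u + i) = occurs_at w s i.
Proof. by rewrite /occurs_at size_cat -addnA leq_add2l (addnC _ i) -drop_drop drop_size_cat. Qed.

Lemma occurs_at_end w s : size w <= size s ->
  occurs_at w s (size s - size w) = (drop (size s - size w) s == w).
Proof.
move=> le; rewrite /occurs_at subnK // leqnn /= take_oversize //.
by rewrite size_drop subKn.
Qed.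

Lemma occurs_at_suffix w s : occurs_at w (s ++ w) (size s).
Proof. by rewrite -[X in occurs_at _ _ X]addn0 occurs_at_catr /occurs_at add0n leqnn drop0 take_size eqxx. Qed.

Lemma hitP w s : reflect [/\ size w <= size s, occurs_at w s (size s - size w)
    & forall i, i < size s - size w -> ~~ occurs_at w s i] (hit w s).
Proof.
apply: (iffP and3P) => [[le ds /allP H]|[le ds H]]; split=> //.
- by rewrite occurs_at_end.
- by move=> i lti; apply: H; rewrite mem_iota.
- by rewrite -occurs_at_end.
- by apply/allP => i; rewrite mem_iota => lti; apply: H.
Qed.

Lemma occurs_at_oob w s i : size s < i + size w -> occurs_at w s i = false.
Proof. by rewrite /occurs_at => lt; rewrite leqNgt lt. Qed.

Lemma avdP w s : 0 < size w -> reflect (forall i, ~~ occurs_at w s i) (avd w s).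
Proof.
move=> w0; apply: (iffP allP) => H i => [|_]; last exact: H.
case: (ltnP i (size s)) => le; first by apply: H; rewrite mem_iota.
by rewrite occurs_at_oob //; lia.
Qed.

(** An occurrence created by the new letter ends at that letter. So an extension of an avoiding word
    either avoids w or hits it for the first time, and an extension of any other word does
    neither. *)
Lemma avd_rcons w s c : 0 < size w ->
  (avd w s : nat) = avd w (rcons s c) + hit w (rcons s c).
Proof.
move=> w0.
have occ i : i + size w <= size s -> occurs_at w (rcons s c) i = occurs_at w s i.
  by move=> le; rewrite -cats1 occurs_at_catl.
case: (avdP s w0) => [a|na].
  case: (avdP (rcons s c) w0) => [/(_ ((size s).+1 - size w)) a'|na'].
    by case: hitP => //=; rewrite size_rcons => -[_ h1]; rewrite h1 in a'.
  case: hitP => //= -[].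
  have [i oi] : exists i, occurs_at w (rcons s c) i.
    case: (boolP (has (occurs_at w (rcons s c)) (iota 0 (size s).+1))) => [/hasP[i _ ?]|/hasPn H].
      by exists i.
    case: na' => i; case: (ltnP i (size s).+1) => le; first by apply: H; rewrite mem_iota.
    by rewrite occurs_at_oob // size_rcons; lia.
  have le1 : i + size w <= size (rcons s c) by case/andP: oi.
  have ie : i = size (rcons s c) - size w.
    rewrite size_rcons in le1 *; case: (leqP (i + size w) (size s)) => le; last by lia.
    by have := a i; rewrite -occ // oi.
  rewrite -ie; split=> // [|j lj]; first by lia.
  by rewrite occ //; rewrite size_rcons in ie; lia.
case: (avdP (rcons s c) w0) => [a'|na'].
  case: na => i; case: (leqP (i + size w) (size s)) => le; first by rewrite -occ.
  by rewrite /occurs_at leqNgt le.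
case: hitP => //= -[le o H]; case: na => i.
case: (leqP (i + size w) (size s)) => le'; last by rewrite /occurs_at leqNgt le'.
by rewrite -occ //; apply: H; rewrite size_rcons; lia.
Qed.

Definition av w n := cnt n (avd w).

Lemma avS w n : 0 < size w -> #|Omega| * av w n = av w n.+1 + h w n.+1.
Proof.
move=> w0; rewrite hE /av !cnt_rcons -big_split /= -sum_nat_const.
apply: eq_bigr => c _; rewrite /cnt -big_split; apply: eq_bigr => s _.
exact: avd_rcons.
Qed.

Lemma av0 w : 0 < size w -> av w 0 = 1.
Proof.
move=> w0; rewrite /av /cnt (bigD1 [tuple]) //= big1 // => s /eqP.
by rewrite (tuple0 s).
Qed.

Lemma h_small w n : n < size w -> h w n = 0.
Proof.
move=> lt; rewrite hE /cnt big1 // => s _; rewrite /hit size_tuple.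
by rewrite leqNgt lt.
Qed.

Lemma h_size w : h w (size w) = 1.
Proof.
rewrite hE -[size w]add0n (@cnt_suffix _ _ _ w) //.
  rewrite /cnt (bigD1 [tuple]) //= big1 => [|s /eqP]; last by rewrite (tuple0 s).
  by rewrite /hit subnn drop0 leqnn eqxx.
move=> [|//] v _ sv /=; case/hitP => _; rewrite sv subnn /occurs_at drop0.
by rewrite -sv take_size => /andP[_ /eqP].
Qed.

(* The border of length i is the period k - i, so that [per w 0], the leading bit b_k of the
   autocorrelation, always holds. *)
Definition per w b := bcor w (size w - b).

Lemma perE w b : b <= size w -> per w b = (drop b w == take (size w - b) w).
Proof. by move=> le; rewrite /per /bcor subKn. Qed.

Lemma hit_take w s b : b <= size s ->
  hit w (take (size s + size w - b) (s ++ w)) =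
  occurs_at w (s ++ w) (size s - b) &&
    all (fun i => ~~ occurs_at w (s ++ w) i) (iota 0 (size s - b)).
Proof.
move=> bs; have sz : size (take (size s + size w - b) (s ++ w)) = size s + size w - b.
  by rewrite size_takel // size_cat leq_subr.
have szE : size s + size w - b - size w = size s - b by lia.
have occ i : i <= size s - b ->
  occurs_at w (take (size s + size w - b) (s ++ w)) i = occurs_at w (s ++ w) i.
  by move=> le; rewrite occurs_at_take // ?size_cat; lia.
apply/hitP/andP => [|[o /allP H]]; rewrite sz szE.
  rewrite occ // => -[_ -> H]; split=> //; apply/allP => i; rewrite mem_iota => lt.
  by rewrite -occ ?H // ltnW.
rewrite occ //; split=> // [|i lt]; first by lia.
by rewrite occ 1?ltnW // H // mem_iota.
Qed.

(** As s avoids w, the first occurrence of w in [s ++ w] starts at [size s - b] for one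
    [b < size w]; cutting right after it gives the only prefix that is a first hit. *)
Lemma av_hit_take w s : avd w s -> 0 < size w ->
  \sum_(0 <= b < size w) hit w (take (size s + size w - b) (s ++ w)) = 1.
Proof.
move=> a w0; have {}a := elimT (avdP s w0) a.
have ex : exists i, occurs_at w (s ++ w) i by exists (size s); apply: occurs_at_suffix.
case: (ex_minnP ex) => i oi imin.
have is_ : i <= size s by apply: imin; apply: occurs_at_suffix.
have ik : size s < i + size w.
  by rewrite ltnNge; apply/negP => le; rewrite occurs_at_catl // (negbTE (a i)) in oi.
have bl : size s - i < size w by lia.
rewrite big_mkord (bigD1 (Ordinal bl)) //= big1 => [|b ne].
  rewrite hit_take; last by lia.
  rewrite (_ : size s - (size s - i) = i); last by lia.
  rewrite oi; case: allP => // -[] j; rewrite mem_iota => /= lt.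
  by apply/negP => /imin; lia.
case: (leqP b (size s)) => bs; last first.
  apply/eqP; rewrite eqb0; apply/hitP => -[].
  by rewrite size_takel ?size_cat; lia.
rewrite hit_take //; apply/eqP; rewrite eqb0; apply/negP => /andP[o /allP H].
have := imin _ o; move=> le.
have ne' : i <> size s - b.
  by move=> ie; case/eqP: ne; apply: val_inj => /=; lia.
suff lt : i < size s - b by have := H i; rewrite mem_iota oi /= add0n lt => /(_ isT).
by lia.
Qed.

Lemma cat_eq_suffix s t u w : s ++ u = t ++ w -> size u <= size w ->
  u = drop (size w - size u) w.
Proof.
move=> E le; have sE : size s = size w - size u + size t.
  by have := congr1 size E; rewrite !size_cat; lia.
have := drop_size_cat u (erefl (size s)).
by rewrite E sE -drop_drop drop_size_cat.
Qed.

Lemma hit_cat w s u : hit w (s ++ u) -> size u <= size w ->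
  u = drop (size w - size u) w.
Proof.
move=> /and3P[_ /eqP E _]; apply: (@cat_eq_suffix s (take (size (s ++ u) - size w) (s ++ u))).
by rewrite -{2}E cat_take_drop.
Qed.

(** Append w to an avoiding word and cut after the first occurrence. That occurrence overlaps the
    appended w with shift b, so b is a period. Conversely, a first-hit word of length n + k - b ends
    with [drop b w], and removing this nonempty end leaves an avoiding word. *)
Lemma av_decomp w n : 0 < size w ->
  av w n = \sum_(0 <= b < size w) per w b * h w (n + size w - b).
Proof.
move=> w0; rewrite /av /cnt.
rewrite (eq_bigr (fun s : n.-tuple Omega => \sum_(0 <= b < size w)
    (avd w s && hit w (take (n + size w - b) (s ++ w)) : nat))); last first.
  move=> s _; case a: (avd w s); last by rewrite big1.
  by rewrite -{1}(size_tuple s) av_hit_take.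
rewrite exchange_big /=; rewrite big_nat [RHS]big_nat; apply: eq_bigr => b bk.
rewrite hE (_ : n + size w - b = n + (size w - b)); last by lia.
rewrite (@cnt_suffix _ _ _ (drop b w)); last 2 first.
- by rewrite size_drop.
- move=> s v ss sv /hit_cat; rewrite sv => E.
  by rewrite [LHS]E ?leq_subr // subKn // ltnW.
rewrite big_distrr; apply: eq_bigr => s _ /=.
have tE : take (n + (size w - b)) (s ++ w) = s ++ take (size w - b) w.
  by rewrite take_cat size_tuple ltnNge leq_addr /= addKn.
rewrite tE perE; last by lia.
case: eqP => [<-|ne]; last first.
  rewrite mul0n; apply/eqP; rewrite eqb0 negb_and; apply/orP; right.
  apply/negP => /hit_cat; rewrite size_takel ?leq_subr // subKn 1?ltnW // => /(_ isT) E.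
  by apply: ne; rewrite E.
rewrite mul1n; case: hitP => [[le _ H]|_]; last by rewrite andbF.
rewrite andbT; case: avdP => // -[] i.
case: (leqP (i + size w) (size s)) => le'; last by rewrite /occurs_at leqNgt le'.
by rewrite -(occurs_at_catl (drop b w)) //; apply: H; rewrite size_cat size_drop; lia.
Qed.

End Counting.

(** * Periods *)

Section Periods.
Variable Omega : finType.
Implicit Types (w s : seq Omega).

(** Deleting the first letter of a first-hit word longer than w leaves a first-hit word. *)
Lemma h_mul w n : size w <= n -> h w n.+1 <= #|Omega| * h w n.
Proof.
move=> le; rewrite !hE cnt_cons -sum_nat_const; apply: leq_sum => c _.
apply: cnt_le => s ss /hitP[_ o H]; apply/hitP; split; first by rewrite ss.
- move: o; rewrite /= -(occurs_at_catr w [:: c] s) /= add1n subSn ?ss //.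
- move=> i lt; rewrite -(occurs_at_catr w [:: c] s) /= add1n; apply: H => /=.
  by rewrite subSn ?ss // ltnS -ss.
Qed.

Lemma occurs_at_nth x0 w s i : occurs_at w s i ->
  forall m, m < size w -> nth x0 s (i + m) = nth x0 w m.
Proof. by case/andP=> _ /eqP E m lt; rewrite -[in RHS]E nth_take // nth_drop. Qed.

Lemma perP x0 w b : b <= size w ->
  reflect (forall i, i + b < size w -> nth x0 w i = nth x0 w (i + b)) (per w b).
Proof.
move=> le; rewrite perE //; apply: (iffP eqP) => [E i lt|H].
  have lt' : i < size w - b by lia.
  by rewrite -(nth_take x0 lt' w) -E nth_drop addnC.
apply: (@eq_from_nth _ x0); first by rewrite size_drop size_takel ?leq_subr.
move=> i; rewrite size_drop => lt; rewrite nth_drop nth_take // addnC.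
by rewrite -H //; lia.
Qed.

Lemma per0 w : per w 0.
Proof. by rewrite perE // drop0 subn0 take_size. Qed.

(* The j-windows of a word of period j are cyclic shifts of each other. *)
Lemma per_window x0 w j d m : (forall i, i + j < size w -> nth x0 w i = nth x0 w (i + j)) ->
  0 < j -> d + m + j <= size w ->
  (forall i, m < i < m + j -> nth x0 w (i + d) = nth x0 w i) ->
  nth x0 w (m + d) = nth x0 w m.
Proof.
move=> pj j0 le H; set F := fun i => (nth x0 w i == nth x0 w m : nat).
have shift r : r + m + j <= size w ->
  \sum_(0 <= i < j) F (r + m + i) = \sum_(0 <= i < j) F (m + i).
  elim: r => [|r IH] leu; first by [].
  rewrite -IH; last by lia.
  case: j j0 pj {le H IH} leu => // j _ pj leu.
  rewrite big_nat_recr // big_nat_recl //= addnC; congr (_ + _).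
    rewrite /F addn0; congr ((_ == _) : nat); apply/esym.
    by rewrite pj; [congr nth; lia | lia].
  by apply: eq_bigr => i _; congr F; lia.
have := shift d le; rewrite [d + m]addnC => /esym.
case: j j0 {pj shift} le H => // j _ le H.
rewrite big_nat_recl // [in X in _ = X]big_nat_recl // !addn0.
rewrite (_ : \sum_(0 <= i < j) F (m + d + i.+1) = \sum_(0 <= i < j) F (m + i.+1)).
  by move/addIn; rewrite /F eqxx => /esym/eqP; rewrite eqb1 => /eqP.
rewrite big_nat [RHS]big_nat; apply: eq_bigr => i /andP[_ ij]; rewrite /F.
by rewrite -(H (m + i.+1)) -?addnA ?[d + _]addnC //; lia.
Qed.

(** Both letters are read off w, at the indices [size w - j] and [size w - j']. The occurrence at j
    makes j a period of w, and the two occurrences together show that the windows of length j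
    starting at these indices agree after their first letter; [per_window] then settles the first
    letter. *)
Lemma bad_letter_uniq w s c c' j j' : 0 < j -> j < j' -> j' <= size w ->
  occurs_at w (w ++ c :: s) j -> occurs_at w (w ++ c' :: s) j' -> c = c'.
Proof.
move=> j0 jj' j'k /(occurs_at_nth c) o /(occurs_at_nth c) o'.
have -> : c = nth c w (size w - j).
  rewrite -o; last by lia.
  by rewrite nth_cat ltnNge subnKC ?leqnn ?subnn //; lia.
have -> : c' = nth c w (size w - j').
  rewrite -o'; last by lia.
  by rewrite nth_cat ltnNge subnKC ?leqnn ?subnn //; lia.
rewrite (_ : size w - j = size w - j' + (j' - j)); last by lia.
apply: (@per_window _ _ j) => //; last 2 first.
- by lia.
- move=> i /andP[i1 i2]; rewrite -o; last by lia.
  rewrite -[RHS]o'; last by lia.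
  rewrite !nth_cat !ltnNge (_ : size w <= _); last by lia.
  rewrite (_ : size w <= j' + i) /=; last by lia.
  have -> : j + (i + (j' - j)) - size w = (j' + i - size w).-1.+1 by lia.
  by have -> : j' + i - size w = (j' + i - size w).-1.+1 by lia.
move=> i ij; rewrite -o; last by lia.
by rewrite nth_cat addnC ij.
Qed.

Lemma bad_letter w s c : 0 < size w -> hit w s -> ~~ hit w (behead w ++ c :: s) ->
  exists2 j, 0 < j <= size w & occurs_at w (w ++ c :: s) j.
Proof.
case: w => // a w _ /hitP[le o H] nh.
have occS i : occurs_at (a :: w) ((a :: w) ++ c :: s) i.+1 =
              occurs_at (a :: w) (w ++ c :: s) i.
  exact: (occurs_at_catr _ [:: a]).
have occ i : occurs_at (a :: w) (w ++ c :: s) ((size w).+1 + i) = occurs_at (a :: w) s i.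
  by rewrite -(occurs_at_catr (a :: w) (rcons w c) s) cat_rcons size_rcons.
case: (boolP (has (occurs_at (a :: w) (w ++ c :: s)) (iota 0 (size w).+1))) => [/hasP[i]|/hasPn nb].
  by rewrite mem_iota => lt oi; exists i.+1; rewrite ?occS //=; lia.
case/hitP: nh; split; rewrite ?size_cat /=.
- by lia.
- rewrite (_ : size w + (size s).+1 - _ = (size w).+1 + (size s - (size (a :: w)))) /=; last by rewrite /= in le *; lia.
  by rewrite occ.
- move=> i lt; case: (ltnP i (size w).+1) => ik; first by apply: nb; rewrite mem_iota.
  rewrite -(subnKC ik) occ; apply: H => /=; lia.
Qed.

(* In the words w c s with s counted by [h w n], at most one letter c creates a further
   occurrence of w; hence q h(n+k) - h(n+k+1) >= (q - 1) h(n). *)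
Lemma h_append w n : 0 < size w -> size w <= n ->
  h w (n + size w).+1 + #|Omega|.-1 * h w n <= #|Omega| * h w (n + size w).
Proof.
move=> w0 le.
have -> : #|Omega| * h w (n + size w) = cnt (n + size w).+1 (fun t => hit w (behead t)).
  by rewrite hE cnt_cons /= sum_nat_const.
have -> : cnt (n + size w).+1 (fun t => hit w (behead t)) =
    h w (n + size w).+1 + cnt (n + size w).+1 (fun t => hit w (behead t) && ~~ hit w t).
  rewrite hE /cnt -big_split; apply: eq_bigr => /= t _.
  case E: (hit w t) => /=; last by rewrite andbT.
  rewrite andbF addn0; move: E (size_tuple t); case: (tval t) => //= c s /hitP[l o H] [ss].
  suff -> : hit w s by [].
  apply/hitP; split; first by rewrite ss; lia.
  - move: o; rewrite /= -(occurs_at_catr w [:: c] s) /= add1n subSn ?ss //; lia.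
  - move=> i lt; rewrite -(occurs_at_catr w [:: c] s) /= add1n; apply: H => /=.
    by rewrite subSn ?ss ?ltnS -?ss //; lia.
rewrite leq_add2l.
set P := fun t => _ && _.
apply: (@leq_trans (cnt (size w + n.+1) (fun t => (take (size w) t == w) && P t))); last first.
  by rewrite addnS (addnC (size w)); apply: cnt_le => t _ /andP[].
rewrite (@cnt_prefix _ _ _ _ w) //; last first.
  by move=> s v _ sv /andP[/eqP]; rewrite -sv take_size_cat.
rewrite cnt_cons hE /cnt exchange_big big_distrr /=; apply: leq_sum => s _.
case hs: (hit w s); last by rewrite muln0.
rewrite muln1.
have PE c : P (w ++ c :: s) = hit w (behead w ++ c :: s).
  have E : behead (w ++ c :: s) = behead w ++ c :: s by case: (w) w0.
  rewrite /P E.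
  case hit => //=; apply/negP => /hitP[_ _ /(_ 0)].
  rewrite size_cat /= size_tuple => /(_ _)/negP F; apply: F; first by lia.
  by rewrite occurs_at_catl /occurs_at ?add0n ?leqnn // drop0 take_size eqxx.
under eq_bigr => c _ do rewrite take_size_cat // eqxx PE /=.
set good := fun c => hit w (behead w ++ c :: s).
have [allg|] := boolP [forall c, good c].
  rewrite (eq_bigr (fun=> 1)) => [|c _]; last by rewrite (forallP allg c : hit _ _).
  by rewrite sum1_card leq_pred.
rewrite negb_forall => /existsP[c0 b0].
rewrite (bigD1 c0) //= (eq_bigr (fun=> 1)) => [|c ne].
  by rewrite sum1_card -(cardC1 c0) leq_addl.
apply/eqP; rewrite eqb1; apply/negPn/negP => b1.
have [j /andP[j0 jk] oj] := bad_letter w0 hs b0.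
have [j' /andP[j0' jk'] oj'] := bad_letter w0 hs b1.
case/eqP: ne; case: (ltngtP j j') => jj.
- by apply/esym; apply: bad_letter_uniq j0 jj jk' oj oj'.
- by apply: bad_letter_uniq j0' jj jk oj' oj.
move: oj oj'; rewrite -jj => /(occurs_at_nth c) o /(occurs_at_nth c) o'.
have lt : size w - j < size w by lia.
have := o _ lt; rewrite -o' // !nth_cat subnKC // ltnn subnn //=.
Qed.

Lemma per_add w a b : per w a -> per w b -> a + b <= size w -> per w (a + b).
Proof.
case: w => [|x0 w] pa pb le; first by move: le; case: a b pa pb => // -[].
have la : a <= size (x0 :: w) by apply: leq_trans le; apply: leq_addr.
have lb : b <= size (x0 :: w) by apply: leq_trans le; apply: leq_addl.
apply/(perP x0) => // i lt.
have /(perP x0 la) Ha := pa; have /(perP x0 lb) Hb := pb.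
by rewrite addnA -Hb -?Ha //; lia.
Qed.
End Periods.

(** * The theorem of Fine and Wilf *)

Section FineWilf.
Variables (T : Type) (f : nat -> T).

Definition fper n a := forall i, i + a < n -> f i = f (i + a).

Lemma fper_mul n g m : fper n g -> fper n (m * g).
Proof.
move=> pg; elim: m => [|m IH] i lt; first by rewrite addn0.
by rewrite mulSn addnA -IH -?pg //; lia.
Qed.

(** Euclid's algorithm: the first n - a values have periods a and b - a, hence by induction the
    period gcd(a, b). *)
Lemma fine_wilf n a b : 0 < a -> 0 < b -> fper n a -> fper n b ->
  a + b <= n + gcdn a b -> fper n (gcdn a b).
Proof.
have [m] := ubnP (a + b); elim: m n a b => // m IH n a b mab a0 b0.
wlog le : a b mab a0 b0 / a <= b.
  move=> W pa pb leg; case/orP: (leq_total a b) => le; first exact: W.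
  by rewrite gcdnC; apply: W => //; rewrite 1?addnC 1?gcdnC //; lia.
move=> pa pb leg.
have [eab|lt] := eqVneq a b; first by rewrite -eab gcdnn.
have {le lt} lt : a < b by rewrite ltn_neqAle lt.
set g := gcdn a b in leg *.
have gE : gcdn a (b - a) = g by rewrite /g -{2}(subnKC (ltnW lt)) gcdnDl.
have g0 : 0 < g by rewrite gcdn_gt0 a0.
have ga : g <= a by apply: dvdn_leq => //; apply: dvdn_gcdl.
have gba : g <= b - a by rewrite -gE; apply: dvdn_leq; rewrite ?dvdn_gcdr //; lia.
have pg : fper (n - a) g.
  rewrite -gE; apply: IH; rewrite ?gE //; try lia.
  - by move=> i lti; apply: pa; lia.
  - move=> i lti; rewrite pb; last by lia.
    rewrite -[i + b](_ : i + (b - a) + a = _); last by lia.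
    by rewrite -pa //; lia.
(* The period g now spreads from the prefix of length n - a to everything. For i >= a, shift down by
   a. Otherwise i >= a - g, and i + g is reached from i - (a - g) by one step a, while a - g is a
   multiple of g. *)
move=> i; have [l] := ubnP i; elim: l i => // l IHl i il ign.
case: (ltnP (i + g) (n - a)) => igna; first exact: pg.
case: (leqP a i) => ai.
  rewrite -(subnK ai) addnAC -pa; last by lia.
  by rewrite -pa; [apply: IHl; lia | lia].
have ag : g %| a - g by rewrite dvdn_subr ?dvdn_gcdl.
rewrite -[i + g](_ : (i - (a - g)) + a = _); last by lia.
rewrite -pa; last by lia.
have := @fper_mul _ _ ((a - g) %/ g) pg; rewrite divnK // => H.
by rewrite (H (i - _)) ?subnK //; lia.
Qed.
End FineWilf.

Lemma per_gcd (Omega : finType) (w : seq Omega) a b : 0 < a <= size w -> 0 < b <= size w ->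
  per w a -> per w b -> a + b <= size w + gcdn a b -> per w (gcdn a b).
Proof.
case/andP=> a0 ak /andP[b0 bk]; case: w ak bk => [|x0 w] ak bk; first by case: a a0 ak.
move=> /(perP x0 ak) pa /(perP x0 bk) pb le; apply/(perP x0).
  by apply: leq_trans ak; apply: dvdn_leq => //; apply: dvdn_gcdl.
exact: (fine_wilf a0 b0 pa pb le).
Qed.

Import Order.TTheory GRing.Theory Num.Theory.
Local Open Scope ring_scope.

(** * The hitting, avoiding and return sequences *)

Section BigNat.
Variable R : numDomainType.
Implicit Types (F G : nat -> R).

Lemma sum_nat_if F m k a : (m <= a < k)%N ->
  \sum_(m <= i < k) (i == a)%:R * F i = F a.
Proof.
move=> ak; rewrite (bigD1_seq a) ?mem_index_iota ?iota_uniq //= eqxx mul1r big1 ?addr0 //.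
by move=> i /negbTE ->; rewrite mul0r.
Qed.

Lemma sum_nat_ge_term F m k a : (m <= a < k)%N ->
  (forall i, (m <= i < k)%N -> 0 <= F i) -> F a <= \sum_(m <= i < k) F i.
Proof.
move=> ak F0; rewrite (bigD1_seq a) ?mem_index_iota ?iota_uniq //= lerDl.
by rewrite big_seq_cond sumr_ge0 // => i /andP[]; rewrite mem_index_iota => /F0.
Qed.

Lemma sum_nat_ge_term2 F m k a b : (m <= a < k)%N -> (m <= b < k)%N -> a != b ->
  (forall i, (m <= i < k)%N -> 0 <= F i) -> F a + F b <= \sum_(m <= i < k) F i.
Proof.
move=> ak bk ab F0; rewrite (bigD1_seq a) ?mem_index_iota ?iota_uniq //= lerD2l.
rewrite big_mkcond [leRHS](bigD1_seq b) ?mem_index_iota ?iota_uniq //= eq_sym ab lerDl.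
rewrite big_seq_cond sumr_ge0 // => i /andP[]; rewrite mem_index_iota => /F0 Fi _.
by case: ifP.
Qed.

Lemma sumr_nat_ge0 F m k :
  (forall i, (m <= i < k)%N -> 0 <= F i) -> 0 <= \sum_(m <= i < k) F i.
Proof.
by move=> F0; rewrite big_seq sumr_ge0 // => i; rewrite mem_index_iota => /F0.
Qed.
Lemma sum_nat_cat F m j k : (m <= j <= k)%N ->
  \sum_(m <= i < k) F i = \sum_(m <= i < j) F i + \sum_(j <= i < k) F i.
Proof. by case/andP=> *; apply: big_cat_nat. Qed.

Lemma big_nat_eq0 F m k :
  (forall i, (m <= i < k)%N -> F i = 0) -> \sum_(m <= i < k) F i = 0.
Proof. by move=> F0; rewrite big1_seq // => i; rewrite mem_index_iota => /F0. Qed.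
End BigNat.

Section Words.
Variable Omega : finType.
Hypothesis hq : (1 < #|Omega|)%N.
Implicit Types (w : seq Omega).

Local Notation q := (#|Omega|%:R : rat).

Definition hr w n : rat := (h w n)%:R.
Definition ar w n : rat := (av w n)%:R.
(* For n > size w, the number of words of length n that start and end with w and contain it
   nowhere else; at n = size w the value is -1. *)
Definition yr w n : rat := q * hr w n.-1 - hr w n.
Definition cr w b : rat := (per w b)%:R.
(* Primitive periods, those with [yr w (size w + a) = 1]: the periods that are not sums of
   smaller ones. *)
Definition prim w a := (0 < a)%N && (h w (size w + a) < #|Omega| * h w (size w + a).-1)%N.
Definition pr w a : rat := (prim w a)%:R.
(** The terms of degree at least k in the product of the indicator series of primitive periods and
    of periods, weighted by E: the remainder left by an inversion that is exact only below degree
    k. *)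
Definition wrapsum w (E : nat -> rat) : rat :=
  \sum_(0 <= a < size w) \sum_(0 <= b < size w) (size w <= a + b)%N%:R * (pr w a * cr w b * E (a + b)%N).

Lemma hr_ge0 w n : 0 <= hr w n. Proof. exact: ler0n. Qed.
Lemma ar_ge0 w n : 0 <= ar w n. Proof. exact: ler0n. Qed.
Lemma cr_ge0 w n : 0 <= cr w n. Proof. exact: ler0n. Qed.
Lemma cr_le1 w n : cr w n <= 1. Proof. by rewrite lern1 leq_b1. Qed.
Lemma pr_ge0 w n : 0 <= pr w n. Proof. exact: ler0n. Qed.
Lemma pr_le1 w n : pr w n <= 1. Proof. by rewrite lern1 leq_b1. Qed.
Lemma cr0 w : cr w 0 = 1. Proof. by rewrite /cr per0. Qed.
Lemma pr0 w : pr w 0 = 0. Proof. by []. Qed.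

Section OneWord.
Variable w : seq Omega.
Hypothesis w0 : (0 < size w)%N.
Let k := size w.

Lemma hr_small n : (n < k)%N -> hr w n = 0.
Proof. by move=> lt; rewrite /hr h_small. Qed.

Lemma hr_size : hr w k = 1. Proof. by rewrite /hr h_size. Qed.

Lemma yr_small n : (n < k)%N -> yr w n = 0.
Proof. by move=> lt; rewrite /yr !hr_small ?mulr0 ?subr0 //; lia. Qed.

Lemma yr_size : yr w k = -1.
Proof. by rewrite /yr hr_size hr_small ?mulr0 ?sub0r //; rewrite prednK. Qed.

Lemma yr_nat n : (k < n)%N -> yr w n = (#|Omega| * h w n.-1 - h w n)%N%:R.
Proof.
move=> lt; rewrite /yr /hr -natrM natrB //.
by case: n lt => // n lt; apply: h_mul.
Qed.

Lemma yr_ge0 n : (k < n)%N -> 0 <= yr w n.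
Proof. by move/yr_nat->; apply: ler0n. Qed.

Lemma hrS n : hr w n.+1 = q * hr w n - yr w n.+1.
Proof. by rewrite /yr /= opprB addrC subrK. Qed.

Lemma ar_hr n : q * ar w n = ar w n.+1 + hr w n.+1.
Proof. by rewrite /ar /hr -natrM -natrD avS. Qed.

Lemma ar_decomp n : ar w n = \sum_(0 <= b < k) cr w b * hr w (n + k - b).
Proof.
rewrite /ar av_decomp // natr_sum; apply: eq_bigr => b _.
by rewrite natrM.
Qed.

(** This is q times [ar_decomp] at n - 1 minus [ar_decomp] at n: avoiding counts turn into h, and h
    turns into y. *)
Lemma hr_decomp n : (0 < n)%N -> hr w n = \sum_(0 <= b < k) cr w b * yr w (n + k - b).
Proof.
case: n => // n _; have -> : hr w n.+1 = q * ar w n - ar w n.+1 by rewrite ar_hr addrC addKr.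
rewrite !ar_decomp mulr_sumr -sumrB; apply: eq_big_nat => b /andP[_ bk].
rewrite /yr (_ : (n.+1 + k - b).-1 = n + k - b)%N; last by lia.
by rewrite mulrBr mulrCA.
Qed.

(** For k <= n every index in [hr_decomp] exceeds k, where y is nonnegative, so the sum dominates
    its term b = 0. *)
Lemma yr_le n : (k <= n)%N -> yr w (n + k) <= hr w n.
Proof.
move=> le; rewrite [leRHS]hr_decomp; last by lia.
rewrite -[leLHS]mul1r -[X in X * _](cr0 w) -[X in yr w X]subn0.
apply: (@sum_nat_ge_term _ (fun b => cr w b * yr w (n + k - b))); first by lia.
by move=> i ik; rewrite mulr_ge0 ?cr_ge0 ?yr_ge0 //; lia.
Qed.

(** Here h(j) = 0, and the term b = j of its decomposition contains y(k) = -1; moving that term to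
    the other side gives the relation. *)
Lemma yr_conv j : (0 < j < k)%N -> \sum_(0 <= b < j) cr w b * yr w (j + k - b) = cr w j.
Proof.
move=> jk; have jk' : (j < k)%N by lia.
have := @hr_decomp j; rewrite hr_small // => /(_ _)/esym.
rewrite (@sum_nat_cat _ _ 0 j k); last by lia.
rewrite (@big_ltn _ _ _ j) // addKn yr_size mulrN1 [X in _ + (_ + X)]big_nat_eq0 => [|i ij].
  by rewrite addr0 => E; apply/eqP; rewrite -subr_eq0 E //; lia.
by rewrite yr_small ?mulr0 //; lia.
Qed.

(** The term b = 0 of [yr_conv] bounds the nonnegative integer y(j + k) by 1, and [prim] tests
    whether it is positive. *)
Lemma yr_pr j : (0 < j < k)%N -> yr w (j + k) = pr w j.
Proof.
move=> jk; have : yr w (j + k) <= 1.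
  apply: le_trans (cr_le1 w j); rewrite -(yr_conv jk).
  rewrite -[leLHS]mul1r -[X in X * _](cr0 w) -[X in yr w X]subn0.
  apply: (@sum_nat_ge_term _ (fun b => cr w b * yr w (j + k - b))); first by lia.
  by move=> i ik; rewrite mulr_ge0 ?cr_ge0 ?yr_ge0 //; lia.
rewrite yr_nat; last by lia.
rewrite lern1 /pr /prim -/k (addnC k j) -[X in _ && X]subn_gt0 => le1.
have -> /= : (0 < j)%N by lia.
by move: le1; case: (_ - _)%N => [|[|]].
Qed.

Lemma prim_conv j : (0 < j < k)%N -> \sum_(0 <= a < j.+1) pr w a * cr w (j - a) = cr w j.
Proof.
move=> jk; rewrite big_nat_recl // pr0 mul0r add0r -[RHS](yr_conv jk) big_nat_rev /=.
apply: eq_big_nat => i ij; rewrite add0n mulrC (_ : (j - (j - i.+1).+1 = i)%N); last by lia.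
by rewrite -yr_pr; [congr (_ * yr w _); lia | lia].
Qed.

Lemma prim_gt0 a : prim w a -> (0 < a)%N. Proof. by case/andP. Qed.

Lemma prim_per a : (a < k)%N -> prim w a -> per w a.
Proof.
move=> ak pa; have a0 := prim_gt0 pa; have ak' : (0 < a < k)%N by rewrite a0.
have := prim_conv ak'; rewrite big_nat_recr // subnn cr0 mulr1 /=.
rewrite /cr; case: (per w a) => //=.
have -> : pr w a = 1 by rewrite /pr pa.
move/eqP; rewrite paddr_eq0 ?oner_eq0 ?andbF //.
by apply: sumr_nat_ge0 => i _; rewrite mulr_ge0 ?pr_ge0 ?ler0n.
Qed.

(** Otherwise the sum [prim_conv] at a + b, which is at most 1, would contain two terms equal to 1:
    a with the period b, and a + b with the period 0. *)
Lemma prim_indec a b : (a + b < k)%N -> (0 < b)%N -> prim w a -> per w b -> ~~ prim w (a + b).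
Proof.
move=> abk b0 pa pb; apply/negP => pab; have a0 := prim_gt0 pa.
have ak' : (0 < a + b < k)%N by lia.
have /negP[] : ~~ (2 <= cr w (a + b)) by rewrite -ltNge (le_lt_trans (cr_le1 _ _)) // ltr1n.
rewrite -(prim_conv ak').
apply: le_trans (@sum_nat_ge_term2 _ (fun i => pr w i * cr w (a + b - i)) 0 _ a (a + b) _ _ _ _); try lia.
  by rewrite addKn subnn cr0 /pr /cr pa pab pb !mulr1 natr1.
by move=> i _; rewrite mulr_ge0 ?pr_ge0 ?cr_ge0.
Qed.

Lemma per_prim j : (0 < j < k)%N -> per w j ->
  exists a, [/\ (0 < a <= j)%N, prim w a & per w (j - a)].
Proof.
move=> jk pj; have := prim_conv jk; rewrite [RHS]/cr pj => E.
have [/hasP[a]|/hasPn H] := boolP (has (fun a => prim w a && per w (j - a)) (iota 0 j.+1)).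
  rewrite mem_iota => aj /andP[pa pja]; exists a; split=> //.
  by rewrite (prim_gt0 pa) /=; lia.
case/negP: (@oner_neq0 rat); rewrite -[X in X == _]E big_nat_eq0 // => i ij.
have := H i; rewrite mem_iota add0n => /(_ ij).
by rewrite /pr /cr; case: prim; case: per => //= _; rewrite ?mulr0 ?mul0r.
Qed.

Lemma conv_eq (E : nat -> rat) :
  \sum_(0 <= a < k) \sum_(0 <= b < k) pr w a * cr w b * E (a + b)%N =
  \sum_(0 <= s < k) (0 < s)%N%:R * cr w s * E s + wrapsum w E.
Proof.
rewrite /wrapsum -/k.
have split_row a : (a < k)%N -> \sum_(0 <= b < k) pr w a * cr w b * E (a + b)%N =
   \sum_(0 <= s < k) (a <= s)%N%:R * (pr w a * cr w (s - a) * E s) +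
   \sum_(0 <= b < k) (k <= a + b)%N%:R * (pr w a * cr w b * E (a + b)%N).
  move=> ak.
  rewrite [X in _ = X + _](_ : _ = \sum_(0 <= b < k - a) pr w a * cr w b * E (a + b)%N).
    rewrite !(@sum_nat_cat _ _ 0 (k - a) k) ?leq_subr //=.
    rewrite [X in _ = _ + (X + _)]big_nat_eq0 ?add0r => [|i ik]; last first.
      by rewrite (_ : (k <= a + i)%N = false) ?mul0r //; lia.
    congr (_ + _); apply: eq_big_nat => i ik; rewrite (_ : (k <= a + i)%N) ?mul1r //; lia.
  rewrite (@sum_nat_cat _ _ 0 a k); last by lia.
  rewrite big_nat_eq0 ?add0r => [|i ik]; last first.
    by rewrite (_ : (a <= i)%N = false) ?mul0r //; lia.
  rewrite -{1}[a]add0n big_addn; apply: eq_big_nat => i ik.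
  by rewrite leq_addl mul1r addnK addnC.
rewrite (eq_big_nat _ _ (fun a ak => split_row a (proj2 (andP ak)))) big_split /=; congr (_ + _).
rewrite exchange_big_nat /=; apply: eq_big_nat => s /andP[_ sk].
case: (posnP s) => [->|s0].
  rewrite !mul0r big_nat_eq0 // => -[|a] _ //; first by rewrite pr0 !mul0r mulr0.
  by rewrite mul0r.
rewrite mul1r -prim_conv ?s0 // (@sum_nat_cat _ _ 0 s.+1 k) //= [X in _ + X]big_nat_eq0 ?addr0.
  rewrite mulr_suml; apply: eq_big_nat => a /andP[_]; rewrite ltnS => ->.
  by rewrite mul1r.
by move=> a; rewrite ltnNge => /andP[/negbTE -> _]; rewrite mul0r.
Qed.

(** Expanding F(n - a) and applying [conv_eq], where [prim_conv] collapses the degrees below k,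
    turns the weighted sum into the terms b > 0 of F(n) plus the wrapped remainder. It serves for
    the pairs (h, y) in [yr_inv] and (a, h) in [hr_inv]. *)
Lemma inv_conv (F E : nat -> rat) n : (k <= n)%N ->
  (forall m, (n < m + k)%N -> (m <= n)%N -> F m = \sum_(0 <= b < k) cr w b * E (m + k - b)%N) ->
  E (n + k)%N = F n - \sum_(0 <= a < k) pr w a * F (n - a)%N + wrapsum w (fun s => E (n + k - s)%N).
Proof.
move=> kn HF.
have -> : \sum_(0 <= a < k) pr w a * F (n - a)%N =
  \sum_(0 <= a < k) \sum_(0 <= b < k) pr w a * cr w b * E (n + k - (a + b))%N.
  apply: eq_big_nat => a ak; rewrite HF; [|lia|lia].
  rewrite mulr_sumr; apply: eq_big_nat => b bk; rewrite mulrA; congr (_ * E _); lia.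
rewrite (conv_eq (fun s => E (n + k - s)%N)) HF; [|lia|lia].
rewrite opprD addrA subrK.
rewrite (big_ltn w0) [in X in _ = _ - X](big_ltn w0) !mul0r add0r cr0 mul1r subn0.
rewrite -[LHS]addr0 -addrA; congr (_ + _); apply/esym/eqP; rewrite subr_eq0; apply/eqP.
by apply: eq_big_nat => -[|i] ik; rewrite // mul1r.
Qed.

End OneWord.
End Words.

(** * Growth of the hitting and avoiding counts *)

Section Growth.
Variable Omega : finType.
Hypothesis hq : (1 < #|Omega|)%N.
Variable w : seq Omega.
Hypothesis w0 : (0 < size w)%N.
Let k := size w.
Local Notation q := (#|Omega|%:R : rat).
Local Notation hh := (hr w).
Local Notation a := (ar w).
Local Notation y := (yr w).

Let q2 : 2 <= q. Proof. by rewrite ler_nat. Qed.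

(** As q >= 2, it suffices that y(n + 1) <= h(n). From 2k on this is [yr_le] with the induction
    hypothesis; between k and 2k, y is at most 1 = h(k). *)
Lemma hr_nondec i j : (i <= j)%N -> hh i <= hh j.
Proof.
suff S n : forall i, (i <= n)%N -> hh i <= hh n by move/S.
elim/ltn_ind: n {i j} => n IH i.
case: n IH => [|n] IH; first by rewrite leqn0 => /eqP ->.
rewrite leq_eqVlt => /orP[/eqP -> //|]; rewrite ltnS => le.
apply: le_trans (IH n (ltnSn n) _ le) _.
have [nk|kn] := ltnP n k; first by rewrite hr_small ?hr_ge0.
suff yh : y n.+1 <= hh n.
  by rewrite hrS; have := hr_ge0 w n; move: q2 yh; nra.
have [lt|le2] := ltnP n.+1 (k + k); last first.
  rewrite -(subnK (leq_trans (leq_addr k k) le2)).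
  apply: le_trans (yr_le hq w0 _) _; first by lia.
  by apply: IH => //; lia.
have -> : n.+1 = (n.+1 - k + k)%N by lia.
rewrite yr_pr //; last by lia.
apply: le_trans (pr_le1 _ _) _; rewrite -(hr_size w); exact: IH.
Qed.

Lemma hr_ge1 n : (k <= n)%N -> 1 <= hh n.
Proof. by move=> kn; rewrite -(hr_size w); apply: hr_nondec. Qed.

Lemma yr_le_pred n : y n.+1 <= hh n.
Proof.
have [nk|kn] := ltnP n.+1 k; first by rewrite yr_small ?hr_ge0.
have [lt|le2] := ltnP n.+1 (k + k); last first.
  rewrite -(subnK (leq_trans (leq_addr k k) le2)).
  apply: le_trans (yr_le hq w0 _) _; first by lia.
  by apply: hr_nondec; lia.
move: kn; rewrite leq_eqVlt => /orP[/eqP kn|kn].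
  by rewrite -kn yr_size //; apply: le_trans (hr_ge0 w n); rewrite lerN10.
have -> : n.+1 = (n.+1 - k + k)%N by lia.
by rewrite yr_pr //; [apply: le_trans (pr_le1 _ _) (hr_ge1 _); lia | lia].
Qed.

Lemma hr_geS n : (q - 1) * hh n <= hh n.+1.
Proof. by rewrite hrS; have := yr_le_pred n; lra. Qed.

Lemma hr_leS n : (k <= n)%N -> hh n.+1 <= q * hh n.
Proof. by move=> le; rewrite hrS gerBl yr_ge0. Qed.

Lemma yr_append n : (k <= n)%N -> (q - 1) * hh n <= y (n + k).+1.
Proof.
move=> le; rewrite /yr /= lerBrDr /hr.
have : ((h w (n + k).+1 + #|Omega|.-1 * h w n)%N%:R <= (#|Omega| * h w (n + k))%N%:R :> rat).
  by rewrite ler_nat; apply: h_append.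
by rewrite natrD !natrM -subn1 natrB 1?addrC // ltnW.
Qed.

Lemma yr_inv n : (k <= n)%N -> y (n + k) =
  hh n - \sum_(0 <= b < k) pr w b * hh (n - b) + wrapsum w (fun s => y (n + k - s)).
Proof.
move=> le; apply: inv_conv => // m lt _; apply: hr_decomp => //; lia.
Qed.

Lemma hr_inv n : (k <= n)%N -> hh (n + k) =
  a n - \sum_(0 <= b < k) pr w b * a (n - b) + wrapsum w (fun s => hh (n + k - s)).
Proof. by move=> le; apply: inv_conv => // m _ _; apply: ar_decomp. Qed.

Lemma hr_sub_yr n : (0 < n)%N ->
  hh n - y (n + k) = \sum_(1 <= b < k) cr w b * y (n + k - b).
Proof.
by move=> n0; rewrite hr_decomp // (big_ltn w0) cr0 mul1r subn0 addrC addKr.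
Qed.

Lemma hr_sub_yr_ge0 n : (k <= n)%N -> 0 <= hh n - y (n + k).
Proof. by move=> le; rewrite subr_ge0 yr_le. Qed.

Lemma wrapsum_ge0 E : (forall s, (k <= s < k + k)%N -> 0 <= E s) -> 0 <= wrapsum w E.
Proof.
move=> E0; apply: sumr_nat_ge0 => i ik; apply: sumr_nat_ge0 => j jk.
have [le|lt] := leqP (size w) (i + j); last by rewrite mul0r.
by rewrite mul1r !mulr_ge0 ?pr_ge0 ?cr_ge0 ?E0 //; rewrite le /=; rewrite /k; lia.
Qed.

Lemma hr_sub_yr_le n : (k + k <= n)%N ->
  hh n - y (n + k) <= \sum_(0 <= b < k) pr w b * hh (n - b).
Proof.
move=> le; rewrite yr_inv; last by lia.
have := @wrapsum_ge0 (fun s => y (n + k - s)); set W := wrapsum _ _.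
move=> /(_ _); suff: (forall s, (k <= s < k + k)%N -> 0 <= y (n + k - s)) by move=> H /(_ H); lra.
by move=> s sk; apply: yr_ge0 => //; lia.
Qed.

Lemma arS n : a n.+1 = q * a n - hh n.+1.
Proof. by rewrite ar_hr // addrK. Qed.

Lemma ar0 : a 0%N = 1. Proof. by rewrite /ar av0. Qed.

Lemma hr_le_ar n : hh (n + k) <= a n.
Proof.
rewrite ar_decomp //; rewrite (big_ltn w0) cr0 mul1r subn0 lerDl.
by apply: sumr_nat_ge0 => i _; rewrite mulr_ge0 ?cr_ge0 ?hr_ge0.
Qed.

Lemma ar_leS n : a n.+1 <= q * a n.
Proof. by rewrite arS gerBl hr_ge0. Qed.

(** When n grows by one, the window gains a(n) and loses a(n - k + 1), and the subtracted h(n + 1)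
    is at most that lost term. *)
Lemma ar_ge_sum n :
  1 + (q - 1) * \sum_(1 <= i < k) (i <= n)%N%:R * a (n - i) <= a n.
Proof.
elim: n => [|n IH].
  rewrite ar0 big_nat_eq0 ?mulr0 ?addr0 // => i /andP[i0 _].
  by rewrite leqNgt i0 mul0r.
set F := fun i => (i <= n)%N%:R * a (n - i).
have [k' kE] : exists k', k = k'.+1 by exists k.-1; rewrite prednK.
have hF : hh n.+1 <= F k'.
  rewrite /F; case: leqP => le; last by rewrite mul0r hr_small // -/k kE.
  by rewrite mul1r (_ : n.+1 = n - k' + k)%N ?hr_le_ar //; lia.
have E : \sum_(1 <= i < k) (i <= n.+1)%N%:R * a (n.+1 - i) + F k' = a n + \sum_(1 <= i < k) F i.
  have -> : a n = F 0%N by rewrite /F subn0 mul1r.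
  by rewrite -(@big_ltn _ _ _ 0 k) // [in RHS]kE big_nat_recr //= kE big_add1.
have Fk : 0 <= F k' by rewrite /F mulr_ge0 ?ler0n.
by rewrite arS; move: IH E hF Fk q2; rewrite -/F; nra.
Qed.

(** Every avoiding word of length n has an extension by at most k letters that hits w: in formulas,
    a(n) <= h(n + 1) + ... + h(n + k). So among the q^k a(n) extensions at least a(n) contain w. *)
Lemma ar_decay n : a (n + k) <= (q ^+ k - 1) * a n.
Proof.
have Hs : a n <= \sum_(1 <= i < k.+1) hh (n + i).
  rewrite ar_decomp // (_ : \sum_(1 <= i < k.+1) hh (n + i) = \sum_(0 <= b < k) hh (n + k - b)).
    by apply: ler_sum_nat => b _; rewrite ler_piMl ?hr_ge0 ?cr_le1.
  rewrite big_add1 /= big_nat_rev /=; apply: eq_big_nat => b bk; congr hh; lia.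
suff G m : a (n + m) + \sum_(1 <= i < m.+1) hh (n + i) <= q ^+ m * a n.
  by have := G k; lra.
elim: m => [|m IH]; first by rewrite big_geq // addn0 addr0 mul1r.
rewrite big_nat_recr //= addnS arS.
have S0 : 0 <= \sum_(1 <= i < m.+1) hh (n + i) by apply: sumr_nat_ge0 => *; apply: hr_ge0.
by rewrite exprS -mulrA; move: IH S0 q2; nra.
Qed.

Definition gap n := hh n - \sum_(1 <= j < k) hh (n - j).

Lemma gapS n : (k <= n.+1)%N -> (0 < n.+1 - k)%N ->
  gap n.+1 = gap n + (q - 2) * hh n + (hh (n.+1 - k) - y n.+1).
Proof.
move=> kn _; have [k' kE] : exists k', k = k'.+1 by exists k.-1; rewrite prednK.
have E : \sum_(1 <= i < k) hh (n.+1 - i) + hh (n - k') = hh n + \sum_(1 <= i < k) hh (n - i).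
  rewrite -[X in X + _ = hh n + _]/(\sum_(1 <= i < k) hh (n.+1 - i)).
  have -> : hh n = hh (n - 0) by rewrite subn0.
  by rewrite -(@big_ltn _ _ _ 0 k (fun i => hh (n - i))) // [in RHS]kE big_nat_recr //= kE big_add1.
rewrite /gap hrS (_ : n.+1 - k = n - k')%N; last by lia.
by move: E; lra.
Qed.

(** For q >= 3, h at least doubles at each step and dominates its predecessors at once; for q = 2
    the deficit built up before 2k is made good by 3k - 1. *)
Definition Q_start : nat := if #|Omega| == 2 then (3 * k).-1 else k.

(** For q = 2 the gap does not decrease from 2k - 1 on, where it equals 1 minus the number of
    primitive periods below k. Over the next k steps each such period b returns at least 1, since
    the values of y met at shift b add up to at least h(2k - 1 - b) >= 1. *)
Lemma gap_ge0 n : (Q_start <= n)%N -> \sum_(1 <= j < k) hh (n - j) <= hh n.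
Proof.
rewrite /Q_start; case: eqP => [q2E le|q3 _]; last first.
  have q3' : (2 : rat) <= q - 1 by rewrite lerBrDr natr1 ler_nat; lia.
  have G m N : \sum_(1 <= j < m.+1) hh (N - j) <= hh N.
    elim: N m => [|N IH] m.
      by rewrite hr_small // big_nat_eq0 // => j _; rewrite sub0n hr_small.
    case: m => [|m]; first by rewrite big_geq ?hr_ge0.
    rewrite big_ltn // subn1 big_add1 /=.
    rewrite (eq_big_nat _ _ (F2 := fun j => hh (N - j))) //.
    by have := IH m; have := hr_geS N; have := hr_ge0 w N; move: q3'; nra.
  by move: (G k.-1 n); rewrite prednK.
have qE : q = 2 by rewrite q2E.
suff : 0 <= gap n by rewrite /gap subr_ge0.
have step m : (k + k <= m.+1)%N -> gap m <= gap m.+1.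
  move=> le1; rewrite gapS; [|lia|lia].
  rewrite qE subrr mul0r addr0 lerDl.
  by rewrite [X in y X](_ : _ = m.+1 - k + k)%N ?hr_sub_yr_ge0 //; lia.
have mono i j : (k + k <= i.+1)%N -> (i <= j)%N -> gap i <= gap j.
  move=> le1 /subnK <-; elim: (j - i)%N => [|d IH]; first by rewrite add0n.
  by apply: le_trans IH _; apply: step; lia.
apply: le_trans (mono (3 * k).-1 n _ le); last by lia.
have base m : (m < k)%N -> gap (k + m) = 1 - \sum_(1 <= j < m.+1) pr w j.
  elim: m => [|m IH] mk.
    rewrite big_geq // subr0 addn0 /gap hr_size big_nat_eq0 ?subr0 // => j jk.
    by rewrite hr_small //; lia.
  have [k1|k1] := leqP k 1; first by lia.
  rewrite big_nat_recr //= opprD addrA -IH; last by lia.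
  have E : \sum_(1 <= i < k) hh (k + m.+1 - i) = hh (k + m) + \sum_(1 <= i < k) hh (k + m - i).
    have [k' kE] : exists k', k = k'.+1 by exists k.-1; rewrite prednK.
    set F := fun i => hh (k + m - i).
    have -> : \sum_(1 <= i < k) hh (k + m.+1 - i) = \sum_(0 <= i < k') F i.
      by rewrite {1}kE big_add1; apply: eq_big_nat => i _; rewrite /F; congr hh; lia.
    have -> : hh (k + m) = F 0%N by rewrite /F subn0.
    rewrite -(@big_ltn _ _ _ 0 k F) // [in RHS]kE big_nat_recr //= [F k']hr_small ?addr0 //.
    by rewrite -/k; lia.
  rewrite /gap E addnS hrS -addnS -yr_pr; [|by []|by []|lia].
  by rewrite -/k [(m.+1 + k)%N]addnC qE; lra.
have sum_gap m : gap (k + k + m).-1 >= gap (k + k).-1 +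
    \sum_(k <= i < k + m) (hh i - y (i + k)).
  elim: m => [|m IH]; first by rewrite !addn0 big_geq // addr0.
  rewrite addnS big_nat_recr /=; last by lia.
  set N := (k + k + m).-1; have NE : (k + k + m)%N = N.+1 by rewrite /N; lia.
  rewrite (_ : (k + k + m.+1).-1 = N.+1) 1?gapS; try lia.
  rewrite qE subrr mul0r addr0 (_ : N.+1 - k = k + m)%N; last by lia.
  rewrite (_ : y N.+1 = y (k + m + k)%N); last by congr y; lia.
  by move: IH; rewrite -/N; lra.
have -> : (3 * k).-1 = (k + k + k).-1 by lia.
apply: le_trans (sum_gap k).
have -> : (k + k).-1 = (k + k.-1)%N by lia.
rewrite base ?ltn_predL // prednK //.
suff : \sum_(1 <= j < k) pr w j <= \sum_(k <= i < k + k) (hh i - y (i + k)) by lra.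
have -> : \sum_(k <= i < k + k) (hh i - y (i + k)) =
    \sum_(k <= i < k + k) \sum_(1 <= b < k) cr w b * y (i + k - b).
  by apply: eq_big_nat => i ik; apply: hr_sub_yr; lia.
rewrite exchange_big_nat /=; apply: ler_sum_nat => b bk; rewrite -mulr_sumr.
apply: le_trans (_ : cr w b * 1 <= _).
  rewrite mulr1 /pr /cr ler_nat; case p: (prim w b) => //.
  by rewrite (prim_per hq w0 _ p) //; case/andP: bk.
rewrite ler_wpM2l ?cr_ge0 //; apply: le_trans (@hr_ge1 (k + k - b).-1 _) _; first by lia.
rewrite hr_decomp //; last by lia.
apply: le_trans (_ : \sum_(0 <= i < k) y ((k + k - b).-1 + k - i) <= _).
  by apply: ler_sum_nat => i ik; rewrite ler_piMl ?cr_le1 // yr_ge0 //; rewrite -/k; lia.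
rewrite le_eqVlt; apply/orP; left; apply/eqP.
rewrite big_nat_rev /= -[in RHS](add0n k) big_addn add0n addnK.
by apply: eq_big_nat => i ik; congr y; lia.
Qed.
End Growth.

(** * Comparing autocorrelations *)

Section Cor.
Local Open Scope nat_scope.
Variable Omega : finType.
Implicit Types w : seq Omega.

Lemma corE w : cor w = \sum_(1 <= i < (size w).+1) per w (size w - i) * 2 ^ i.-1.
Proof.
apply: eq_big_nat => i /andP[i0 ik]; rewrite /per subKn //.
Qed.

Lemma sum_bits_lt (b : nat -> bool) m : \sum_(1 <= i < m.+1) b i * 2 ^ i.-1 < 2 ^ m.
Proof.
elim: m => [|m IH]; first by rewrite big_geq.
rewrite big_nat_recr //= expnS mul2n -addnn -addSn leq_add //.
by case: (b _); rewrite ?mul1n ?mul0n.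
Qed.

Lemma cor_size w w' : cor w' < cor w -> size w' <= size w.
Proof.
move=> lt; rewrite leqNgt; apply/negP => kk.
have h1 : cor w < 2 ^ size w by apply: sum_bits_lt.
have h2 : 2 ^ (size w').-1 <= cor w'.
  case E: (size w') kk => [|k'] // _.
  by rewrite corE E big_nat_recr //= subnn per0 mul1n leq_addl.
have h3 : 2 ^ size w <= 2 ^ (size w').-1 by rewrite leq_exp2l //; lia.
by lia.
Qed.

(** A smaller shift is a more significant bit, so the first disagreement decides: by [sum_bits_lt]
    the bits below it sum to less than its weight. *)
Lemma cor_first_diff w w' : size w' = size w -> cor w' < cor w ->
  exists p, [/\ 0 < p < size w, per w p, ~~ per w' p
              & forall b, b < p -> per w b = per w' b].
Proof.
move=> kk lt.
have ex : exists p, (p < size w) && (per w p != per w' p).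
  case: (boolP (has (fun p => per w p != per w' p) (iota 0 (size w)))).
    by case/hasP => p; rewrite mem_iota /= add0n => lp d; exists p; rewrite lp.
  move/hasPn => H; move: lt; rewrite !corE kk.
  rewrite (_ : \sum_(1 <= i < _) _ = \sum_(1 <= i < (size w).+1) per w (size w - i) * 2 ^ i.-1) ?ltnn //.
  apply: eq_big_nat => i ik; have := H (size w - i); rewrite mem_iota => /(_ _)/negPn/eqP -> //; lia.
case: (ex_minnP ex) => p /andP[pk pd] pmin.
have agree b : b < p -> per w b = per w' b.
  move=> bp; case: (eqVneq (per w b) (per w' b)) => // d.
  by have := pmin b; rewrite d (ltn_trans bp pk) => /(_ isT); rewrite leqNgt bp.
have p0 : 0 < p by case: (p) pd => //; rewrite !per0.
exists p; case pw: (per w p) pd; case pw': (per w' p) => // _; first by rewrite p0 pk.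
case/negP: (ltn_geF lt); rewrite !corE kk.
have [m mE] : exists m, size w - p = m.+1 by exists (size w - p).-1; rewrite prednK // subn_gt0.
have split v : \sum_(1 <= i < (size w).+1) per v (size w - i) * 2 ^ i.-1 =
   \sum_(1 <= i < m.+1) per v (size w - i) * 2 ^ i.-1 + per v p * 2 ^ m +
   \sum_(m.+2 <= i < (size w).+1) per v (size w - i) * 2 ^ i.-1.
  rewrite (@big_cat_nat _ _ _ m.+1) //=; last by lia.
  rewrite (@big_ltn _ _ _ m.+1) ?addnA; last by lia.
  by rewrite (_ : size w - m.+1 = p) //; lia.
rewrite !split pw pw' mul0n mul1n addn0 leq_add //.
  by rewrite (leq_trans (ltnW (sum_bits_lt _ _))) // leq_addl.
rewrite leq_eqVlt; apply/orP; left; apply/eqP.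
by apply: eq_big_nat => i ik; rewrite agree //; lia.
Qed.
End Cor.

(** * Persistence of positivity *)

Section Persistence.
Variables (q : rat) (e : nat -> rat).
Hypothesis q2 : 2 <= q.

(** Invariant: e(n) is positive and is the largest value so far. It then serves as B, and the step
    yields e(n + 1) >= e(n). Integrality gives B >= 1, so that losses of one unit can be
    absorbed. *)
Lemma persist_nondec n0 M :
  (forall n, 0 < e n -> 1 <= e n) ->
  (forall n, (n <= n0)%N -> e n <= 0) ->
  (forall n B, (n0 <= n)%N -> 1 <= B -> (forall j, (j <= n)%N -> e j <= B) ->
     q * e n - e n.+1 <= (q - 1) * B) ->
  (forall n, (n < M)%N -> e n <= 0) -> 0 < e M ->
  forall n, (M <= n)%N -> 0 < e n.
Proof.
move=> e1 e0 step eM0 eM.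
have n0M : (n0 < M)%N by rewrite ltnNge; apply/negP => /e0; rewrite leNgt eM.
suff H n : (M <= n)%N -> 0 < e n /\ forall j, (j <= n)%N -> e j <= e n by move=> n /H[].
move/subnK <-; elim: (n - M)%N => [|d [ed IH]].
  rewrite add0n; split=> // j; rewrite leq_eqVlt => /orP[/eqP -> //|/eM0 le].
  by apply: le_trans le (ltW eM).
rewrite addSn; have := step (d + M)%N _ _ (e1 _ ed) IH => /(_ _).
have -> : (n0 <= d + M)%N by lia.
move=> /(_ isT) le; have le' : e (d + M)%N <= e (d + M).+1 by lra.
split=> [|j]; first exact: lt_le_trans le'.
by rewrite leq_eqVlt => /orP[/eqP -> //|]; rewrite ltnS => /IH le2; apply: le_trans le'.
Qed.

(** Invariant: e(j) <= r^(N-j) e(N) for j <= N, with r = 2/3. It bounds e(N + 1 - k) by r^(k-1) e(N)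
    and all values up to N + 1 - 2k by r^(2k-1) e(N), so the loss is at most e(N)/2 and e(N + 1) >=
    (2 - 1/2) e(N), which restores the invariant. *)
Lemma persist_growth n0 k (K r : rat) M : (0 < k)%N -> 0 <= K -> 3 * r = 2 ->
  2 * (r ^+ k.-1 + K * r ^+ (2 * k).-1) <= 1 ->
  (forall n, (n < n0 + k)%N -> e n <= 0) ->
  (forall n B, (n0 <= n)%N -> 0 <= B -> (forall j, (j + k <= n)%N -> e j <= B) ->
     q * e (n + k).-1 - e (n + k) <= Num.max (e n) 0 + K * B) ->
  (forall n, (n < M)%N -> e n <= 0) -> 0 < e M ->
  forall n, (M <= n)%N -> 0 < e n.
Proof.
move=> k0 K0 r23 small e0 step eM0 eM.
have [r0 r1] : 0 < r /\ r <= 1 by split; lra.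
have n0M : (n0 + k <= M)%N by rewrite leqNgt; apply/negP => /e0; rewrite leNgt eM.
suff H n : (M <= n)%N -> 0 < e n /\ forall j, (j <= n)%N -> e j <= r ^+ (n - j) * e n by move=> n /H[].
move/subnK <-; elim: (n - M)%N => [|d [ed IH]].
  rewrite add0n; split=> // j; rewrite leq_eqVlt => /orP[/eqP ->|/eM0 le].
    by rewrite subnn mul1r.
  by apply: le_trans le _; rewrite mulr_ge0 ?exprn_ge0 // ltW.
rewrite addSn; set N := (d + M)%N in ed IH *.
have e1 : Num.max (e (N.+1 - k)) 0 <= r ^+ k.-1 * e N.
  rewrite ge_max mulr_ge0 ?exprn_ge0 ?(ltW ed) ?(ltW r0) // andbT.
  have -> : k.-1 = (N - (N.+1 - k))%N by lia.
  by apply: IH; lia.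
have B0 : 0 <= r ^+ (2 * k).-1 * e N by rewrite mulr_ge0 ?exprn_ge0 ?(ltW ed) ?(ltW r0).
have := step (N.+1 - k)%N (r ^+ (2 * k).-1 * e N) _ B0 _.
rewrite subnK; last by lia.
move=> /(_ _ _)/=; have -> : (n0 <= N.+1 - k)%N by lia.
move=> /(_ isT) st.
have {}st : q * e N - e N.+1 <= Num.max (e (N.+1 - k)) 0 + K * (r ^+ (2 * k).-1 * e N).
  apply: st => j jk; apply: le_trans (IH j _) _; first by lia.
  rewrite ler_wpM2r ?(ltW ed) //; apply: ler_wiXn2l; rewrite ?(ltW r0) //; lia.
have st2 : 2 * (q * e N - e N.+1) <= e N.
  apply: le_trans (_ : 2 * (r ^+ k.-1 + K * r ^+ (2 * k).-1) * e N <= _).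
    by rewrite -mulrA ler_pM2l // mulrDl -mulrA (le_trans st) // lerD2r.
  by rewrite -[leRHS]mul1r ler_wpM2r // ltW.
have qe : 2 * e N <= q * e N by rewrite ler_wpM2r // ltW.
have st3 : 3 * e N <= 2 * e N.+1 by move: st2 qe; lra.
have st4 : e N <= r * e N.+1.
  by rewrite -(@ler_pM2l _ 3) // mulrA r23.
split=> [|j]; first by move: st3 ed; lra.
rewrite leq_eqVlt => /orP[/eqP ->|]; first by rewrite subnn mul1r.
rewrite ltnS => jN; apply: le_trans (IH j jN) _.
by rewrite subSn // exprSr -mulrA ler_wpM2l // exprn_ge0 // ltW.
Qed.
End Persistence.

Section Difference.
Variable Omega : finType.
Hypothesis hq : (1 < #|Omega|)%N.
Variables w w' : seq Omega.
Hypothesis w0 : (0 < size w)%N.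
Hypothesis w0' : (0 < size w')%N.
Let k := size w.
Local Notation q := (#|Omega|%:R : rat).

Definition er n : rat := hr w n - hr w' n.
Definition xr n : rat := yr w' n - yr w n.

Let q2 : 2 <= q. Proof. by rewrite ler_nat. Qed.

Lemma erS n : er n.+1 = q * er n + xr n.+1.
Proof. by rewrite /er /xr !hrS; ring. Qed.

Lemma er_ge1 n : 0 < er n -> 1 <= er n.
Proof. by rewrite /er /hr subr_gt0 ltr_nat lerBrDl natr1 ler_nat. Qed.

Lemma er_le_m1 n : er n < 0 -> er n <= -1.
Proof.
rewrite /er /hr subr_lt0 ltr_nat => lt.
have : (h w n)%:R + 1 <= (h w' n)%:R :> rat by rewrite natr1 ler_nat.
lra.
Qed.

Lemma ar_sub n : ar w n.+1 - ar w' n.+1 = q * (ar w n - ar w' n) - er n.+1.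
Proof. by rewrite /er !arS //; ring. Qed.

(** Bernoulli's inequality (1 + 1/(Q - 1))^m >= 1 + m/(Q - 1), cleared of denominators. *)
Lemma bernoulli_sub (Q : rat) m : 1 <= Q -> (Q - 1) ^+ m * (Q - 1 + m%:R) <= Q ^+ m * (Q - 1).
Proof.
move=> Q1; elim: m => [|m IH]; first by rewrite !mul1r addr0.
rewrite !exprS -!mulrA; apply: le_trans (_ : Q * ((Q - 1) ^+ m * (Q - 1 + m%:R)) <= _).
  rewrite !(mulrCA _ ((Q - 1) ^+ m)) ler_wpM2l ?exprn_ge0 ?subr_ge0 //.
  by rewrite -natr1; have := ler0n rat m; nra.
by rewrite ler_wpM2l // (le_trans _ Q1).
Qed.

Lemma er_eventually_pos j0 : er j0 < 0 -> exists n, 0 < er n.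
Proof.
move=> ej; have Hq := q2; set A := ar w j0; set Q : rat := q ^+ k.
have Q2 : 2 <= Q.
  have kE : k = k.-1.+1 by rewrite prednK.
  rewrite /Q kE exprS.
  have : 1 <= q ^+ k.-1 by rewrite exprn_ege1 //; lra.
  by move: q2; nra.
have A0 : 0 <= A by apply: ar_ge0.
(* With nonpositive e, the avoiding counts would give Q^m <= (Q - 1)^m A; Bernoulli then yields Q -
   1 + m <= A (Q - 1), which this m violates. *)
pose m := Num.bound (A * (Q - 1)).
have mA : A * (Q - 1) < m%:R by apply: archi_boundP; rewrite mulr_ge0 //; lra.
have [/hasP[n _ en]|/hasPn H] := boolP (has (fun n => 0 < er n) (iota 0 (j0 + k * m).+1)).
  by exists n.
have {}H n : (n <= j0 + k * m)%N -> er n <= 0.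
  by move=> le; rewrite leNgt; apply: H; rewrite mem_iota.
have d0 n : (n <= j0 + k * m)%N -> 0 <= ar w n - ar w' n.
  elim: n => [|n IH] le; first by rewrite !ar0 // subrr.
  by rewrite ar_sub; have := IH (ltnW le); have := H _ le; move: q2; nra.
have d1 : 1 <= ar w j0 - ar w' j0.
  have j0p : (0 < j0)%N.
    by rewrite lt0n; apply/eqP => j00; move: ej; rewrite j00 /er !hr_small ?subrr ?ltxx.
  rewrite -(prednK j0p) ar_sub prednK //; have em := er_le_m1 ej.
  have dp : 0 <= ar w j0.-1 - ar w' j0.-1 by apply: d0; lia.
  by move: Hq em dp; nra.
have dm n : (n <= k * m)%N -> q ^+ n <= ar w (j0 + n) - ar w' (j0 + n).
  elim: n => [|n IH] le; first by rewrite addn0.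
  rewrite addnS ar_sub exprS; have := IH (ltnW le).
  have : er (j0 + n).+1 <= 0 by apply: H; lia.
  by move: (q ^+ n) (ar w _ - _) (er _) => u v t t0 uv; have := Hq; nra.
have am i : ar w (j0 + k * i) <= (Q - 1) ^+ i * A.
  elim: i => [|i IH]; first by rewrite muln0 addn0 mul1r.
  rewrite mulnS (addnC k) addnA; apply: le_trans (ar_decay hq w0 _) _.
  by rewrite exprS -mulrA ler_wpM2l //; move: Q2; rewrite /Q; lra.
have := dm _ (leqnn _); have := am m; have := @bernoulli_sub Q m.
have : 0 <= ar w' (j0 + k * m) by apply: ar_ge0.
have P0 : 0 < (Q - 1) ^+ m by rewrite exprn_gt0 //; lra.
rewrite exprM -/Q; move: P0 mA Q2; move: (_ ^+ m) (Q ^+ m) => z Z P0 mA Q2 a0.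
have -> : 1 <= Q by lra.
move=> /(_ isT) b1 b2 b3.
have b4 : Z <= z * A by lra.
have b5 : Z * (Q - 1) <= z * A * (Q - 1) by rewrite ler_wpM2r //; lra.
have b6 : z * (Q - 1 + m%:R) <= z * (A * (Q - 1)) by rewrite mulrA; apply: le_trans b5.
by move: b6; rewrite ler_pM2l //; lra.
Qed.

End Difference.

Section SignChange.
Variable Omega : finType.
Hypothesis hq : (1 < #|Omega|)%N.
Variables w w' : seq Omega.
Hypothesis w0 : (0 < size w)%N.
Hypothesis w0' : (0 < size w')%N.
Local Notation k := (size w).
Local Notation q := (#|Omega|%:R : rat).
Local Notation e := (er w w').

Definition persists := forall M, (forall n, (n < M)%N -> e n <= 0) -> 0 < e M ->
  forall n, (M <= n)%N -> 0 < e n.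

Lemma sign_change j0 : (forall n, (n <= k)%N -> e n <= 0) -> e j0 < 0 -> persists ->
  exists N : nat, (k < N)%N /\
    (forall n : nat, (n < N)%N -> (h w n)%:Z - (h w' n)%:Z <= 0) /\
    (forall n : nat, (N < n)%N -> (h w n)%:Z - (h w' n)%:Z > 0).
Proof.
move=> e0 ej pers; have [M eM Mmin] := ex_minnP (er_eventually_pos hq w0 w0' ej).
have eM0 n : (n < M)%N -> e n <= 0.
  by move=> lt; rewrite leNgt; apply/negP => /Mmin; rewrite leqNgt lt.
exists M; split.
  by rewrite ltnNge; apply/negP => /e0; rewrite leNgt eM.
split=> n lt.
  by have := eM0 n lt; rewrite /er /hr !subr_le0 ler_nat lez_nat.
by have := pers M eM0 eM n (ltnW lt); rewrite /er /hr !subr_gt0 ltr_nat ltz_nat.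
Qed.

Lemma longer_nonpos n : (size w' <= k)%N -> (n <= k)%N -> e n <= 0.
Proof.
move=> kk; rewrite leq_eqVlt => /orP[/eqP ->|lt]; rewrite /er.
  by rewrite hr_size subr_le0 hr_ge1.
by rewrite hr_small // sub0r oppr_le0 hr_ge0.
Qed.

(** The loss is at most h(n + 1 - k) - (q - 1) h'(n - k'). Since n + 1 - k <= n - k' and h' is
    nondecreasing, this is at most e(n + 1 - k) <= B. Below 2k the loss is at most one unit. *)
Lemma longer_persists : (size w' < k)%N -> persists.
Proof.
move=> kk; have Hq : 2 <= q by rewrite ler_nat.
move=> M; apply: (persist_nondec Hq (n0 := k)); first exact: er_ge1.
  by move=> n; apply: longer_nonpos; rewrite ltnW.
move=> n B kn B1 eB; rewrite erS opprD addrA subrr add0r /xr opprB.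
have [lt|le] := ltnP n.+1 (k + k).
  have -> : n.+1 = (n.+1 - k + k)%N by lia.
  rewrite yr_pr //; last by lia.
  have := pr_le1 w (n.+1 - k); have : 0 <= yr w' (n.+1 - k + k) by apply: yr_ge0 => //; lia.
  by move: Hq B1; nra.
have h1 : yr w n.+1 <= hr w (n.+1 - k).
  by rewrite {1}(_ : n.+1 = n.+1 - k + k)%N ?yr_le //; lia.
have h2 : (q - 1) * hr w' (n - size w') <= yr w' n.+1.
  by rewrite [X in yr _ X](_ : n.+1 = (n - size w' + size w').+1) ?yr_append //; lia.
have h3 : hr w' (n.+1 - k) <= hr w' (n - size w') by apply: hr_nondec => //; lia.
have h4 : e (n.+1 - k) <= B by apply: eB; lia.
have := hr_ge0 w' (n - size w'); move: h4; rewrite /er; move: Hq B1 h1 h2 h3; nra.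
Qed.

Lemma longer_neg : (size w' < k)%N -> e (size w') < 0.
Proof. by move=> kk; rewrite /er hr_small // hr_size sub0r oppr_lt0. Qed.
End SignChange.

(** * Words of equal length and their first differing period *)

Section SameLength.
Variable Omega : finType.
Hypothesis hq : (1 < #|Omega|)%N.
Variables w w' : seq Omega.
Hypothesis w0 : (0 < size w)%N.
Hypothesis kk : size w' = size w.
Variable p : nat.
Hypothesis p0 : (0 < p)%N.
Hypothesis pk : (p < size w)%N.
Hypothesis pp : per w p.
Hypothesis np : ~~ per w' p.
Hypothesis agree : forall b, (b < p)%N -> per w b = per w' b.
Local Notation k := (size w).
Local Notation q := (#|Omega|%:R : rat).
Local Notation e := (er w w').

Let w0' : (0 < size w')%N. Proof. by rewrite kk. Qed.
Let q2 : 2 <= q. Proof. by rewrite ler_nat. Qed.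

Lemma pr_agree a : (a < p)%N -> pr w a = pr w' a.
Proof.
elim/ltn_ind: a => -[|a] IH ap; first by rewrite !pr0.
have C : \sum_(0 <= i < a.+2) pr w i * cr w (a.+1 - i) =
         \sum_(0 <= i < a.+2) pr w' i * cr w' (a.+1 - i).
  have ak : (0 < a.+1 < k)%N by lia.
  by rewrite !prim_conv ?kk // /cr agree.
move: C; rewrite !(@big_nat_recr _ _ _ a.+1) //= subnn !cr0 !mulr1.
have -> : \sum_(0 <= i < a.+1) pr w i * cr w (a.+1 - i) =
          \sum_(0 <= i < a.+1) pr w' i * cr w' (a.+1 - i).
  apply: eq_big_nat => i ia; rewrite /cr (@agree (a.+1 - i)); last by lia.
  by rewrite IH //; lia.
by move/addrI.
Qed.

(** At p the convolutions of w and w' agree except in their last terms, so their values 1 and 0 are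
    those last terms up to a common nonnegative sum, which must vanish. *)
Lemma pr_p : pr w p = 1 /\ pr w' p = 0.
Proof.
have C1 : \sum_(0 <= i < p.+1) pr w i * cr w (p - i) = 1.
  by rewrite prim_conv ?p0 // /cr pp.
have C2 : \sum_(0 <= i < p.+1) pr w' i * cr w' (p - i) = 0.
  by rewrite prim_conv ?p0 ?kk // /cr (negbTE np).
move: C1 C2; rewrite !(@big_nat_recr _ _ _ p) //= subnn !cr0 !mulr1.
have -> : \sum_(0 <= i < p) pr w i * cr w (p - i) = \sum_(0 <= i < p) pr w' i * cr w' (p - i).
  apply: eq_big_nat => -[|i] ip; first by rewrite !pr0 !mul0r.
  by rewrite pr_agree 1?/cr 1?(@agree (p - i.+1)) //; lia.
set S := \sum_(_ <= _ < _) _; have S0 : 0 <= S.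
  by apply: sumr_nat_ge0 => i _; rewrite mulr_ge0 ?pr_ge0 ?cr_ge0.
move=> E1 E2; have := pr_ge0 w' p; have := pr_le1 w p; split; lra.
Qed.

Lemma er_small n : (n <= k)%N -> e n = 0.
Proof.
rewrite leq_eqVlt => /orP[/eqP ->|lt]; rewrite /er.
  by rewrite -{2}kk !hr_size subrr.
by rewrite !hr_small ?kk // subrr.
Qed.

Lemma er_step i : (i.+1 < k)%N -> e (k + i.+1) = q * e (k + i) + (pr w' i.+1 - pr w i.+1).
Proof.
move=> ik; have <- : yr w (k + i.+1) = pr w i.+1 by rewrite addnC yr_pr.
have <- : yr w' (k + i.+1) = pr w' i.+1 by rewrite -kk addnC yr_pr ?kk.
by rewrite addnS erS.
Qed.

Lemma er_below_p i : (i < p)%N -> e (k + i) = 0.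
Proof.
elim: i => [|i IH] ip; first by rewrite addn0 er_small.
by rewrite er_step ?IH ?mulr0 ?add0r ?pr_agree ?subrr //; lia.
Qed.

Lemma er_at_p : e (k + p) = -1.
Proof.
have [p1 p2] := pr_p; have pE : p = p.-1.+1 by rewrite prednK.
by rewrite {1}pE er_step -pE // p1 p2 er_below_p ?ltn_predL // mulr0 !add0r.
Qed.

Lemma er_above_p i : (p <= i < k)%N -> e (k + i) <= -1.
Proof.
elim: i => [|i IH] ik; first by lia.
have [<-|ne] := eqVneq p i.+1; first by rewrite er_at_p.
rewrite er_step; last by lia.
have := IH _; rewrite (_ : (_ && _)); last by lia.
move=> /(_ isT) le; have := pr_le1 w' i.+1; have := pr_ge0 w i.+1.
by move: q2 le; nra.
Qed.

Lemma er_lt2k n : (n < k + k)%N -> e n <= 0.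
Proof.
move=> lt; have [le|gt] := leqP n k; first by rewrite er_small.
rewrite -(subnKC (ltnW gt)); have [lp|lp] := ltnP (n - k) p; first by rewrite er_below_p.
by apply: le_trans (@er_above_p (n - k) _) _; rewrite ?lerN10 //; lia.
Qed.

Lemma no_period_persists : (forall b, (0 < b < k)%N -> ~~ per w' b) -> persists w w'.
Proof.
move=> nper M; apply: (persist_nondec q2 (n0 := (k + k).-1)); first exact: er_ge1.
  by move=> n le; apply: er_lt2k; lia.
move=> n B kn B1 eB; rewrite erS // opprD addrA subrr add0r /xr opprB.
have E : n.+1 = (n.+1 - k + k)%N by lia.
have h1 : yr w n.+1 <= hr w (n.+1 - k) by rewrite {1}E yr_le //; lia.
have h2 : yr w' n.+1 = hr w' (n.+1 - k).
  have := @hr_sub_yr _ hq w' w0' (n.+1 - k); rewrite kk -E => /(_ _).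
  rewrite big_nat_eq0 => [H|b bk]; last by rewrite /cr (negbTE (nper b bk)) mul0r.
  by apply/eqP; rewrite eq_sym -subr_eq0 H //; lia.
have h4 : e (n.+1 - k) <= B by apply: eB; lia.
by move: h4; rewrite /er; move: q2 B1 h1 h2; nra.
Qed.

Lemma constant_persists : per w 1 -> persists w w'.
Proof.
move=> per1; have k1 : (1 < k)%N by lia.
have perw b : (b <= k)%N -> per w b.
  elim: b => [|b IH] bk; first exact: per0.
  by rewrite -addn1; apply: per_add => //; [apply: IH; lia | lia].
(* Every shift is a period, so h(m) is the sum of y over m + 1, ..., m + k. Consecutive windows
   differ only in their end terms, whence this closed form. *)
have yE n : (1 < n)%N -> yr w (n + k) = (q - 1) * hr w n.-1.
  case: n => [|[|n]] // _.
  have D m : (0 < m)%N -> hr w m = \sum_(0 <= b < k) yr w (m + k - b).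
    move=> m0; rewrite hr_decomp //; apply: eq_big_nat => b bk.
    by rewrite /cr perw ?mul1r //; lia.
  have E : yr w (n.+2 + k) + hr w n.+1 = hr w n.+2 + yr w n.+2.
    pose F b := yr w (n.+2 + k - b).
    have -> : hr w n.+1 = \sum_(0 <= b < k) F b.+1.
      by rewrite D //; apply: eq_big_nat => b _; rewrite /F; congr yr; lia.
    have -> : yr w (n.+2 + k) = F 0%N by rewrite /F subn0.
    rewrite -(@big_nat_recl _ _ _ k 0 F) // big_nat_recr //= D //.
    by rewrite /F addnK.
  by move: E; rewrite (hrS w n.+1); lra.
move=> M; apply: (persist_nondec q2 (n0 := (k + k).-1)); first exact: er_ge1.
  by move=> n le; apply: er_lt2k; lia.
move=> n B kn B1 eB; rewrite erS // opprD addrA subrr add0r /xr opprB.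
have E : n.+1 = (n.+1 - k + k)%N by lia.
rewrite {1}E yE; last by lia.
have [lt|le] := ltnP (n.+1 - k).-1 k.
  rewrite hr_small // mulr0 sub0r.
  have : 0 <= yr w' n.+1 by apply: yr_ge0; rewrite ?kk //; lia.
  by move: q2 B1; nra.
have h2 : (q - 1) * hr w' (n - k) <= yr w' n.+1.
  have -> : n.+1 = (n - k + size w').+1 by rewrite kk; lia.
  by apply: yr_append => //; rewrite kk; lia.
have h4 : e (n - k) <= B by apply: eB; lia.
have -> : (n.+1 - k).-1 = (n - k)%N by lia.
by move: h4; rewrite /er; move: q2 B1 h2; nra.
Qed.
End SameLength.

(** * Pairs of periods *)

Section WrapSplit.
Variable Omega : finType.
Variables w w' : seq Omega.
Variable p : nat.
Hypothesis kk : size w' = size w.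
Hypothesis pk : (p < size w)%N.
Hypothesis pr_agree : forall a, (a < p)%N -> pr w a = pr w' a.
Hypothesis pr1 : pr w p = 1.
Local Notation k := (size w).
Implicit Type E : nat -> rat.

(* [com], [rowp] and [rowX] split the difference of the two [wrapsum]s: common pairs (a, b)
   with a < p, the pairs of w involving p, and those involving a primitive b > p. *)
Definition com b := cr w b * cr w' b * (1 - (p < b)%N%:R * pr w b).
Definition common E := \sum_(0 <= a < p) \sum_(0 <= b < k)
  (k <= a + b)%N%:R * (pr w a * com b * E (a + b)%N).
Definition rowp E :=
  \sum_(0 <= b < k) (k <= p + b)%N%:R * ((cr w b - (p < b)%N%:R * pr w b) * E (p + b)%N) +
  \sum_(0 <= a < p) (k <= p + a)%N%:R * (pr w a * E (p + a)%N).
Definition rowX b E :=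
  \sum_(0 <= c < k) (k <= b + c)%N%:R * (cr w c * E (b + c)%N) +
  (k <= b + p)%N%:R * E (b + p)%N +
  \sum_(0 <= a < p) (k <= b + a)%N%:R * (pr w a * E (b + a)%N).

(** What [wrapsum_le] requires of w: the partner b of a primitive a < p is common, or is p, or is a
    primitive period beyond p. *)
Definition classified := forall a b, (a < p)%N -> prim w a -> (b < k)%N -> (k <= a + b)%N ->
  cr w b <= com b + (b == p)%:R + (p < b)%N%:R * pr w b.

Lemma com_ge0 b : 0 <= com b.
Proof.
rewrite /com !mulr_ge0 ?cr_ge0 // subr_ge0.
by case: (p < b)%N; rewrite ?mul1r ?mul0r ?pr_le1.
Qed.

Lemma com_le b : com b <= cr w' b.
Proof.
rewrite /com (mulrC (cr w b)) -mulrA ler_piMr ?cr_ge0 //.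
have : 0 <= (p < b)%N%:R * pr w b by rewrite mulr_ge0 ?ler0n.
by have := cr_le1 w b; have := cr_ge0 w b; nra.
Qed.

(** Rows are sorted by a < p, a = p and a > p. As E depends only on a + b, a pair with a < p and b =
    p can be charged to [rowp], and a pair with a <= p whose partner b > p is primitive to
    [rowX b]. *)
Lemma wrapsum_le E : classified -> (forall s, (k <= s < k + k)%N -> 0 <= E s) ->
  wrapsum w E <= common E + rowp E + \sum_(0 <= b < k) (p < b)%N%:R * pr w b * rowX b E.
Proof.
move=> cls E0.
have tE a b : (a < k)%N -> (b < k)%N -> 0 <= (k <= a + b)%N%:R * E (a + b)%N.
  move=> ak bk; case: leqP => le; rewrite ?mul0r // mul1r E0 //; lia.
set row := fun a => \sum_(0 <= b < k) (k <= a + b)%N%:R * (pr w a * cr w b * E (a + b)%N).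
have -> : wrapsum w E = \sum_(0 <= a < p) row a + row p + \sum_(0 <= a < k) (p < a)%N%:R * row a.
  rewrite /wrapsum -/(\sum_(0 <= a < k) row a) (@sum_nat_cat _ row 0 p k); last by lia.
  rewrite (big_ltn pk) addrA; congr (_ + _).
  rewrite [RHS](@sum_nat_cat _ _ 0 p.+1 k); last by lia.
  rewrite [X in _ = X + _]big_nat_eq0 ?add0r => [|a ap]; last first.
    by rewrite ltnNge (_ : (a <= p)%N) ?mul0r //; lia.
  by apply: eq_big_nat => a /andP[->]; rewrite mul1r.
have -> : \sum_(0 <= b < k) (p < b)%N%:R * pr w b * rowX b E =
  \sum_(0 <= a < k) (p < a)%N%:R * row a +
  \sum_(0 <= b < k) (p < b)%N%:R * pr w b * ((k <= b + p)%N%:R * E (b + p)%N) +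
  \sum_(0 <= a < p) \sum_(0 <= b < k) (p < b)%N%:R * pr w b * ((k <= b + a)%N%:R * (pr w a * E (b + a)%N)).
  rewrite exchange_big_nat -!big_split /=; apply: eq_big_nat => b _.
  rewrite /rowX !mulrDr -mulr_sumr; congr (_ + _ + _).
  rewrite /row -mulrA mulr_sumr; congr (_ * _); apply: eq_big_nat => c _.
  by rewrite mulrCA !mulrA.
have rp : row p = \sum_(0 <= b < k) (k <= p + b)%N%:R * ((cr w b - (p < b)%N%:R * pr w b) * E (p + b)%N) +
    \sum_(0 <= b < k) (p < b)%N%:R * pr w b * ((k <= b + p)%N%:R * E (b + p)%N).
  rewrite -big_split /=; apply: eq_big_nat => b _; rewrite pr1 mul1r [(b + p)%N]addnC.
  by ring.
suff ra a : (a < p)%N -> row a <= \sum_(0 <= b < k) (k <= a + b)%N%:R * (pr w a * com b * E (a + b)%N) +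
    (k <= p + a)%N%:R * (pr w a * E (p + a)%N) +
    \sum_(0 <= b < k) (p < b)%N%:R * pr w b * ((k <= b + a)%N%:R * (pr w a * E (b + a)%N)).
  have : \sum_(0 <= a < p) row a <= \sum_(0 <= a < p) (\sum_(0 <= b < k) (k <= a + b)%N%:R * (pr w a * com b * E (a + b)%N) +
    (k <= p + a)%N%:R * (pr w a * E (p + a)%N) +
    \sum_(0 <= b < k) (p < b)%N%:R * pr w b * ((k <= b + a)%N%:R * (pr w a * E (b + a)%N))).
    by apply: ler_sum_nat => a /andP[_ ap]; apply: ra.
  rewrite !big_split /= rp /common /rowp; lra.
move=> ap; rewrite -(@sum_nat_if _ (fun b => (k <= b + a)%N%:R * (pr w a * E (b + a)%N)) 0 k p) ?pk //.
rewrite -!big_split /=; apply: ler_sum_nat => b /andP[_ bk].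
rewrite [(b + a)%N]addnC.
have ak : (a < k)%N by lia.
have := tE a b ak bk; case: (leqP k (a + b)) => le; rewrite ?(mul1r, mul0r, mulr0, addr0) // => Eab.
have [pa|npa] := boolP (prim w a); last first.
  by rewrite /pr (negbTE npa) ?(mul1r, mul0r, mulr0, addr0).
have -> : pr w a = 1 by rewrite /pr pa.
have := cls a b ap pa bk le; rewrite !mul1r => c.
by rewrite -!mulrDl ler_wpM2r.
Qed.

(** The common pairs also occur for w', because primitive periods below p agree and [com] is at most
    the period indicator of w'; all other pairs contribute nonnegatively. *)
Lemma wrapsum_ge E : (forall s, (k <= s < k + k)%N -> 0 <= E s) -> common E <= wrapsum w' E.
Proof.
move=> E0.
have tE a b : (a < k)%N -> (b < k)%N -> 0 <= (k <= a + b)%N%:R * E (a + b)%N.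
  move=> ak bk; case: leqP => le; rewrite ?mul0r // mul1r E0 //; lia.
rewrite /wrapsum kk (@sum_nat_cat _ _ 0 p k); last by lia.
rewrite -[leLHS]addr0 lerD //; last first.
  apply: sumr_nat_ge0 => a ak; apply: sumr_nat_ge0 => b bk.
  by rewrite mulrCA mulr_ge0 ?tE ?mulr_ge0 ?pr_ge0 ?cr_ge0 //; lia.
apply: ler_sum_nat => a ap; apply: ler_sum_nat => b bk.
rewrite pr_agree; last by lia.
rewrite !(mulrCA (k <= a + b)%N%:R) -2!(mulrA (pr w' a)) ler_wpM2l ?pr_ge0 //.
by apply: ler_wpM2r; [apply: tE; lia | apply: com_le].
Qed.

Lemma common_sub E E' : common E - common E' = common (fun s => E s - E' s).
Proof.
rewrite /common -sumrB; apply: eq_big_nat => a _; rewrite -sumrB.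
by apply: eq_big_nat => b _; ring.
Qed.
End WrapSplit.

Section Common.
Variable Omega : finType.
Variables w w' : seq Omega.
Variable p : nat.
Hypothesis pk : (p < size w)%N.
Local Notation k := (size w).

Lemma common_mono E E' : (forall s, (k <= s < k + k)%N -> E s <= E' s) ->
  common w w' p E <= common w w' p E'.
Proof.
move=> EE; apply: ler_sum_nat => a ap; apply: ler_sum_nat => b bk.
case: (leqP k (a + b)) => kab; last by rewrite !mul0r.
rewrite !mul1r; apply: ler_wpM2l; first by apply: mulr_ge0; rewrite ?pr_ge0 ?com_ge0.
by apply: EE; lia.
Qed.

Lemma common_const B : 0 <= B -> common w w' p (fun=> B) <= (k * k)%N%:R * B.
Proof.
move=> B0; apply: le_trans (_ : \sum_(0 <= a < p) \sum_(0 <= b < k) B <= _).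
  apply: ler_sum_nat => a ap; apply: ler_sum_nat => b bk.
  case: (leqP k (a + b)) => kab; rewrite ?mul0r // mul1r ler_piMl //.
  have := pr_le1 w a; have := pr_ge0 w a; have := com_ge0 w w' p b.
  have := le_trans (com_le w w' p b) (cr_le1 w' b); nra.
rewrite !sumr_const_nat !subn0 -mulrnA -[leLHS]mulr_natl ler_wpM2r // ler_nat.
by rewrite leq_mul2l ltnW // orbT.
Qed.

Lemma commonD E E' : common w w' p (fun s => E s + E' s) = common w w' p E + common w w' p E'.
Proof.
rewrite /common -big_split; apply: eq_big_nat => a _; rewrite -big_split /=.
by apply: eq_big_nat => b _; rewrite -!mulrDr.
Qed.

End Common.

(** * The least period and the primitive periods beyond it *)

Section MinimalPeriod.
Variable Omega : finType.
Hypothesis hq : (1 < #|Omega|)%N.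
Variables w : seq Omega.
Hypothesis w0 : (0 < size w)%N.
Local Notation k := (size w).

Lemma per_mul g m : per w g -> (m * g <= k)%N -> per w (m * g).
Proof.
move=> pg; elim: m => [|m IH] le; first exact: per0.
by rewrite mulSn; apply: per_add => //; apply: IH; rewrite (leq_trans _ le) // leq_mul2r leqnSn orbT.
Qed.

Variable g : nat.
Hypothesis g0 : (0 < g <= k)%N.
Hypothesis pg : per w g.
Hypothesis gmin : forall b, (0 < b < g)%N -> ~~ per w b.

Lemma per_dvd b : (0 < b <= k)%N -> per w b -> (g + b <= k + gcdn g b)%N -> (g %| b)%N.
Proof.
move=> bk pb le; have pgb := per_gcd g0 bk pg pb le.
have g1 : (0 < g)%N by case/andP: g0.
have g2 : (0 < gcdn g b)%N by rewrite gcdn_gt0 g1.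
have g3 : (gcdn g b <= g)%N by apply: dvdn_leq (dvdn_gcdl g b).
have [E|ne] := eqVneq (gcdn g b) g; first by rewrite -E dvdn_gcdr.
have /gmin : (0 < gcdn g b < g)%N by lia.
by rewrite pgb.
Qed.

Lemma prim_min a : (0 < a < k)%N -> prim w a -> (g <= a)%N.
Proof.
move=> ak /(prim_per hq w0) pa; rewrite leqNgt; apply/negP => lt.
by have := gmin (b := a); rewrite pa //; [move=> /(_ _)/negP; apply; lia|lia].
Qed.

(** Otherwise Fine-Wilf makes b a multiple of g, and g + (b - g) contradicts [prim_indec]. *)
Lemma prim_far b : (g < b < k)%N -> prim w b -> (k + gcdn g b < g + b)%N.
Proof.
move=> bk pb; rewrite ltnNge; apply/negP => le.
have gb : (g %| b)%N by apply: per_dvd => //; [lia | apply: prim_per => //; lia].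
have pm : per w (b - g).
  by case/dvdnP: gb => m bE; rewrite bE -[X in (_ - X)%N]mul1n -mulnBl per_mul // mulnBl mul1n -bE; lia.
have pgm : prim w g.
  have gk : (0 < g < k)%N by lia.
  have [a [ag pa pga]] := per_prim hq w0 gk pg.
  have : (g <= a)%N by apply: prim_min => //; lia.
  by move=> ga; have -> : g = a by lia.
have bE : (b = g + (b - g))%N by lia.
have := @prim_indec _ hq w w0 g (b - g)%N; rewrite -bE pb => H.
by have := H _ _ pgm pm; lia.
Qed.

(** Split b as a + (b - a) with a primitive. If a were not g, [prim_far] would leave no room below k
    for b - a >= g. So a = g, and b - g is short enough for Fine-Wilf to make it a multiple of g. *)
Lemma per_nonprim b : (g < b < k)%N -> (k <= g + b)%N -> per w b -> ~~ prim w b -> (g %| b)%N.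
Proof.
move=> bk kb pb nb; have bk' : (0 < b < k)%N by lia.
have [a [ab pa pba]] := per_prim hq w0 bk' pb.
have ga : (g <= a)%N by apply: prim_min => //; lia.
have ne : a != b by apply/eqP => E; rewrite -E pa in nb.
have gba : (g <= b - a)%N.
  rewrite leqNgt; apply/negP => lt; have := gmin (b := (b - a)%N).
  by rewrite pba => /(_ _)/negP; apply; lia.
have [E|na] := eqVneq a g; last first.
  have ga' : (g < a < k)%N by lia.
  have H := prim_far ga' pa; exfalso; move: H gba bk ab; clear; generalize (gcdn g a); lia.
rewrite E in pba gba; have gb : (g + (b - g) <= k + gcdn g (b - g))%N.
  rewrite subnKC; last by lia.
  by case/andP: bk => _ bk; rewrite (leq_trans (ltnW bk)) // leq_addr.
have gb' : (0 < b - g <= k)%N by lia.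
have -> : b = (g + (b - g))%N by lia.
by rewrite dvdn_add // per_dvd.
Qed.
End MinimalPeriod.

Section Star.
Variable Omega : finType.
Hypothesis hq : (1 < #|Omega|)%N.
Variables w w' : seq Omega.
Hypothesis w0 : (0 < size w)%N.
Hypothesis kk : size w' = size w.
Variable p : nat.
Hypothesis p0 : (0 < p)%N.
Hypothesis pk : (p < size w)%N.
Hypothesis pp : per w p.
Hypothesis np : ~~ per w' p.
Hypothesis agree : forall b, (b < p)%N -> per w b = per w' b.
Local Notation k := (size w).
Local Notation q := (#|Omega|%:R : rat).
Local Notation e := (er w w').

Let w0' : (0 < size w')%N. Proof. by rewrite kk. Qed.
Let prA a : (a < p)%N -> pr w a = pr w' a. Proof. by move=> ap; apply: pr_agree ap. Qed.
Let pr1 : pr w p = 1. Proof. by have [] := pr_p hq w0 kk p0 pk pp np agree. Qed.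
Let pr1' : pr w' p = 0. Proof. by have [] := pr_p hq w0 kk p0 pk pp np agree. Qed.

Lemma rows_split (F F' : nat -> rat) :
  \sum_(0 <= a < k) pr w a * F a - \sum_(0 <= a < k) pr w' a * F' a =
  \sum_(0 <= a < p) pr w a * (F a - F' a) + F p +
  \sum_(0 <= b < k) (p < b)%N%:R * pr w b * F b - \sum_(p.+1 <= b < k) pr w' b * F' b.
Proof.
have tail : \sum_(0 <= b < k) (p < b)%N%:R * pr w b * F b = \sum_(p.+1 <= b < k) pr w b * F b.
  rewrite (@sum_nat_cat _ _ 0 p.+1 k); last by lia.
  rewrite big_nat_eq0 ?add0r => [|a ap]; last first.
    by rewrite ltnNge (_ : (a <= p)%N) ?mul0r //; lia.
  by apply: eq_big_nat => b /andP[-> _]; rewrite mul1r.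
rewrite tail !(@sum_nat_cat _ _ 0 p k); try lia.
rewrite !(big_ltn pk) pr1 pr1' mul1r mul0r add0r.
have -> : \sum_(0 <= a < p) pr w a * (F a - F' a) =
   \sum_(0 <= a < p) pr w a * F a - \sum_(0 <= a < p) pr w' a * F' a.
  by rewrite -sumrB; apply: eq_big_nat => a ap; rewrite -prA ?mulrBr //; lia.
by ring.
Qed.

(** Difference of the two inversions [yr_inv]. A primitive period b > p of w contributes h(n - b),
    which pays for [rowX b]; the primitive periods of w' beyond p are bounded by all j > p. *)
Lemma star n : (k + k <= n)%N -> classified w w' p ->
  (forall b, (p < b < k)%N -> prim w b -> rowX w p b (fun s => yr w (n + k - s)) <= hr w (n - b)) ->
  - e n + \sum_(0 <= a < p) pr w a * e (n - a) + hr w (n - p)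
    - \sum_(p.+1 <= j < k) hr w' (n - j) + common w w' p (fun s => xr w w' (n + k - s))
    - rowp w p (fun s => yr w (n + k - s)) <= xr w w' (n + k).
Proof.
move=> le cls XB; set Y := fun s => yr w (n + k - s).
set Y' := fun s => yr w' (n + k - s).
have Y0 s : (k <= s < k + k)%N -> 0 <= Y s by move=> sk; apply: yr_ge0 => //; lia.
have Y0' s : (k <= s < k + k)%N -> 0 <= Y' s by move=> sk; apply: yr_ge0 => //; rewrite kk; lia.
have := wrapsum_le kk pk pr1 cls Y0; have := wrapsum_ge kk pk prA Y0'.
have X : \sum_(0 <= b < k) (p < b)%N%:R * pr w b * rowX w p b Y <=
         \sum_(0 <= b < k) (p < b)%N%:R * pr w b * hr w (n - b).
  apply: ler_sum_nat => b bk; case: ltnP => pb; rewrite ?mul0r // mul1r.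
  by rewrite /pr; case pb': prim; rewrite ?mul0r // !mul1r XB //; lia.
have T : \sum_(p.+1 <= b < k) pr w' b * hr w' (n - b) <= \sum_(p.+1 <= b < k) hr w' (n - b).
  by apply: ler_sum_nat => b _; rewrite ler_piMl ?hr_ge0 ?pr_le1.
have C : common w w' p (fun s => xr w w' (n + k - s)) = common w w' p Y' - common w w' p Y.
  by rewrite common_sub.
have R := rows_split (fun b => hr w (n - b)) (fun b => hr w' (n - b)).
have S : \sum_(0 <= a < p) pr w a * (hr w (n - a) - hr w' (n - a)) = \sum_(0 <= a < p) pr w a * e (n - a) by [].
have kn' : (size w' <= n)%N by rewrite kk; lia.
have := yr_inv hq w0' kn'; rewrite kk -/Y' => E'.
have kn : (k <= n)%N by lia.
have := yr_inv hq w0 kn; rewrite -/Y => E.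
by rewrite /xr E E' /er; move: X T C R S; lra.
Qed.

End Star.

Section StepBack.
Variable Omega : finType.
Hypothesis hq : (1 < #|Omega|)%N.
Variables w w' : seq Omega.
Hypothesis w0 : (0 < size w)%N.
Hypothesis kk : size w' = size w.
Local Notation k := (size w).
Local Notation q := (#|Omega|%:R : rat).
Local Notation e := (er w w').

(** The recurrence of e unrolled over i steps, with each increment bounded by xr(m) <= h'(m - k). *)
Lemma hr_step_back n i : (k + k + i <= n + 1)%N ->
  e n - \sum_(0 <= j < i) q ^+ j * hr w' (n - k - j) <= q ^+ i * e (n - i).
Proof.
elim: i => [|i IH] le; first by rewrite big_geq // subr0 subn0 mul1r.
rewrite big_nat_recr //=; have := IH _; rewrite (_ : (_ <= _)%N); last by lia.
move=> /(_ isT) H.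
have -> : q ^+ i.+1 * e (n - i.+1) = q ^+ i * e (n - i) - q ^+ i * xr w w' (n - i).
  have -> : (n - i = (n - i.+1).+1)%N by lia.
  by rewrite erS // exprS; ring.
have : q ^+ i * xr w w' (n - i) <= q ^+ i * hr w' (n - k - i).
  rewrite ler_wpM2l ?exprn_ge0 //.
  have : 0 <= yr w (n - i) by apply: yr_ge0 => //; lia.
  have : yr w' (n - k - i + size w') <= hr w' (n - k - i) by apply: yr_le => //; rewrite kk; lia.
  rewrite kk (_ : n - k - i + k = n - i)%N; last by lia.
  by rewrite /xr; lra.
by move: H; lra.
Qed.
End StepBack.

(** * Tails of the hitting counts *)

Section TailSums.
Variable Omega : finType.
Hypothesis hq : (1 < #|Omega|)%N.
Variable w : seq Omega.
Hypothesis w0 : (0 < size w)%N.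
Local Notation k := (size w).

Lemma tail_gt_le n i : (Q_start w + i <= n)%N ->
  \sum_(i.+1 <= b < k) hr w (n - b) <= hr w (n - i).
Proof.
move=> Qn; have Qn' : (Q_start w <= n - i)%N by lia.
apply: le_trans (gap_ge0 hq w0 Qn').
have [ki|ik] := leqP k i.+1.
  by rewrite big_geq // sumr_nat_ge0 // => j _; apply: hr_ge0.
rewrite (@sum_nat_cat _ _ 1 (k - i) k); last by lia.
rewrite -[leLHS]addr0 lerD //; last by apply: sumr_nat_ge0 => j _; apply: hr_ge0.
rewrite -(add1n i) big_addn le_eqVlt; apply/orP; left; apply/eqP.
by apply: eq_big_nat => j _; congr hr; lia.
Qed.

Lemma tail_ge_le n i : (Q_start w + i <= n)%N -> \sum_(i <= b < k) hr w (n - b) <= 2 * hr w (n - i).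
Proof.
move=> Qn; have [ki|ik] := leqP k i; first by rewrite big_geq // mulr_ge0 ?hr_ge0.
by rewrite big_ltn //; have := tail_gt_le Qn; lra.
Qed.

Lemma tail_add_le n i j : (Q_start w + i + j <= n)%N ->
  \sum_(j <= b < k) hr w (n - (i + b)) <= 2 * hr w (n - (i + j)).
Proof.
move=> Qn; rewrite subnDA; apply: le_trans (@tail_ge_le (n - i) j _); last by lia.
by apply: ler_sum_nat => b _; rewrite subnDA.
Qed.

Lemma tail3_le n : (Q_start w + 2 <= n)%N -> 2 * \sum_(3 <= c < k) hr w (n - c) <= hr w n.
Proof.
move=> Qn; have h1 := tail_gt_le Qn.
have [k3|k3] := leqP k 3; first by rewrite big_geq // mulr0 hr_ge0.
have h3 : hr w (n - 1) + hr w (n - 2) <= hr w n.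
  have Qn' : (Q_start w <= n)%N by lia.
  apply: le_trans (gap_ge0 hq w0 Qn').
  apply: (@sum_nat_ge_term2 _ (fun j => hr w (n - j))) => //; lia.
have h4 : hr w (n - 2) <= hr w (n - 1) by apply: hr_nondec => //; lia.
by rewrite mulr_natl mulr2n; apply: le_trans h3; rewrite lerD // (le_trans h1).
Qed.

(** The superincreasing property at n - i, whose window reaches i places further back than that of
    n. *)
Lemma gap_window n i : (Q_start w + i <= n)%N -> (i < k)%N ->
  \sum_(0 <= j < i) hr w (n - k - j) <= hr w (n - i) - \sum_(i.+1 <= j < k) hr w (n - j).
Proof.
move=> Qn ik; have Qn' : (Q_start w <= n - i)%N by lia.
have := gap_ge0 hq w0 Qn'.
have -> : \sum_(1 <= j < k) hr w (n - i - j) =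
    \sum_(i.+1 <= j < k) hr w (n - j) + \sum_(0 <= j < i) hr w (n - k - j).
  have -> : \sum_(0 <= j < i) hr w (n - k - j) = \sum_(k <= j < k + i) hr w (n - j).
    rewrite -[in RHS](add0n k) big_addn add0n addKn; apply: eq_big_nat => j _; congr hr; lia.
  rewrite -(@sum_nat_cat _ _ i.+1 k (k + i)); last by lia.
  by rewrite -[in RHS](addn1 i) addnC big_addn addnK; apply: eq_big_nat => j _; congr hr; lia.
by lra.
Qed.

(** For q = 2, h(n + 1) dominates its four predecessors, each at least half of the next, and 15/8 =
    1 + 1/2 + 1/4 + 1/8; k >= 5 makes the window contain all four. For q >= 3 the ratio is at least
    2. *)
Lemma hr_ratio n : (5 <= k)%N -> (Q_start w <= n.+1)%N -> 15%:R * hr w n <= 8%:R * hr w n.+1.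
Proof.
rewrite /Q_start; case: eqP => [qE|qE] k5 Qn; last first.
  have q3 : (3%:R : rat) <= #|Omega|%:R by rewrite ler_nat; lia.
  by have := hr_geS hq w0 n; have := hr_ge0 w n; nra.
have qE' : (#|Omega|%:R : rat) = 2 by rewrite qE.
have Qn' : (Q_start w <= n.+1)%N by rewrite /Q_start qE eqxx.
have S : hr w n + hr w (n - 1) + hr w (n - 2) + hr w (n - 3) <= hr w n.+1.
  apply: le_trans (gap_ge0 hq w0 Qn').
  rewrite (@sum_nat_cat _ _ 1 5 k); last by lia.
  rewrite 4?big_ltn // big_geq // addr0 !subSS subn0 !addrA lerDl.
  by apply: sumr_nat_ge0 => *; apply: hr_ge0.
have D i : (k <= n - i.+1)%N -> hr w (n - i) <= 2 * hr w (n - i.+1).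
  by move=> ki; have := hr_leS ki; rewrite qE' (_ : (n - i.+1).+1 = n - i)%N //; lia.
have d0 : hr w n <= 2 * hr w (n - 1) by rewrite -{1}[n]subn0; apply: D; lia.
have d1 : hr w (n - 1) <= 2 * hr w (n - 2) by apply: D; lia.
have d2 : hr w (n - 2) <= 2 * hr w (n - 3) by apply: D; lia.
by move: S d0 d1 d2; lra.
Qed.

Variables p g : nat.
Hypothesis g3 : (3 <= g <= p)%N.
Hypothesis pk : (p < k)%N.
Hypothesis gmin : forall b, (0 < b < g)%N -> ~~ per w b.

Lemma cr_below b : (0 < b < g)%N -> cr w b = 0.
Proof. by move=> bg; rewrite /cr (negbTE (gmin bg)). Qed.

Lemma pr_below b : (b < g)%N -> pr w b = 0.
Proof.
case: b => [|b] bg; first exact: pr0.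
rewrite /pr; case E: (prim w b.+1) => //.
have bk : (b.+1 < k)%N by lia.
by have := gmin (b := b.+1); rewrite (prim_per hq w0 bk E) => /(_ _)/negP; case; lia.
Qed.

(** Nonzero periods and primitive periods are at least g >= 3. The periods fill at most one tail
    from 3 on; p and the primitive periods below it fill at most a second one. *)
Lemma rowX_le b E : (b < k)%N -> (forall s, (k <= s < k + k)%N -> 0 <= E s) ->
  rowX w p b E <= 2 * \sum_(3 <= c < k) (k <= b + c)%N%:R * E (b + c)%N.
Proof.
move=> bk E0.
have T0 c : (c < k)%N -> 0 <= (k <= b + c)%N%:R * E (b + c)%N.
  by move=> ck; case: leqP => le; rewrite ?mul0r // mul1r E0 //; lia.
have h1 : \sum_(0 <= c < k) (k <= b + c)%N%:R * (cr w c * E (b + c)%N) <=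
    \sum_(3 <= c < k) (k <= b + c)%N%:R * E (b + c)%N.
  rewrite (@sum_nat_cat _ _ 0 3 k); last by lia.
  rewrite big_nat_eq0 ?add0r => [|c c3]; last first.
    case: c c3 => [|c] c3; first by rewrite addn0 leqNgt bk mul0r.
    by rewrite cr_below ?mul0r ?mulr0 //; lia.
  by apply: ler_sum_nat => c ck; rewrite mulrCA ler_piMl ?cr_le1 ?T0 //; lia.
have h2 : (k <= b + p)%N%:R * E (b + p)%N + \sum_(0 <= a < p) (k <= b + a)%N%:R * (pr w a * E (b + a)%N)
   <= \sum_(3 <= c < k) (k <= b + c)%N%:R * E (b + c)%N.
  rewrite (@sum_nat_cat _ _ 3 p k); last by lia.
  rewrite addrC lerD //.
    rewrite (@sum_nat_cat _ _ 0 3 p); last by lia.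
    rewrite big_nat_eq0 ?add0r => [|a a3]; last by rewrite pr_below ?mul0r ?mulr0 //; lia.
    by apply: ler_sum_nat => c ck; rewrite mulrCA ler_piMl ?pr_le1 ?T0 //; lia.
  apply: (@sum_nat_ge_term _ (fun c => (k <= b + c)%N%:R * E (b + c)%N)); first by lia.
  by move=> c ck; apply: T0; lia.
by rewrite /rowX -addrA; move: h1 h2; lra.
Qed.

Lemma rowX_hr n b E : (b < k)%N -> (Q_start w + b + 2 <= n)%N ->
  (forall s, (k <= s < k + k)%N -> 0 <= E s <= hr w (n - s)) -> rowX w p b E <= hr w (n - b).
Proof.
move=> bk Qn E0; apply: le_trans (rowX_le bk _) _ => [s /E0/andP[]//|].
apply: le_trans (@tail3_le (n - b) _); last by lia.
rewrite ler_pM2l //; apply: ler_sum_nat => j jk.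
case: leqP => bj; rewrite ?mul0r ?hr_ge0 // mul1r -subnDA.
by have /andP[] : 0 <= E (b + j)%N <= hr w (n - (b + j)) by apply: E0; lia.
Qed.
End TailSums.

(** * The least period of w is not a period of w' *)

Section FirstPeriodDiffers.
Variable Omega : finType.
Hypothesis hq : (1 < #|Omega|)%N.
Variables w w' : seq Omega.
Hypothesis w0 : (0 < size w)%N.
Hypothesis kk : size w' = size w.
Variable p : nat.
Hypothesis p1 : (1 < p)%N.
Hypothesis pk : (p < size w)%N.
Hypothesis pp : per w p.
Hypothesis np : ~~ per w' p.
Hypothesis agree : forall b, (b < p)%N -> per w b = per w' b.
Hypothesis pmin : forall b, (0 < b < p)%N -> ~~ per w b.
Local Notation k := (size w).
Local Notation q := (#|Omega|%:R : rat).
Local Notation e := (er w w').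

Let w0' : (0 < size w')%N. Proof. by rewrite kk. Qed.
Let q2 : 2 <= q. Proof. by rewrite ler_nat. Qed.
Let p0 : (0 < p)%N. Proof. by apply: ltnW. Qed.
Let pk' : (0 < p <= k)%N. Proof. by rewrite p0 ltnW. Qed.

Lemma pr_zero a : (a < p)%N -> pr w a = 0.
Proof.
case: a => [|a] ap; first exact: pr0.
rewrite /pr; case E: (prim w a.+1) => //.
by have := @prim_min _ hq w w0 p pk' pp pmin a.+1 _ E; lia.
Qed.

Lemma classified_min : classified w w' p.
Proof. by move=> a b ap pa; have := pr_zero ap; rewrite /pr pa => /eqP; rewrite oner_eq0. Qed.

Lemma common_min E : common w w' p E = 0.
Proof.
by apply: big_nat_eq0 => a ap; apply: big_nat_eq0 => b bk; rewrite pr_zero ?mul0r ?mulr0 //; lia.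
Qed.

(** A partner b of p that is not a primitive period beyond p is a multiple of p by [per_nonprim],
    and b lies between k - p and k. Hence p + b can only be c, the least multiple of p that is at
    least k. *)
Lemma rowp_min : exists2 c, (k <= c < k + p)%N &
  forall E, (forall s, (k <= s < k + k)%N -> 0 <= E s) -> rowp w p E <= E c.
Proof.
pose m := ((k + p.-1) %/ p)%N; pose c := (m * p)%N.
have ck : (k <= c < k + p)%N.
  by have := divn_eq (k + p.-1) p; have := ltn_pmod (k + p.-1) p0; rewrite /c /m; lia.
exists c => // E E0; rewrite /rowp [X in _ + X]big_nat_eq0 ?addr0 => [|a ap]; last first.
  by rewrite pr_zero ?mul0r ?mulr0 //; lia.
have -> : E c = \sum_(0 <= b < k) (b == c - p)%N%:R * E (p + b)%N.
  by rewrite sum_nat_if ?subnKC //; lia.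
apply: ler_sum_nat => b bk; have [le|lt] := leqP k (p + b); last first.
  by rewrite mul0r; case: eqP => [bE|_]; rewrite ?mul0r // mul1r bE; have := ck; lia.
have Eb : 0 <= E (p + b)%N by apply: E0; lia.
rewrite mul1r ler_wpM2r //; have [bE|ne] := eqVneq b (c - p)%N.
  have := cr_le1 w b; have : 0 <= (p < b)%N%:R * pr w b by rewrite mulr_ge0 ?ler0n.
  by rewrite mulr1n; lra.
rewrite mulr0n subr_le0 /cr; case pb: (per w b); last by rewrite mulr_ge0 ?ler0n.
have nd : ~~ (p %| b)%N.
  apply/negP => /dvdnP[m' bE].
  have m1 : (m'.+1 * p < m.+1 * p)%N by rewrite !mulSn -bE -/c; lia.
  have m2 : (m * p < m'.+2 * p)%N by rewrite !mulSn -bE -/c; lia.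
  move: m1 m2; rewrite !ltn_pmul2r // !ltnS => m1 m2.
  by case/eqP: ne; rewrite bE /c (_ : m = m'.+1) ?mulSn ?addKn //; lia.
have bp : (p < b)%N.
  rewrite ltnNge leq_eqVlt; apply/negP => /orP[/eqP E1|lt]; first by rewrite E1 dvdnn in nd.
  by have := pmin (b := b); rewrite pb => /(_ _)/negP; apply; lia.
rewrite bp mul1r /pr; case pr_b: (prim w b) => //.
case/negP: nd; apply: (per_nonprim hq w0 pk' pp pmin) => //; rewrite ?pr_b //; lia.
Qed.

(** Chosen to be at least [Q_start w + k + 1], which is 4k for q = 2. *)
Definition start1 : nat := if #|Omega| == 2 then (4 * k)%N else (3 * k)%N.

Lemma start1_Q : (3 * k <= start1)%N /\ (Q_start w + k + 1 <= start1)%N.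
Proof. by rewrite /start1 /Q_start; case: eqP => _; lia. Qed.

Lemma step_min n : (start1 <= n)%N -> exists2 c, (k <= c < k + p)%N &
  - xr w w' (n + k) <= Num.max (e n) 0 + Num.max (e (n - c)) 0.
Proof.
have [st1 st2] := start1_Q; move=> le; have [c ck rp] := rowp_min; exists c => //.
have nkS : (n - k = (n - k - 1).+1)%N by lia.
have nk1 : (k <= n - k - 1)%N by lia.
have kc : (k <= c)%N by lia.
set Y := fun s => yr w (n + k - s).
have Y0 s : (k <= s < k + k)%N -> 0 <= Y s by move=> sk; apply: yr_ge0 => //; lia.
have Yh s : (k <= s < k + k)%N -> 0 <= Y s <= hr w (n - s).
  move=> sk; rewrite Y0 //= /Y (_ : n + k - s = n - s + k)%N; last by lia.
  by apply: yr_le => //; lia.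
have XB b : (p < b < k)%N -> prim w b -> rowX w p b Y <= hr w (n - b).
  move=> bk pb; have far := prim_far hq w0 pk' pp pmin bk pb.
  have g0 : (0 < gcdn p b)%N by rewrite gcdn_gt0 p0.
  have p3 : (3 <= p <= p)%N by move: (gcdn p b) g0 far => g; lia.
  by apply: (rowX_hr hq w0 p3 pk pmin) => //; lia.
have nk : (k + k <= n)%N by lia.
have := star hq w0 kk p0 pk pp np agree nk classified_min XB.
rewrite common_min addr0 big_nat_eq0 ?addr0 => [|a ap]; last by rewrite pr_zero ?mul0r //; lia.
have hp := rp Y Y0; have /andP[_ hc] : 0 <= Y c <= hr w (n - c) by apply: Yh; lia.
move=> st.
pose H j := hr w' (n - k - j).
have hsub : hr w' (n - p) - \sum_(p.+1 <= j < k) hr w' (n - j) >= \sum_(0 <= j < p) H j.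
  have Qn : (Q_start w' + p <= n)%N by rewrite /Q_start kk -/(Q_start w); lia.
  by have := gap_window hq w0' Qn; rewrite kk; apply.
have sb : (k + k + p <= n + 1)%N by lia.
have back := hr_step_back hq w0 kk sb.
have H0 j : 0 <= H j by apply: hr_ge0.
have q1 : 1 <= q by have := q2; lra.
have H01 : H 0%N <= q * H 1%N.
  by rewrite /H subn0 {1}nkS; apply: hr_leS => //; rewrite kk.
(* For 2 <= j < p, q^j <= q^p. The first two terms together are at most 2 q H(1) <= q^p H(1),
   because H(0) <= q H(1) and p >= 2; this frees H(0) for the wrapped pair. *)
have key : \sum_(0 <= j < p) q ^+ j * H j <= q ^+ p * \sum_(1 <= j < p) H j.
  rewrite mulr_sumr big_ltn // expr0 mul1r.
  rewrite !(@big_ltn _ _ _ 1 p) // addrA lerD //.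
    have : q ^+ 2 * H 1%N <= q ^+ p * H 1%N.
      by rewrite ler_wpM2r // ler_weXn2l.
    have : 2 * (q * H 1%N) <= q * (q * H 1%N) by rewrite ler_wpM2r // mulr_ge0.
    by rewrite expr2 expr1 -mulrA; move: H01; lra.
  by apply: ler_sum_nat => j /andP[_ /ltnW jp]; rewrite ler_wpM2r // ler_weXn2l.
have Hc : hr w' (n - c) <= H 0%N by rewrite /H subn0; apply: hr_nondec => //; apply: leq_sub2l.
have Hs : \sum_(0 <= j < p) H j = H 0%N + \sum_(1 <= j < p) H j by rewrite big_ltn.
set z := q ^+ p in back key.
have z1 : 1 <= z by rewrite exprn_ege1.
have em : e n <= Num.max (e n) 0 by rewrite le_max lexx.
have em0 : 0 <= Num.max (e n) 0 by rewrite le_max lexx orbT.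
have ec : e (n - c) <= Num.max (e (n - c)) 0 by rewrite le_max lexx.
move: em em0 ec; set M1 := Num.max _ _; set M2 := Num.max _ _ => em em0 ec.
have ecE : hr w (n - c) = hr w' (n - c) + e (n - c) by rewrite /er; lra.
have epE : hr w (n - p) = hr w' (n - p) + e (n - p) by rewrite /er; lra.
have zpos : 0 < z by lra.
(* After scaling by q^p, [back] trades q^p e(n - p) for e(n) minus the weighted window. By [key]
   that window is paid by the one gained in [hsub], whose term H(0) covers the pair with sum c. *)
rewrite -(ler_pM2l zpos).
have st' : z * (- xr w w' (n + k)) <= z * (e n - e (n - p) - (\sum_(0 <= j < p) H j) + H 0%N + M2).
  by rewrite ler_pM2l //; move: st hc hp hsub ecE epE ec Hc; lra.
apply: le_trans st' _.
have E1 : z * (e n - e (n - p) - \sum_(0 <= j < p) H j + H 0%N + M2) =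
  z * e n - z * e (n - p) - z * (\sum_(1 <= j < p) H j) + z * M2 by rewrite Hs; ring.
have E2 : (z - 1) * e n <= (z - 1) * M1 by rewrite ler_wpM2l //; lra.
rewrite E1 -/H in back *; move: back key E2; rewrite mulrDr.
rewrite !mulrBl; lra.
Qed.
End FirstPeriodDiffers.

Section HalfSums.
Variable F : nat -> rat.

(** The sum of F(j) / 2^(a-j) over j < a: the error collected when the recurrence of e is run a
    steps backwards with division by 2. *)
Fixpoint halfsum a : rat := if a is a'.+1 then (halfsum a' + F a') / 2%:R else 0.

Lemma halfsumS a : 2 * halfsum a.+1 = halfsum a + F a.
Proof. by rewrite /= mulrC divfK. Qed.

(** From index 2 on, [halfsum F j] is at least F(j), since its last two terms give (1/2)(15/8) +
    (1/4)(15/8)^2 > 1; averaging it with F(j) then cannot increase it. *)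
Lemma halfsum_nonincr a b : (forall j, 0 <= F j) ->
  (forall j, (j < b)%N -> 15%:R * F j.+1 <= 8%:R * F j) -> (2 <= a <= b)%N -> halfsum b <= halfsum a.
Proof.
move=> F0 ratio.
have ge j : (2 <= j <= b)%N -> F j <= halfsum j.
  case: j => [|[|j]] // jb; have [E1 E2] := (halfsumS j.+1, halfsumS j).
  have h0 : 0 <= halfsum j.
    by elim: j {jb E1 E2} => [|i IH] //; have := halfsumS i; have := F0 i; move: IH; lra.
  have r1 := ratio j.+1; have r2 := ratio j.
  have {}r1 : 15%:R * F j.+2 <= 8%:R * F j.+1 by apply: r1; lia.
  have {}r2 : 15%:R * F j.+1 <= 8%:R * F j by apply: r2; lia.
  by move: E1 E2 h0 (F0 j) (F0 j.+1) (F0 j.+2) r1 r2; lra.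
elim: b ratio ge => [|b IH] ratio ge ab; first by lia.
have [<-//|ne] := eqVneq a b.+1.
have ab' : (2 <= a <= b)%N by lia.
apply: le_trans (IH _ _ ab') => [|j jb|j jb]; last 2 first.
- by apply: ratio; lia.
- by apply: ge; lia.
by have := halfsumS b; have := ge b; rewrite (_ : (_ && _)); [move=> /(_ isT); lra | lia].
Qed.

Lemma halfsum_sum m : (5 <= m)%N ->
  \sum_(5 <= a < m.+1) halfsum a + halfsum m = halfsum 4 + \sum_(4 <= a < m) F a.
Proof.
elim: m => [|m IH] // m5; have [E|ne] := eqVneq m 4%N.
  by rewrite E !big_nat1 -mulr2n -mulr_natl halfsumS.
have m4 : (4 <= m)%N by lia.
have m5' : (5 <= m)%N by lia.
rewrite big_nat_recr // [in RHS]big_nat_recr //= addrA -IH //.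
by have := halfsumS m; lra.
Qed.
End HalfSums.

(** * The least period of w is shared *)

Section SharedFirstPeriod.
Variable Omega : finType.
Hypothesis hq : (1 < #|Omega|)%N.
Variables w w' : seq Omega.
Hypothesis w0 : (0 < size w)%N.
Hypothesis kk : size w' = size w.
Variables p g : nat.
Hypothesis g1 : (1 < g < p)%N.
Hypothesis pk : (p < size w)%N.
Hypothesis pp : per w p.
Hypothesis np : ~~ per w' p.
Hypothesis agree : forall b, (b < p)%N -> per w b = per w' b.
Hypothesis pg : per w g.
Hypothesis gmin : forall b, (0 < b < g)%N -> ~~ per w b.
Local Notation k := (size w).
Local Notation q := (#|Omega|%:R : rat).
Local Notation e := (er w w').

Let w0' : (0 < size w')%N. Proof. by rewrite kk. Qed.
Let gk : (0 < g <= k)%N. Proof. by lia. Qed.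

Lemma ndvd_gp : ~~ (g %| p)%N.
Proof.
apply/negP => /dvdnP[m pE]; case/negP: np; rewrite pE; apply: per_mul => //.
  by rewrite -agree //; lia.
by rewrite kk -pE ltnW.
Qed.

(** Otherwise Fine-Wilf makes p a multiple of g, and w', which shares g, would have the period p.
    The 2 combines a strict inequality with gcd >= 1. *)
Lemma gp_far : (k + 2 <= p + g)%N.
Proof.
have [le|] := leqP (g + p) (k + gcdn g p).
  case/negP: ndvd_gp; apply: (per_dvd hq w0 gk pg gmin) => //; lia.
by have : (0 < gcdn g p)%N; [rewrite gcdn_gt0; lia | move: (gcdn g p) => c; lia].
Qed.

Lemma g_ge3 : (3 <= g <= p)%N.
Proof. by have := gp_far; lia. Qed.

Lemma prim_g : prim w g.
Proof.
have gk' : (0 < g < k)%N by lia.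
have [a [ag pa pga]] := per_prim hq w0 gk' pg.
have : (g <= a)%N by apply: (prim_min hq w0 gk pg gmin) => //; lia.
by move=> ga; have -> : g = a by lia.
Qed.

Lemma prim_other a : (0 < a < k)%N -> prim w a -> a != g -> (k + 2 <= g + a)%N.
Proof.
move=> ak pa ne; have ga : (g <= a)%N by apply: (prim_min hq w0 gk pg gmin).
have gak : (g < a < k)%N by lia.
have := prim_far hq w0 gk pg gmin gak pa.
by have : (0 < gcdn g a)%N; [rewrite gcdn_gt0; lia | move: (gcdn g a) => c; lia].
Qed.

(** Such a b is the sum of two nonzero periods, each at least g, so each is at most b - g < p by
    [gp_far] and hence shared. *)
Lemma per_shared b : (p < b)%N -> (b < k)%N -> per w b -> ~~ prim w b -> per w' b.
Proof.
move=> pb' bk pb nprb; have far := gp_far.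
have b0 : (0 < b < k)%N by lia.
have [c [cb pc pbc]] := per_prim hq w0 b0 pb.
have ne : c != b by apply/eqP => E; rewrite -E pc in nprb.
have gc : (g <= c)%N by apply: (prim_min hq w0 gk pg gmin) => //; lia.
have gbc : (g <= b - c)%N.
  by rewrite leqNgt; apply/negP => lt; have := gmin (b := (b - c)%N); rewrite pbc => /(_ _)/negP; case; lia.
have -> : b = (c + (b - c))%N by lia.
have ck : (c < k)%N by lia.
apply: per_add; [| |by rewrite kk; lia].
- by rewrite -agree ?(prim_per hq w0 ck pc) //; lia.
- by rewrite -agree //; lia.
Qed.

Lemma classified_shared : classified w w' p.
Proof.
move=> a b ap pa bk kab.
have nn : 0 <= com w w' p b by apply: com_ge0.
have n1 : 0 <= (b == p)%:R :> rat by [].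
have n2 : 0 <= (p < b)%N%:R * pr w b by rewrite mulr_ge0 ?ler0n.
have [pb|npb] := boolP (per w b); last by rewrite {1}/cr (negbTE npb) !addr_ge0.
have -> : cr w b = 1 by rewrite /cr pb.
have [bp|] := ltnP b p.
  suff : com w w' p b = 1 by lra.
  by rewrite /com /cr -agree // pb ltnNge ltnW // mul0r subr0 !mulr1.
rewrite leq_eqVlt => /orP[/eqP E|pb'].
  have E1 : (b == p)%:R = 1 :> rat by rewrite E eqxx.
  by move: nn n2; rewrite E1; lra.
have [prb|nprb] := boolP (prim w b); first by rewrite pb' mul1r /pr prb mulr1n; lra.
suff : com w w' p b = 1 by lra.
rewrite /com /cr /pr pb (negbTE nprb) mulr0 subr0 mul1r mulr1.
by rewrite (per_shared pb' bk pb nprb).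
Qed.

Lemma coef_below b : (b < g)%N -> (k <= p + b)%N -> cr w b - (p < b)%N%:R * pr w b = 0.
Proof.
move=> bg kpb; rewrite (cr_below gmin); last by lia.
by rewrite (pr_below hq w0 g_ge3 pk gmin bg) mulr0 subr0.
Qed.

Lemma rowp_split (F E : nat -> rat) :
  (forall s, 0 <= F s) -> \sum_(g <= b < k) F (p + b)%N <= 2 * F (p + g)%N ->
  (forall s, (k <= s < k + k)%N -> 0 <= E s <= F s) ->
  rowp w p E <= 2 * F (p + g)%N + \sum_(0 <= a < p) (k <= p + a)%N%:R * (pr w a * E (p + a)%N).
Proof.
move=> F0 tail E0; rewrite /rowp lerD2r; apply: le_trans tail.
rewrite (@sum_nat_cat _ _ 0 g k); last by lia.
rewrite big_nat_eq0 ?add0r => [|b bg]; last first.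
  case: (leqP k (p + b)) => kb; last by rewrite mul0r.
  by rewrite coef_below ?mul0r ?mulr0 //; lia.
apply: ler_sum_nat => b bk; case: (leqP k (p + b)) => kb; last by rewrite mul0r F0.
have /andP[e0 e1] : 0 <= E (p + b)%N <= F (p + b)%N by apply: E0; lia.
rewrite mul1r; apply: le_trans e1; rewrite ler_piMl //.
have := cr_le1 w b; have : 0 <= (p < b)%N%:R * pr w b by rewrite mulr_ge0 ?ler0n.
lra.
Qed.

Lemma rowp_le4 (F E : nat -> rat) :
  (forall s, 0 <= F s) -> \sum_(g <= b < k) F (p + b)%N <= 2 * F (p + g)%N ->
  (forall s, (k <= s < k + k)%N -> 0 <= E s <= F s) ->
  rowp w p E <= 4%:R * F (p + g)%N.
Proof.
move=> F0 tail E0; apply: le_trans (rowp_split F0 tail E0) _.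
suff : \sum_(0 <= a < p) (k <= p + a)%N%:R * (pr w a * E (p + a)%N) <= 2 * F (p + g)%N by lra.
apply: le_trans tail.
rewrite (@sum_nat_cat _ _ 0 g p); last by lia.
rewrite big_nat_eq0 ?add0r => [|a ag]; last first.
  by rewrite (pr_below hq w0 g_ge3 pk gmin) ?mul0r ?mulr0 //; lia.
rewrite [leRHS](@sum_nat_cat _ _ g p k); last by lia.
rewrite -[leLHS]addr0 lerD //; last by apply: sumr_nat_ge0.
apply: ler_sum_nat => a ap; case: (leqP k (p + a)) => ka; last by rewrite mul0r F0.
have /andP[e0 e1] : 0 <= E (p + a)%N <= F (p + a)%N by apply: E0; lia.
by rewrite mul1r; apply: le_trans e1; rewrite ler_piMl ?pr_le1.
Qed.

(** When g is the only primitive period below p, the common pairs reduce to one sum c and the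
    constants stay small enough for short words; otherwise [multi_ge] forces longer words, which
    tolerate cruder counts. *)
Definition single := forall a, (a < p)%N -> prim w a -> a = g.

Lemma sum_single (F : nat -> rat) : single -> \sum_(0 <= a < p) pr w a * F a = F g.
Proof.
move=> sg; rewrite -(@sum_nat_if _ F 0 p g); last by lia.
apply: eq_big_nat => a /andP[_ ap]; congr (_ * _); rewrite /pr.
case pa: (prim w a); first by rewrite (sg a ap pa) eqxx.
by case: eqP pa => // ->; rewrite prim_g.
Qed.

Lemma rowp_le3 (F E : nat -> rat) : single ->
  (forall s, 0 <= F s) -> \sum_(g <= b < k) F (p + b)%N <= 2 * F (p + g)%N ->
  (forall s, (k <= s < k + k)%N -> 0 <= E s <= F s) ->
  rowp w p E <= 3%:R * F (p + g)%N.
Proof.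
move=> sg F0 tail E0; apply: le_trans (rowp_split F0 tail E0) _.
have -> : \sum_(0 <= a < p) (k <= p + a)%N%:R * (pr w a * E (p + a)%N) =
  (k <= p + g)%N%:R * E (p + g)%N.
  by rewrite -(sum_single (fun a => (k <= p + a)%N%:R * E (p + a)%N)) //; apply: eq_bigr => a _; rewrite mulrCA.
have far := gp_far; rewrite (_ : (k <= p + g)%N); last by lia.
have /andP[_ e1] : 0 <= E (p + g)%N <= F (p + g)%N by apply: E0; lia.
by move: e1; rewrite mul1r; lra.
Qed.

Lemma common_single : single -> exists2 c, (k <= c < k + g)%N &
  forall E, (forall s, (k <= s < k + k)%N -> 0 <= E s) -> common w w' p E <= E c.
Proof.
move=> sg; pose m := ((k + g.-1) %/ g)%N; pose c := (m * g)%N.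
have g0 : (0 < g)%N by lia.
have ck : (k <= c < k + g)%N.
  by have := divn_eq (k + g.-1) g; have := ltn_pmod (k + g.-1) g0; rewrite /c /m; lia.
exists c => // E E0.
have -> : common w w' p E = \sum_(0 <= b < k) (k <= g + b)%N%:R * (com w w' p b * E (g + b)%N).
  rewrite -(sum_single (fun a => \sum_(0 <= b < k) (k <= a + b)%N%:R * (com w w' p b * E (a + b)%N))) //.
  apply: eq_big_nat => a _; rewrite mulr_sumr; apply: eq_big_nat => b _.
  by ring.
have -> : E c = \sum_(0 <= b < k) (b == c - g)%N%:R * E (g + b)%N.
  by rewrite sum_nat_if ?subnKC //; lia.
apply: ler_sum_nat => b bk; have [le|lt] := leqP k (g + b); last first.
  by rewrite mul0r; case: eqP => [bE|_]; rewrite ?mul0r // mul1r bE; have := ck; lia.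
have Eb : 0 <= E (g + b)%N by apply: E0; lia.
rewrite mul1r ler_wpM2r //; have [bE|ne] := eqVneq b (c - g)%N.
  by apply: le_trans (com_le _ _ _ _) (cr_le1 _ _).
have nd : ~~ (g %| b)%N.
  apply/negP => /dvdnP[m' bE].
  have m1 : (m'.+1 * g < m.+1 * g)%N by rewrite !mulSn -bE -/c; lia.
  have m2 : (m * g < m'.+2 * g)%N by rewrite !mulSn -bE -/c; lia.
  move: m1 m2; rewrite !ltn_pmul2r // !ltnS => m1 m2.
  by case/eqP: ne; rewrite bE /c (_ : m = m'.+1) ?mulSn ?addKn //; lia.
rewrite mulr0n /com /cr; case pb: (per w b); last by rewrite !mul0r.
have gb : (g < b)%N.
  rewrite ltnNge leq_eqVlt; apply/negP => /orP[/eqP E1|lt]; first by rewrite E1 dvdnn in nd.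
  by have := gmin (b := b); rewrite pb => /(_ _)/negP; apply; lia.
have prb : prim w b.
  apply: contraT => npb; case/negP: nd.
  by apply: (per_nonprim hq w0 gk pg gmin) => //; lia.
have [bp|] := ltnP b p; first by have := sg b bp prb; lia.
rewrite leq_eqVlt => /orP[/eqP <-|lt]; first by rewrite (negbTE np) mulr0 mul0r.
by rewrite lt /pr prb mulr1 subrr mulr0.
Qed.

(** In the row a = g the partners are at least k - g. Any other primitive a is at least k + 2 - g by
    [prim_other], with partners at least g. Each tail, in b and then in a, costs a factor 2. *)
Lemma common_hr n : (Q_start w' + 3 * k <= n)%N ->
  common w w' p (fun s => hr w' (n - s - g)) <= 2 * hr w' (n - k - g) + 4%:R * hr w' (n - k - (g + 2)).
Proof.
move=> Qn; have g3 := g_ge3.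
have row0 a b : (b < g)%N -> (a < p)%N -> (k <= a + b)%N%:R * (pr w a * com w w' p b * hr w' (n - (a + b) - g)) = 0.
  case: b => [|b] bg ap; first by rewrite addn0 leqNgt (_ : (a < k)%N) ?mul0r //; lia.
  by rewrite /com (cr_below gmin) ?(mul0r, mulr0) //; lia.
have comb b : 0 <= com w w' p b <= 1.
  by rewrite com_ge0 (le_trans (com_le _ _ _ _) (cr_le1 _ _)).
have rowa a i : (a < p)%N -> (forall b, (b < i)%N -> (k <= a + b)%N%:R * (pr w a * com w w' p b * hr w' (n - (a + b) - g)) = 0) ->
  (i <= k)%N -> (Q_start w' + a + g + i <= n)%N ->
  \sum_(0 <= b < k) (k <= a + b)%N%:R * (pr w a * com w w' p b * hr w' (n - (a + b) - g)) <=
  2 * hr w' (n - a - g - i).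
  move=> ap z ik Qi.
  apply: le_trans (tail_ge_le hq w0' (n := n - a - g) (i := i) _); last by lia.
  rewrite kk (@sum_nat_cat _ _ 0 i k) //.
  rewrite big_nat_eq0 ?add0r => [|b bg]; last by apply: z; lia.
  apply: ler_sum_nat => b bk; rewrite (_ : n - a - g - b = n - (a + b) - g)%N; last by lia.
  case: (leqP k (a + b)) => ka; last by rewrite mul0r hr_ge0.
  rewrite mul1r ler_piMl ?hr_ge0 //.
  have := comb b; have := pr_le1 w a; have := pr_ge0 w a; move=> ? ? /andP[]; nra.
apply: le_trans (_ : \sum_(0 <= a < p) ((a == g)%:R * (2 * hr w' (n - k - g)) +
    (k + 2 <= g + a)%N%:R * (2 * hr w' (n - 2 * g - a))) <= _).
  apply: ler_sum_nat => a /andP[_ ap].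
  have [->|ne] := eqVneq a g.
    rewrite mul1r; apply: ler_wpDr; first by rewrite mulr_ge0 ?ler0n // mulr_ge0 ?hr_ge0.
    have -> : (n - k - g = n - g - g - (k - g))%N by lia.
    apply: rowa; try lia.
    by move=> b bkg; rewrite leqNgt (_ : (g + b < k)%N) ?mul0r //; lia.
  rewrite mul0r add0r; have [pa|npa] := boolP (prim w a); last first.
    rewrite big_nat_eq0 => [|b _]; last by rewrite /pr (negbTE npa) !mul0r mulr0.
    by rewrite mulr_ge0 ?ler0n // mulr_ge0 ?hr_ge0.
  have a0 : (0 < a < k)%N by have := prim_gt0 pa; lia.
  rewrite (prim_other a0 pa ne) mul1r (_ : n - 2 * g - a = n - a - g - g)%N; last by lia.
  by apply: rowa => //; [move=> b bg; apply: row0 | lia | lia].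
rewrite big_split /= sum_nat_if; last by lia.
rewrite lerD2l.
have -> : 4%:R * hr w' (n - k - (g + 2)) = 2 * (2 * hr w' (n - 2 * g - (k + 2 - g))).
  rewrite (_ : n - 2 * g - (k + 2 - g) = n - k - (g + 2))%N; last by lia.
  by rewrite mulrA -natrM.
apply: le_trans (_ : 2 * \sum_(k + 2 - g <= a < k) hr w' (n - 2 * g - a) <= _); last first.
  rewrite ler_pM2l // -{2}kk; apply: tail_ge_le => //; lia.
rewrite mulr_sumr.
apply: le_trans (_ : \sum_(0 <= a < k) (k + 2 <= g + a)%N%:R * (2 * hr w' (n - 2 * g - a)) <= _).
  rewrite [leRHS](@sum_nat_cat _ _ 0 p k); last by lia.
  rewrite -[leLHS]addr0 lerD //; apply: sumr_nat_ge0 => a _.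
  by rewrite mulr_ge0 ?ler0n // mulr_ge0 ?hr_ge0.
rewrite (@sum_nat_cat _ _ 0 (k + 2 - g) k); last by lia.
rewrite big_nat_eq0 ?add0r => [|a ak]; last by rewrite leqNgt (_ : (g + a < k + 2)%N) ?mul0r //; lia.
by apply: ler_sum_nat => a ak; case: leqP => _; rewrite ?mul1r // mul0r mulr_ge0 ?hr_ge0.
Qed.
End SharedFirstPeriod.

Lemma halfsum_ge0 (F : nat -> rat) a : (forall j, 0 <= F j) -> 0 <= halfsum F a.
Proof. by move=> F0; elim: a => [|i IH] //; have := halfsumS F i; have := F0 i; move: IH; lra. Qed.

Lemma sum_half_powers (r : rat) m : 2 * r = 1 -> \sum_(1 <= a < m.+1) r ^+ a + r ^+ m = 1.
Proof.
move=> r2; elim: m => [|m IH]; first by rewrite big_geq // add0r.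
by rewrite big_nat_recr //= -addrA -mulr2n -mulr_natl exprS mulrA r2 mul1r.
Qed.

Section StepBackHalf.
Variable Omega : finType.
Hypothesis hq : (1 < #|Omega|)%N.
Variables w w' : seq Omega.
Hypothesis w0 : (0 < size w)%N.
Hypothesis kk : size w' = size w.
Local Notation k := (size w).
Local Notation q := (#|Omega|%:R : rat).
Local Notation e := (er w w').

Let w0' : (0 < size w')%N. Proof. by rewrite kk. Qed.

Lemma xr_le n : (k + k <= n)%N -> xr w w' n <= hr w' (n - k).
Proof.
move=> le; have : 0 <= yr w n by apply: yr_ge0 => //; lia.
have : yr w' (n - k + size w') <= hr w' (n - k) by apply: yr_le => //; rewrite kk; lia.
by rewrite kk subnK; [rewrite /xr; lra | lia].
Qed.

Lemma xr_ge n : (k + k <= n)%N ->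
  - xr w w' (n + k) <= e n + \sum_(0 <= b < k) pr w' b * hr w' (n - b).
Proof.
move=> le; have h1 : yr w (n + k) <= hr w n by apply: yr_le => //; lia.
have le' : (size w' + size w' <= n)%N by rewrite kk.
have := hr_sub_yr_le hq w0' le'; rewrite kk => h2.
by rewrite /xr /er; move: h1 h2; lra.
Qed.

(** One step back computes (e(m) - xr(m)) / q. Where the result is negative, q may be replaced by 2;
    hence the [Num.min] and the halved errors. *)
Lemma er_back (r : rat) n a : 2 * r = 1 -> (k + k + a <= n.+1)%N ->
  r ^+ a * Num.min (e n) 0 - halfsum (fun j => hr w' (n - k - j)) a <= e (n - a).
Proof.
move=> r2; set F := fun j => hr w' (n - k - j); set m := Num.min _ _.
have F0 j : 0 <= F j by apply: hr_ge0.
have m0 : m <= 0 by rewrite ge_min lexx orbT.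
have r0 : 0 <= r by lra.
elim: a => [|a IH] le; first by rewrite mul1r subr0 subn0 ge_min lexx.
have {}IH : r ^+ a * m - halfsum F a <= e (n - a) by apply: IH; lia.
have E : e (n - a) = q * e (n - a.+1) + xr w w' (n - a).
  by rewrite (_ : n - a = (n - a.+1).+1)%N ?erS //; lia.
have X : xr w w' (n - a) <= F a.
  by rewrite /F subnAC; apply: xr_le; lia.
have q2 : 2 <= q by rewrite ler_nat.
have := halfsumS F a; have := F0 a; have := halfsum_ge0 a F0.
have rm : r ^+ a * m <= 0 by rewrite mulr_ge0_le0 ?exprn_ge0.
rewrite exprS -mulrA; move: (r ^+ a * m) rm IH => z z0 IH.
move: (halfsum F a) (halfsum F a.+1) IH => T T' IH T0 Fa TT.
have rz : 2 * (r * z) = z by rewrite mulrA r2 mul1r.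
rewrite leNgt; apply/negP => lt.
have e0 : e (n - a.+1) < 0 by lra.
have : q * e (n - a.+1) <= 2 * e (n - a.+1) by rewrite ler_nM2r.
lra.
Qed.
End StepBackHalf.

Section SharedFirstPeriodStep.
Variable Omega : finType.
Hypothesis hq : (1 < #|Omega|)%N.
Variables w w' : seq Omega.
Hypothesis w0 : (0 < size w)%N.
Hypothesis kk : size w' = size w.
Variables p g : nat.
Hypothesis g1 : (1 < g < p)%N.
Hypothesis pk : (p < size w)%N.
Hypothesis pp : per w p.
Hypothesis np : ~~ per w' p.
Hypothesis agree : forall b, (b < p)%N -> per w b = per w' b.
Hypothesis pg : per w g.
Hypothesis gmin : forall b, (0 < b < g)%N -> ~~ per w b.
Local Notation k := (size w).
Local Notation q := (#|Omega|%:R : rat).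
Local Notation e := (er w w').

Let w0' : (0 < size w')%N. Proof. by rewrite kk. Qed.
Let p0 : (0 < p)%N. Proof. by lia. Qed.
Let g3 : (3 <= g <= p)%N. Proof. exact: (g_ge3 hq w0 kk g1 pk pp np agree pg gmin). Qed.
Let far : (k + 2 <= p + g)%N. Proof. exact: (gp_far hq w0 kk g1 pk pp np agree pg gmin). Qed.

(** At least [Q_start w + 3 * k]: common pairs lead to h'(n - s - b) with s < 2k and b < k, where
    tails must still be controlled. *)
Definition start2 : nat := if #|Omega| == 2 then (6 * k)%N else (4 * k)%N.

Lemma start2_Q : (4 * k <= start2)%N /\ (Q_start w + 3 * k <= start2)%N.
Proof. by rewrite /start2 /Q_start; case: eqP => _; lia. Qed.

Let Q_eq : Q_start w' = Q_start w. Proof. by rewrite /Q_start kk. Qed.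

(** Besides e(n - p), the values e(n - a) at shared primitive periods now enter, each bounded by
    [er_back]. The weights 2^(-a) sum to at most 1, so the negative part of e(n) is counted at most
    once, and e(n) minus it is the maximum on the right. *)
Lemma step_shared n : (start2 <= n)%N ->
  - xr w w' (n + k) <= Num.max (e n) 0 +
    (\sum_(0 <= a < p) pr w a * halfsum (fun j => hr w' (n - k - j)) a +
     halfsum (fun j => hr w' (n - k - j)) p) -
    \sum_(0 <= j < p) hr w' (n - k - j) -
    common w w' p (fun s => xr w w' (n + k - s)) + rowp w p (fun s => yr w (n + k - s)).
Proof.
have [st1 st2] := start2_Q; move=> le.
have nk : (k + k <= n)%N by lia.
have nkp : (k + k + p <= n.+1)%N by lia.
have Qp : (Q_start w' + p <= n)%N by rewrite Q_eq; lia.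
have pk' : (p < size w')%N by rewrite kk.
have Yh s : (k <= s < k + k)%N -> 0 <= yr w (n + k - s) <= hr w (n - s).
  move=> sk; rewrite (_ : n + k - s = n - s + k)%N; last by lia.
  by rewrite yr_ge0 ?yr_le //; lia.
have XB b : (p < b < k)%N -> prim w b ->
    rowX w p b (fun s => yr w (n + k - s)) <= hr w (n - b).
  move=> bk _; apply: (rowX_hr hq w0 g3 pk gmin) => //; lia.
have := star hq w0 kk p0 pk pp np agree nk
  (classified_shared hq w0 kk g1 pk pp np agree pg gmin) XB.
have := gap_window hq w0' Qp pk'; rewrite kk.
set F := fun j => hr w' (n - k - j); set m := Num.min (e n) 0.
have [r r2] : exists r : rat, 2 * r = 1 by exists (1 / 2%:R); rewrite mulrC divfK.
have back a : (a <= p)%N -> r ^+ a * m - halfsum F a <= e (n - a).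
  by move=> ap; apply: er_back => //; lia.
have m0 : m <= 0 by rewrite ge_min lexx orbT.
have B : m - (\sum_(0 <= a < p) pr w a * halfsum F a + halfsum F p) <=
    \sum_(0 <= a < p) pr w a * e (n - a) + e (n - p).
  have h1 : \sum_(0 <= a < p) pr w a * (r ^+ a * m - halfsum F a) <=
            \sum_(0 <= a < p) pr w a * e (n - a).
    apply: ler_sum_nat => a ap; rewrite ler_wpM2l ?pr_ge0 // back //; lia.
  have h2 := back p (leqnn p).
  have h3 : \sum_(0 <= a < p) pr w a * (r ^+ a * m - halfsum F a) =
    (\sum_(0 <= a < p) pr w a * r ^+ a) * m - \sum_(0 <= a < p) pr w a * halfsum F a.
    by rewrite mulr_suml -sumrB; apply: eq_big_nat => a _; rewrite mulrBr mulrA.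
  have r0 : 0 <= r by lra.
  have h4 : \sum_(0 <= a < p) pr w a * r ^+ a + r ^+ p <= 1.
    rewrite -(sum_half_powers p r2) lerD2r (big_ltn p0) pr0 mul0r add0r.
    rewrite [leRHS](@sum_nat_cat _ _ 1 p p.+1); last by lia.
    rewrite -[leLHS]addr0 lerD //; last by apply: sumr_nat_ge0 => a _; rewrite exprn_ge0.
    by apply: ler_sum_nat => a _; rewrite ler_piMl ?pr_le1 ?exprn_ge0.
  have h5 : m <= (\sum_(0 <= a < p) pr w a * r ^+ a + r ^+ p) * m.
    by rewrite -[leLHS]mul1r ler_wnM2r.
  by move: h1 h2 h5; rewrite h3 mulrDl; lra.
have em : e n - m <= Num.max (e n) 0.
  by rewrite /m; case: (leP (e n) 0) => h0; lra.
have epE : hr w (n - p) = hr w' (n - p) + e (n - p) by rewrite /er; lra.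
by rewrite epE; move: B em; lra.
Qed.
Definition max_bound n (B : rat) := 0 <= B /\ forall j, (j + k <= n)%N -> e j <= B.

Lemma common_xr n B E : (start2 <= n)%N -> max_bound n B ->
  (forall s, (k <= s < k + k)%N -> \sum_(0 <= b < k) pr w' b * hr w' (n - s - b) <= E s) ->
  - common w w' p (fun s => xr w w' (n + k - s)) <= common w w' p (fun s => B + E s).
Proof.
have [st1 st2] := start2_Q; move=> le [B0 eB] HE.
have -> : - common w w' p (fun s => xr w w' (n + k - s)) = common w w' p (fun s => - xr w w' (n + k - s)).
  rewrite /common -sumrN; apply: eq_big_nat => a _; rewrite -sumrN.
  by apply: eq_big_nat => b _; ring.
apply: (@common_mono _ w w' p pk (fun s => - xr w w' (n + k - s)) (fun s => B + E s)) => s sk.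
rewrite (_ : n + k - s = n - s + k)%N; last by lia.
apply: le_trans (xr_ge hq w0 kk _) _; first by lia.
by rewrite lerD ?HE // eB //; lia.
Qed.

Lemma hr_pg n B : (k + k <= n)%N -> max_bound n B -> hr w (n - p - g) <= hr w' (n - k - 2) + B.
Proof.
move=> le [B0 eB]; have -> : hr w (n - p - g) = hr w' (n - p - g) + e (n - p - g) by rewrite /er; lra.
rewrite lerD // ?eB //; last by lia.
by apply: hr_nondec => //; lia.
Qed.

Lemma window_ratio n j : (start2 <= n)%N -> (j < p)%N ->
  15%:R * hr w' (n - k - j.+1) <= 8%:R * hr w' (n - k - j).
Proof.
have [st1 st2] := start2_Q; move=> le jp.
rewrite (_ : n - k - j = (n - k - j.+1).+1)%N; last by lia.
by apply: hr_ratio => //; [rewrite kk; lia | rewrite Q_eq; lia].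
Qed.

Lemma window_halfsum n a : (start2 <= n)%N -> (2 <= a)%N -> forall b, (a <= b <= p)%N ->
  halfsum (fun j => hr w' (n - k - j)) b <= halfsum (fun j => hr w' (n - k - j)) a.
Proof.
move=> le a2 b ab; apply: halfsum_nonincr => [j|j jb|]; [exact: hr_ge0 | |by lia].
by apply: window_ratio => //; lia.
Qed.

Lemma window_sum_le (F : nat -> rat) i : (forall j, 0 <= F j) -> (i <= p)%N ->
  \sum_(0 <= j < i) F j <= \sum_(0 <= j < p) F j.
Proof.
move=> F0 ip; rewrite [leRHS](@sum_nat_cat _ _ 0 i p) // lerDl.
by apply: sumr_nat_ge0 => *; apply: F0.
Qed.

(** Of the constant 4, one comes from the common pair and three from [rowp_le3]. What remains is a
    combination of H(0), ..., H(4) that the ratio 15/8 makes nonpositive. *)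
Lemma step_single n B : single w p g -> (start2 <= n)%N -> max_bound n B ->
  - xr w w' (n + k) <= Num.max (e n) 0 + 4%:R * B.
Proof.
have [st1 st2] := start2_Q; move=> sg le bd.
have [nk Qpg p4] : [/\ (k + k <= n)%N, (Q_start w + p + g <= n)%N & (4 <= p)%N] by split; lia.
have [gp gp' pp'] : [/\ (3 <= g <= p)%N, (4 <= p <= p)%N & (2 <= 3)%N] by split; lia.
have [jp0 jp1 jp2 jp3] : [/\ 0 < p, 1 < p, 2 < p & 3 < p]%N by split; lia.
have [c ck cs] := common_single hq w0 kk g1 pk pp np pg gmin sg.
have [c1 c2] : (n - c - g <= n - k - 3)%N /\ (n - c - p <= n - k - 4)%N by lia.
(* For w' the primitive periods are g and some beyond p, as p itself is not one; the tail beyond p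
   is at most the value at p. *)
pose E s := hr w' (n - s - g) + hr w' (n - s - p).
have HE s : (k <= s < k + k)%N -> \sum_(0 <= b < k) pr w' b * hr w' (n - s - b) <= E s.
  move=> sk; rewrite (@sum_nat_cat _ _ 0 p k); last by lia.
  rewrite (big_ltn pk); have [_ ->] := pr_p hq w0 kk p0 pk pp np agree.
  rewrite mul0r add0r lerD //.
    rewrite -(sum_single hq w0 kk g1 pk pp np pg gmin (fun b => hr w' (n - s - b)) sg).
    apply: ler_sum_nat => b bp; rewrite (pr_agree hq w0 kk p0 pk pp np agree) //; lia.
  have Qn : (Q_start w' + p <= n - s)%N by rewrite Q_eq; lia.
  have := tail_gt_le hq w0' Qn; rewrite kk; apply: le_trans.
  by apply: ler_sum_nat => b _; rewrite ler_piMl ?pr_le1 ?hr_ge0.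
have Yh s : (k <= s < k + k)%N -> 0 <= yr w (n + k - s) <= hr w (n - s).
  move=> sk; rewrite (_ : n + k - s = n - s + k)%N; last by lia.
  by rewrite yr_ge0 ?yr_le //; lia.
have tl := tail_add_le hq w0 Qpg.
have hn0 s : 0 <= hr w (n - s) by apply: hr_ge0.
have rp := rowp_le3 hq w0 kk g1 pk pp np agree pg gmin sg hn0 tl Yh.
rewrite subnDA in rp.
have hpg := hr_pg nk bd.
have Tg := window_halfsum le pp' gp; have Tp := window_halfsum le (isT : (2 <= 4)%N) gp'.
have [B0 _] := bd.
have cE : common w w' p (fun s => B + E s) <= B + E c.
  by apply: (cs (fun s => B + E s)) => s _; rewrite !addr_ge0 ?hr_ge0.
have Ec : E c <= hr w' (n - k - 3) + hr w' (n - k - 4) by rewrite lerD //; apply: hr_nondec.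
have := window_ratio le jp0; have := window_ratio le jp1.
have := window_ratio le jp2; have := window_ratio le jp3.
have := common_xr le bd HE; have := step_shared le.
rewrite (sum_single hq w0 kk g1 pk pp np pg gmin _ sg).
have H0 j : 0 <= hr w' (n - k - j) by apply: hr_ge0.
have W := window_sum_le H0 p4; rewrite 4?big_ltn // big_geq // addr0 in W.
move: W; have := H0 4; move: Tg Tp Ec; rewrite -[hr w' (n - k - 2)]/((fun j => hr w' (n - k - j)) 2) in hpg.
move: hpg; set H := fun j => hr w' (n - k - j).
rewrite -[hr w' (n - k - 0)]/(H 0%N) -[hr w' (n - k - 1)]/(H 1%N) -[hr w' (n - k - 2)]/(H 2) -[hr w' (n - k - 3)]/(H 3) -[hr w' (n - k - 4)]/(H 4).
have := halfsumS H 3; have := halfsumS H 2; have := halfsumS H 1; have := halfsumS H 0.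
rewrite [halfsum H 0]/=; move: cE rp; lra.
Qed.

(** A second primitive c < p satisfies g < c and g + c >= k + 2; with c < p < k this gives all four
    bounds. *)
Lemma multi_ge : ~ single w p g -> [/\ 4 <= g, 6 <= p, k + 3 <= p + g & 7 <= k]%N.
Proof.
move=> msg; have [c [cp pc cg]] : exists c, [/\ (c < p)%N, prim w c & c != g].
  case: (boolP (has (fun c => prim w c && (c != g)) (iota 0 p))) => [/hasP[c]|/hasPn no].
    by rewrite mem_iota => cp /andP[pc ne]; exists c.
  case: msg => c cp pc; apply/eqP; apply: contraT => ne.
  by have := no c; rewrite mem_iota cp pc ne => /(_ isT).
have c0 : (0 < c < k)%N by have := prim_gt0 pc; lia.
have gc : (g <= c)%N by apply: (prim_min hq w0 _ pg gmin) => //; lia.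
have cfar := prim_other hq w0 kk g1 pk pp np pg gmin c0 pc cg.
by split; lia.
Qed.

(** Counting all k^2 pairs as common is affordable because [quadratic_decay] beats this factor; the
    other 4 comes from [rowp_le4]. *)
Lemma step_multi n B : ~ single w p g -> (start2 <= n)%N -> max_bound n B ->
  - xr w w' (n + k) <= Num.max (e n) 0 + (k * k + 4)%N%:R * B.
Proof.
have [st1 st2] := start2_Q; move=> /multi_ge[g4 p6 pg3 k7] le bd.
have k5 : (5 <= k)%N by lia.
have [nk Qpg p5] : [/\ (k + k <= n)%N, (Q_start w + p + g <= n)%N & (5 <= p)%N] by split; lia.
have [Q3 Q4] : (Q_start w' + 3 * k <= n)%N /\ (Q_start w' + 4 <= n - k)%N by rewrite Q_eq; lia.
have [i1 i2] : (n - k - g <= n - k - 4)%N /\ (n - k - (g + 2) <= n - k - 6)%N by lia.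
have [i3 i4] : (n - p - g <= n - k - 3)%N /\ (n - p - g + k <= n)%N by lia.
have [gp4 gp5] : (4 <= g <= p)%N /\ (0 <= g < p)%N by lia.
have [jp0 jp1 jp2 jp3] : [/\ 0 < p, 1 < p, 2 < p & 3 < p]%N by split; lia.
have [jp4 jp5] : (4 < p)%N /\ (5 < p)%N by lia.
have Yh s : (k <= s < k + k)%N -> 0 <= yr w (n + k - s) <= hr w (n - s).
  move=> sk; rewrite (_ : n + k - s = n - s + k)%N; last by lia.
  by rewrite yr_ge0 ?yr_le //; lia.
pose E s := 2 * hr w' (n - s - g).
have HE s : (k <= s < k + k)%N -> \sum_(0 <= b < k) pr w' b * hr w' (n - s - b) <= E s.
  move=> sk; have Qn : (Q_start w' + g <= n - s)%N by rewrite Q_eq; lia.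
  have := tail_ge_le hq w0' Qn; rewrite kk; apply: le_trans.
  rewrite (@sum_nat_cat _ _ 0 g k); last by lia.
  rewrite big_nat_eq0 ?add0r => [|b bg]; last first.
    rewrite -(pr_agree hq w0 kk p0 pk pp np agree); last by lia.
    by rewrite (pr_below hq w0 g3 pk gmin) ?mul0r //; lia.
  by apply: ler_sum_nat => b _; rewrite ler_piMl ?pr_le1 ?hr_ge0.
have H0 j : 0 <= hr w' (n - k - j) by apply: hr_ge0.
have [B0 eB] := bd.
have cE : common w w' p (fun s => B + E s) <=
    (k * k)%N%:R * B + 2 * (2 * hr w' (n - k - 4) + 4%:R * hr w' (n - k - 6)).
  rewrite commonD lerD ?(common_const _ pk) //.
  have -> : common w w' p E = 2 * common w w' p (fun s => hr w' (n - s - g)).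
    rewrite /common mulr_sumr; apply: eq_big_nat => a _; rewrite mulr_sumr.
    by apply: eq_big_nat => b _; rewrite /E; ring.
  rewrite ler_pM2l //.
  apply: le_trans (common_hr hq w0 kk g1 pk pp np agree pg gmin Q3) _.
  by rewrite lerD // ler_pM2l //; apply: hr_nondec.
have tl := tail_add_le hq w0 Qpg.
have hn0 s : 0 <= hr w (n - s) by apply: hr_ge0.
have rp := rowp_le4 hq w0 kk g1 pk pp np agree pg gmin hn0 tl Yh.
rewrite subnDA in rp.
have hpg : hr w (n - p - g) <= hr w' (n - k - 3) + B.
  have -> : hr w (n - p - g) = hr w' (n - p - g) + e (n - p - g) by rewrite /er; lra.
  by rewrite lerD // ?eB //; apply: hr_nondec.
have S4 : \sum_(4 <= a < p) hr w' (n - k - a) <= 2 * hr w' (n - k - 4).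
  have := tail_ge_le hq w0' Q4; rewrite kk; apply: le_trans.
  rewrite [leRHS](@sum_nat_cat _ _ 4 p k); last by rewrite ltnW // ltnW.
  by rewrite -[leLHS]addr0 lerD //; apply: sumr_nat_ge0 => *; apply: hr_ge0.
(* The value at g is bounded by the one at 4, and every other primitive period is at least 5, where
   the sum telescopes by [halfsum_sum]. *)
have Tsum : \sum_(0 <= a < p) pr w a * halfsum (fun j => hr w' (n - k - j)) a +
    halfsum (fun j => hr w' (n - k - j)) p <=
    2 * halfsum (fun j => hr w' (n - k - j)) 4 + 2 * hr w' (n - k - 4).
  have Tg := window_halfsum le (isT : (2 <= 4)%N) gp4.
  move: Tg S4; set H := fun j => hr w' (n - k - j).
  rewrite -[hr w' (n - k - 4)]/(H 4) -[\sum_(4 <= a < p) _]/(\sum_(4 <= a < p) H a) => Tg S4.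
  have T0 a : 0 <= halfsum H a by apply: halfsum_ge0.
  have hs : \sum_(5 <= a < p) halfsum H a + halfsum H p + halfsum H p =
      halfsum H 4 + \sum_(4 <= a < p) H a.
    by rewrite -(halfsum_sum H p5) big_nat_recr.
  have : \sum_(0 <= a < p) pr w a * halfsum H a <= halfsum H 4 + \sum_(5 <= a < p) halfsum H a.
    have -> : halfsum H 4 + \sum_(5 <= a < p) halfsum H a =
       \sum_(0 <= a < p) ((a == g)%:R * halfsum H 4 + (5 <= a)%N%:R * halfsum H a).
      rewrite big_split /= sum_nat_if //.
      rewrite [in RHS](@sum_nat_cat _ _ 0 5 p) ?p5 // big_nat_eq0 ?add0r => [|a /andP[_ a5]]; last first.
        by rewrite leqNgt a5 mul0r.
      by congr (_ + _); apply: eq_big_nat => a /andP[-> _]; rewrite mul1r.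
    apply: ler_sum_nat => a /andP[_ ap].
    have [->|ne] := eqVneq a g.
      rewrite mul1r -[leLHS]addr0 lerD ?mulr_ge0 //.
      by apply: le_trans Tg; rewrite ler_piMl ?pr_le1.
    rewrite mul0r add0r; have [ag|ag] := ltnP a g.
      by rewrite (pr_below hq w0 g3 pk gmin ag) mul0r mulr_ge0.
    have a5 : (5 <= a)%N by rewrite (leq_ltn_trans g4) // ltn_neqAle eq_sym ne ag.
    by rewrite a5 mul1r ler_piMl ?pr_le1.
  by move: hs S4 (T0 p); lra.
have := window_ratio le jp0; have := window_ratio le jp1.
have := window_ratio le jp2; have := window_ratio le jp3.
have := window_ratio le jp4; have := window_ratio le jp5.
have := common_xr le bd HE; have := step_shared le.
have W := window_sum_le H0 p6; rewrite 6?big_ltn // big_geq // addr0 in W.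
move: W; have := H0 6; move: Tsum; set H := fun j => hr w' (n - k - j).
move: hpg cE; rewrite -[hr w' (n - k - 0)]/(H 0%N) -[hr w' (n - k - 1)]/(H 1%N) -[hr w' (n - k - 2)]/(H 2) -[hr w' (n - k - 3)]/(H 3) -[hr w' (n - k - 4)]/(H 4) -[hr w' (n - k - 5)]/(H 5) -[hr w' (n - k - 6)]/(H 6).
have := halfsumS H 3; have := halfsumS H 2; have := halfsumS H 1; have := halfsumS H 0.
rewrite [halfsum H 0]/= natrD mulrDl; move: rp; lra.
Qed.
End SharedFirstPeriodStep.

(** * The base range *)

Section Avoiding.
Variable Omega : finType.
Hypothesis hq : (1 < #|Omega|)%N.
Variable w : seq Omega.
Hypothesis k1 : (1 < size w)%N.
Local Notation k := (size w).
Local Notation q := (#|Omega|%:R : rat).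

Let w0 : (0 < size w)%N. Proof. exact: ltnW. Qed.
Let q2 : 2 <= q. Proof. by rewrite ler_nat. Qed.

Lemma ar_leS_sub n : 1 + (q - 1) * ar w n <= ar w n.+1.
Proof.
apply: le_trans (ar_ge_sum hq w0 n.+1); rewrite lerD2l ler_wpM2l //; first by have := q2; lra.
rewrite (big_ltn k1) mul1r subn1 /= lerDl.
by apply: sumr_nat_ge0 => i _; rewrite mulr_ge0 ?ler0n ?ar_ge0.
Qed.

Lemma ar_nondec i j : (i <= j)%N -> ar w i <= ar w j.
Proof.
move=> /subnK <-; elim: (j - i)%N => [|d IH]; first by rewrite add0n.
apply: le_trans IH _; rewrite addSn; have := ar_leS_sub (d + i).
by have := ar_ge0 w (d + i); move: q2; nra.
Qed.

Lemma ar_ratio n : (5 <= k)%N \/ (3 <= #|Omega|)%N -> 15%:R * ar w n <= 8%:R * ar w n.+1.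
Proof.
move=> H; have [q3|q3] := leqP 3 #|Omega|.
  have q3' : (3%:R : rat) <= q by rewrite ler_nat.
  by have := ar_leS_sub n; have := ar_ge0 w n; nra.
have k5 : (5 <= k)%N by case: H => //; rewrite leqNgt q3.
clear H; elim/ltn_ind: n => n IH.
have S : ar w n.+1 = q * ar w n - hr w n.+1 by rewrite arS.
have qa : 2 * ar w n <= q * ar w n by rewrite ler_wpM2r ?ar_ge0.
have [nk|kn] := ltnP n.+1 k.
  by rewrite hr_small // in S; have := ar_ge0 w n; lra.
have h1 : hr w n.+1 <= ar w (n - 4).
  have -> : n.+1 = (n.+1 - k + k)%N by lia.
  apply: le_trans (hr_le_ar w0 _) _; apply: ar_nondec; lia.
have r i : (0 < i <= n)%N -> 15%:R * ar w (n - i) <= 8%:R * ar w (n - i.-1).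
  move=> i0; have -> : (n - i.-1 = (n - i).+1)%N by lia.
  by apply: IH; lia.
have r1 := r 1%N; have r2 := r 2%N; have r3 := r 3%N; have r4 := r 4%N.
rewrite /= subn0 in r1 r2 r3 r4.
have {}r1 : 15%:R * ar w (n - 1) <= 8%:R * ar w n by apply: r1; lia.
have {}r2 : 15%:R * ar w (n - 2) <= 8%:R * ar w (n - 1) by apply: r2; lia.
have {}r3 : 15%:R * ar w (n - 3) <= 8%:R * ar w (n - 2) by apply: r3; lia.
have {}r4 : 15%:R * ar w (n - 4) <= 8%:R * ar w (n - 3) by apply: r4; lia.
by move: S qa h1 r1 r2 r3 r4 (ar_ge0 w n); lra.
Qed.

(* [n - i] truncates, whence the indicator. *)
Definition arz n i : rat := (i <= n)%N%:R * ar w (n - i).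

Lemma arz_ge0 n i : 0 <= arz n i.
Proof. by rewrite mulr_ge0 ?ler0n ?ar_ge0. Qed.

Lemma arzE n i : (i <= n)%N -> arz n i = ar w (n - i).
Proof. by move=> le; rewrite /arz le mul1r. Qed.

Lemma arz_nonincr n i j : (i <= j)%N -> arz n j <= arz n i.
Proof.
move=> ij; rewrite /arz; case: (leqP j n) => jn; last by rewrite mul0r arz_ge0.
by rewrite (leq_trans ij jn) !mul1r; apply: ar_nondec; apply: leq_sub2l.
Qed.

Lemma arz_ratio n i : (5 <= k)%N \/ (3 <= #|Omega|)%N -> 15%:R * arz n i.+1 <= 8%:R * arz n i.
Proof.
move=> H; rewrite /arz; case: (leqP i.+1 n) => jn; last first.
  by rewrite mul0r mulr0 !mulr_ge0 ?ler0n ?ar_ge0.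
by rewrite (ltnW jn) !mul1r (_ : n - i = (n - i.+1).+1)%N ?ar_ratio //; lia.
Qed.

Lemma arz_window n i : (i <= n)%N ->
  1 + (q - 1) * \sum_(i.+1 <= b < i + k) arz n b <= ar w (n - i).
Proof.
move=> le; apply: le_trans (ar_ge_sum hq w0 (n - i)).
rewrite le_eqVlt; apply/orP; left; apply/eqP; congr (1 + _ * _).
rewrite -(add1n i) big_addn addKn; apply: eq_big_nat => b bk.
rewrite /arz leq_subRL // addnC (_ : n - (i + b) = n - i - b)%N //; lia.
Qed.

Lemma arz_tail n i : \sum_(i.+1 <= b < i + k) arz n b <= arz n i.
Proof.
case: (leqP i n) => le; last first.
  by rewrite big_nat_eq0 ?arz_ge0 // => b ib; rewrite /arz leqNgt (_ : (n < b)%N) ?mul0r //; lia.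
have W := arz_window le; rewrite -(arzE le) in W.
have S0 : 0 <= \sum_(i.+1 <= b < i + k) arz n b by apply: sumr_nat_ge0 => *; apply: arz_ge0.
by move: q2; nra.
Qed.

Lemma arz_tail_shift n i j : \sum_(j.+1 <= c < k) arz n (i + c) <= arz n (i + j).
Proof.
have [kj|jk] := leqP k j.+1; first by rewrite big_geq // arz_ge0.
apply: le_trans (arz_tail n (i + j)).
rewrite -addnS [(i + j.+1)%N]addnC big_addn.
rewrite [leRHS](@sum_nat_cat _ _ j.+1 k); last by lia.
rewrite -[leLHS]addr0 lerD //; last by apply: sumr_nat_ge0 => *; apply: arz_ge0.
by apply: ler_sum_nat => c _; rewrite addnC.
Qed.

Lemma hr_le_arz n s : hr w (n + k - s) <= arz n s.
Proof.
rewrite /arz; case: (leqP s n) => le; last by rewrite mul0r hr_small //; lia.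
by rewrite mul1r (_ : n + k - s = n - s + k)%N ?hr_le_ar //; lia.
Qed.

Lemma hr_pow n : hr w n * q ^+ k <= q ^+ n.
Proof.
have q0 : 0 <= q by rewrite ler0n.
elim: n => [|n IH]; first by rewrite hr_small // mul0r exprn_ge0.
have [lt|le] := ltnP n k; last first.
  have h1 : hr w n.+1 * q ^+ k <= q * hr w n * q ^+ k by rewrite ler_wpM2r ?exprn_ge0 ?hr_leS.
  by apply: le_trans h1 _; rewrite exprS -mulrA ler_wpM2l.
move: lt; rewrite leq_eqVlt => /orP[/eqP ->|lt]; first by rewrite hr_size mul1r.
by rewrite hr_small // mul0r exprn_ge0.
Qed.

(** A union bound over the n + 1 - k possible positions of w, scaled by q^k. *)
Lemma ar_pow n : q ^+ (n + k) - (n.+1 - k)%N%:R * q ^+ n <= ar w n * q ^+ k.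
Proof.
elim: n => [|n IH].
  by rewrite ar0 // mul1r add0n (_ : 1 - k = 0)%N ?mul0r ?subr0 //; lia.
rewrite arS // mulrBl -mulrA.
have h0 := hr_pow n.+1.
have q0 : 0 <= q by rewrite ler0n.
have {}IH : q * (q ^+ (n + k) - (n.+1 - k)%N%:R * q ^+ n) <= q * (ar w n * q ^+ k) by rewrite ler_wpM2l.
rewrite addSn !exprS in h0 *.
have [lt|le] := ltnP n.+1 k.
  rewrite hr_small // mul0r subr0 (_ : n.+2 - k = 0)%N ?mul0r ?subr0; last by lia.
  by move: IH; rewrite (_ : n.+1 - k = 0)%N ?mul0r ?subr0 //; lia.
rewrite (_ : n.+2 - k = (n.+1 - k).+1)%N; last by lia.
rewrite -[(n.+1 - k).+1%:R]natr1; move: IH h0.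
by move: (_%:R) (q ^+ n) (q ^+ k) (q ^+ (n + k)) => A B C D; lra.
Qed.
End Avoiding.

Section Base.
Variable Omega : finType.
Hypothesis hq : (1 < #|Omega|)%N.
Variables w w' : seq Omega.
Hypothesis w0 : (0 < size w)%N.
Hypothesis kk : size w' = size w.
Variable p : nat.
Hypothesis p0 : (0 < p)%N.
Hypothesis pk : (p < size w)%N.
Hypothesis pp : per w p.
Hypothesis np : ~~ per w' p.
Hypothesis agree : forall b, (b < p)%N -> per w b = per w' b.
Local Notation k := (size w).
Local Notation q := (#|Omega|%:R : rat).
Local Notation e := (er w w').

Let w0' : (0 < size w')%N. Proof. by rewrite kk. Qed.
Let k1 : (1 < k)%N. Proof. by lia. Qed.
Let q2 : 2 <= q. Proof. by rewrite ler_nat. Qed.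
Let prA a : (a < p)%N -> pr w a = pr w' a. Proof. by move=> ap; apply: pr_agree ap. Qed.
Let pr1 : pr w p = 1. Proof. by have [] := pr_p hq w0 kk p0 pk pp np agree. Qed.

Definition excess n := \sum_(0 <= a < k) (pr w a - pr w' a) * ar w (n - a).

Lemma excessE n : excess n = ar w (n - p) +
  \sum_(0 <= b < k) (p < b)%N%:R * pr w b * ar w (n - b) - \sum_(p.+1 <= b < k) pr w' b * ar w (n - b).
Proof.
have R := rows_split hq w0 kk p0 pk pp np agree (fun b => ar w (n - b)) (fun b => ar w (n - b)).
have Z : \sum_(0 <= a < p) pr w a * (ar w (n - a) - ar w (n - a)) = 0.
  by apply: big_nat_eq0 => a _; rewrite subrr mulr0.
by rewrite Z add0r in R; rewrite -R /excess -sumrB; apply: eq_big_nat => a _; rewrite mulrBl.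
Qed.

(** Difference of the two inversions [hr_inv]. The cost hypotheses let three quarters of the excess
    pay for the wrapped pairs; a quarter is left to cover the difference of the avoiding counts. *)
Lemma base_step n : (k <= n)%N -> (forall j, (j < n + k)%N -> e j <= 0) ->
  (forall j, (j <= n)%N -> 0 <= ar w j - ar w' j) ->
  classified w w' p ->
  4%:R * rowp w p (fun s => hr w (n + k - s)) <=
    3%:R * (ar w (n - p) - \sum_(p.+1 <= b < k) ar w (n - b)) ->
  (forall b, (p < b < k)%N -> prim w b ->
     4%:R * rowX w p b (fun s => hr w (n + k - s)) <= 3%:R * ar w (n - b)) ->
  4%:R * e (n + k) <= 4%:R * (ar w n - ar w' n) - excess n.
Proof.
move=> kn e0 d0 cls rp rX.
set Z := fun s => hr w (n + k - s); set Z' := fun s => hr w' (n + k - s).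
have Z0 s : (k <= s < k + k)%N -> 0 <= Z s by move=> _; apply: hr_ge0.
have Z0' s : (k <= s < k + k)%N -> 0 <= Z' s by move=> _; apply: hr_ge0.
have := wrapsum_le kk pk pr1 cls Z0; have := wrapsum_ge kk pk prA Z0'.
have C : common w w' p Z - common w w' p Z' <= 0.
  rewrite common_sub; apply: le_trans (_ : common w w' p (fun=> 0) <= _).
    by apply: (@common_mono _ w w' p pk (fun s => Z s - Z' s) (fun=> 0)) => s sk; apply: e0; lia.
  by rewrite /common big_nat_eq0 // => a _; rewrite big_nat_eq0 // => b _; rewrite !mulr0.
have X : 4%:R * \sum_(0 <= b < k) (p < b)%N%:R * pr w b * rowX w p b Z <=
         3%:R * \sum_(0 <= b < k) (p < b)%N%:R * pr w b * ar w (n - b).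
  rewrite !mulr_sumr; apply: ler_sum_nat => b bk.
  rewrite !(mulrCA _ ((p < b)%N%:R * pr w b)) -!mulrA.
  case: (ltnP p b) => pb; rewrite ?mul0r // !mul1r /pr; case prb: (prim w b); rewrite ?mul0r // !mul1r.
  by apply: rX => //; lia.
have P : \sum_(0 <= b < k) pr w' b * ar w' (n - b) <= \sum_(0 <= b < k) pr w' b * ar w (n - b).
  apply: ler_sum_nat => b bk; rewrite ler_wpM2l ?pr_ge0 // -subr_ge0 d0 //; lia.
have T : \sum_(p.+1 <= b < k) pr w' b * ar w (n - b) <= \sum_(p.+1 <= b < k) ar w (n - b).
  by apply: ler_sum_nat => b _; rewrite ler_piMl ?ar_ge0 ?pr_le1.
have kn' : (size w' <= n)%N by rewrite kk.
have := hr_inv hq w0' kn'; rewrite kk -/Z' => E'.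
have := hr_inv hq w0 kn; rewrite -/Z => E.
have M := excessE n.
have M' : excess n = \sum_(0 <= b < k) pr w b * ar w (n - b) - \sum_(0 <= b < k) pr w' b * ar w (n - b).
  by rewrite /excess -sumrB; apply: eq_big_nat => a _; rewrite mulrBl.
by rewrite /er E E'; move: rp X C P T M M'; lra.
Qed.

Local Notation D i := (- e (k + i)).

(** Summation by parts: [er_step] writes the difference of the primitive indicators at m + 1 as D(m
    + 1) - q D(m), and a(n - m) = q a(n - m - 1) - h(n - m). *)
Lemma excess_abel n m : (m < k)%N -> (k <= n)%N ->
  \sum_(0 <= a < m.+1) (pr w a - pr w' a) * ar w (n - a) =
  D m * ar w (n - m) - \sum_(0 <= i < m) D i * hr w (n - i).
Proof.
elim: m => [|m IH] mk kn.
  by rewrite big_nat1 big_geq // !pr0 subrr mul0r addn0 (er_small kk) ?oppr0 ?mul0r ?subr0.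
rewrite big_nat_recr //= IH; [|by lia|by []]; rewrite [in RHS]big_nat_recr //=.
rewrite (er_step hq w0 kk mk).
have -> : ar w (n - m) = q * ar w (n - m.+1) - hr w (n - m).
  by rewrite (_ : n - m = (n - m.+1).+1)%N ?arS //; lia.
by ring.
Qed.

Lemma excess_eq n : (k <= n)%N -> excess n =
  D k.-1 * ar w (n - k.-1) - \sum_(p <= i < k.-1) D i * hr w (n - i).
Proof.
move=> kn; have kE : k = k.-1.+1 by rewrite prednK.
have km : (k.-1 < k)%N by lia.
rewrite /excess {1}kE excess_abel //; congr (_ - _).
rewrite (@sum_nat_cat _ _ 0 p k.-1); last by lia.
rewrite big_nat_eq0 ?add0r // => i ip.
by rewrite (er_below_p hq w0 kk p0 pk pp np agree) ?oppr0 ?mul0r //; lia.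
Qed.

Lemma D_ge1 i : (p <= i < k)%N -> 1 <= D i.
Proof. by move=> /(er_above_p hq w0 kk p0 pk pp np agree); lra. Qed.

Lemma D_mono i j : (i <= j)%N -> (j < k)%N -> D i <= D j.
Proof.
move=> /subnK <-; elim: (j - i)%N => [|m IH] lt; first by rewrite add0n.
apply: le_trans (IH (ltnW lt)) _; rewrite addSn.
have [ip|pi] := ltnP (m + i) p.
  rewrite (er_below_p hq w0 kk p0 pk pp np agree ip) oppr0 oppr_ge0.
  by apply: (er_lt2k hq w0 kk p0 pk pp np agree); lia.
have d1 : 1 <= D (m + i) by apply: D_ge1; lia.
rewrite (er_step hq w0 kk lt); have := pr_le1 w' (m + i).+1; have := pr_ge0 w (m + i).+1.
by move: q2 d1; nra.
Qed.

(** Each step from 2k on loses at most h(n) <= q^(n-k), so D(k - 1) remains the only unknown. *)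
Lemma e_lower i : - e (k + k + i) <= q ^+ i * (q * D k.-1 + i.+1%:R).
Proof.
have X n : (k <= n)%N -> - xr w w' (n + k) <= q ^+ (n - k).
  move=> kn; have := yr_le hq w0 kn; have : 0 <= yr w' (n + k) by apply: yr_ge0 => //; lia.
  have hp : hr w n <= q ^+ (n - k).
    have qk : 0 < q ^+ k by rewrite exprn_gt0 //; have := q2; lra.
    rewrite -(ler_pM2r qk) -exprD subnK //; exact: hr_pow.
  by rewrite /xr; move: hp; lra.
elim: i => [|i IH].
  rewrite addn0 mul1r (_ : k + k = (k + k.-1).+1)%N; last by lia.
  rewrite erS opprD mulrN lerD //.
  by have := X k (leqnn k); rewrite subnn (_ : (k + k.-1).+1 = k + k)%N //; lia.
rewrite addnS erS opprD -mulrN.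
have h := X (k + i).+1; rewrite (_ : (k + i).+1 + k = (k + k + i).+1)%N in h; last by lia.
have {}h : - xr w w' (k + k + i).+1 <= q ^+ i.+1.
  by have := h _; rewrite (_ : (k + i).+1 - k = i.+1)%N; [apply; lia | lia].
have {}IH : q * - e (k + k + i) <= q * (q ^+ i * (q * D k.-1 + i.+1%:R)) by rewrite ler_wpM2l.
rewrite exprS -[i.+2%:R]natr1 in h *.
by move: IH h; move: (q ^+ i) (e (k + k + i)) (D k.-1) (xr _ _ _) => A B C E; lra.
Qed.

(** In the bound on the avoiding difference, [powsum] collects the lengths below 2k and [linsum] the
    later ones, both with D(k - 1) factored out. *)
Definition powsum := \sum_(p <= i < k) q ^+ (k - i).
Definition linsum N := \sum_(1 <= m < N.+1) (q + m%:R).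

Let d n := ar w n - ar w' n.

Let dS n : d n.+1 = q * d n - e n.+1. Proof. exact: ar_sub. Qed.

Let d_small : d k = 0.
Proof.
suff H n : (n <= k)%N -> d n = 0 by exact: H.
elim: n => [|n IH] nk; first by rewrite /d !ar0 ?subrr.
by rewrite dS IH ?mulr0 ?(er_small kk) ?subrr // ltnW.
Qed.

Lemma d_first i : (i < k)%N ->
  d (k + i) * q ^+ k <= D k.-1 * (q ^+ i * \sum_(p <= j < i.+1) q ^+ (k - j)).
Proof.
have q0 : 0 <= q by rewrite ler0n.
have D1 : 1 <= D k.-1 by apply: D_ge1; lia.
elim: i => [|i IH] ik.
  by rewrite addn0 d_small mul0r big_geq ?mulr0.
rewrite addnS dS mulrBl -addnS.
have {}IH := IH (ltnW ik).
have [ip|pi] := ltnP i.+1 p.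
  rewrite (er_below_p hq w0 kk p0 pk pp np agree ip) mul0r subr0.
  have IH0 : d (k + i) * q ^+ k <= 0 by move: IH; rewrite big_geq ?mulr0 // ltnW.
  by rewrite big_geq // !mulr0 -mulrA mulr_ge0_le0.
have h1 : q * (d (k + i) * q ^+ k) <= q * (D k.-1 * (q ^+ i * \sum_(p <= j < i.+1) q ^+ (k - j))).
  by rewrite ler_wpM2l.
have h2 : D i.+1 * q ^+ k <= D k.-1 * (q * q ^+ i * q ^+ (k - i.+1)).
  rewrite -exprS -exprD subnKC; last by lia.
  by rewrite ler_wpM2r ?exprn_ge0 // D_mono //; lia.
rewrite big_nat_recr //= exprS; move: h1 h2.
move: (\sum_(_ <= _ < _) _) (q ^+ i) (q ^+ k) (q ^+ (k - i.+1)) (d _) (D k.-1) (e _) => S A B C F G E.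
lra.
Qed.

Lemma d_bound n : (k <= n)%N ->
  d n * q ^+ k <= D k.-1 * (q ^+ (n - k) * (powsum + linsum (n.+1 - (k + k)))).
Proof.
move=> kn; have q0 : 0 <= q by rewrite ler0n.
have D1 : 1 <= D k.-1 by apply: D_ge1; lia.
have [lt|le] := ltnP n (k + k).
  have E : n = (k + (n - k))%N by lia.
  rewrite (_ : n.+1 - (k + k) = 0)%N; last by lia.
  rewrite /linsum big_geq // addr0 {1}E; apply: le_trans (d_first _) _; first by lia.
  rewrite ler_wpM2l ?ler_wpM2l ?exprn_ge0 //; first by lra.
  rewrite /powsum; have [pi|ip] := leqP p (n - k).+1; last first.
    by rewrite big_geq ?sumr_nat_ge0 // => [i _|]; [rewrite exprn_ge0 | lia].
  rewrite [leRHS](@sum_nat_cat _ _ p (n - k).+1 k); last by lia.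
  by rewrite lerDl; apply: sumr_nat_ge0 => i _; rewrite exprn_ge0.
rewrite -(subnKC le); elim: (n - (k + k))%N => [|N IH].
  have dE : d (k + k) = q * d (k + k.-1) - e (k + k).
    by have E : (k + k = (k + k.-1).+1)%N by [lia]; rewrite [in LHS]E [in RHS]E dS.
  have km : (k.-1 < k)%N by lia.
  have h1 := d_first km; rewrite prednK // -/powsum in h1.
  have h2 := e_lower 0; rewrite addn0 mul1r in h2.
  rewrite addn0 dE mulrBl addnK (_ : (k + k).+1 - (k + k) = 1)%N; last by lia.
  rewrite /linsum big_nat1.
  have h3 : - e (k + k) * q ^+ k <= (q * D k.-1 + 1) * q ^+ k by rewrite ler_wpM2r ?exprn_ge0.
  have h4 : q * (d (k + k.-1) * q ^+ k) <= q * (D k.-1 * (q ^+ k.-1 * powsum)) by rewrite ler_wpM2l.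
  have h5 : 1 * q ^+ k <= D k.-1 * q ^+ k by rewrite ler_wpM2r ?exprn_ge0.
  have qk : q ^+ k = q * q ^+ k.-1 by rewrite -exprS prednK.
  move: h3 h4 h5; rewrite [in X in _ -> X -> _]mulrA.
  have -> : D k.-1 * (q ^+ k * (powsum + (q + 1))) = q * (D k.-1 * (q ^+ k.-1 * powsum)) + D k.-1 * q ^+ k * (q + 1).
    by rewrite [in LHS]qk [in RHS]qk; ring.
  move: (q ^+ k) (q ^+ k.-1) (D k.-1) (d (k + k.-1)) (e (k + k)) powsum => Z A B C E S.
  by lra.
rewrite addnS dS mulrBl.
have nn : (k + k + N - k = (k + N))%N by lia.
have nn' : ((k + k + N).+1 - (k + k) = N.+1)%N by lia.
have nn2 : ((k + k + N).+1 - k = (k + N).+1)%N by lia.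
have nn3 : ((k + k + N).+2 - (k + k) = N.+2)%N by lia.
rewrite nn nn' in IH; rewrite nn2 nn3.
have h2 := e_lower N.+1; rewrite addnS in h2.
have TE : linsum N.+2 = linsum N.+1 + (q + N.+2%:R) by rewrite /linsum big_nat_recr.
rewrite TE exprS exprD.
have h4 : q * (d (k + k + N) * q ^+ k) <= q * (D k.-1 * (q ^+ (k + N) * (powsum + linsum N.+1))) by rewrite ler_wpM2l.
have h3 : - e (k + k + N).+1 * q ^+ k <= q ^+ N.+1 * (q * D k.-1 + N.+2%:R) * q ^+ k.
  by rewrite ler_wpM2r ?exprn_ge0.
have h5 : N.+2%:R * (q ^+ N.+1 * q ^+ k) <= N.+2%:R * (q ^+ N.+1 * q ^+ k) * D k.-1.
  by rewrite ler_peMr // mulr_ge0 ?ler0n // mulr_ge0 ?exprn_ge0.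
move: h3 h4 h5; rewrite exprD exprS.
move: (q ^+ N) (q ^+ k) (D k.-1) (d _) (e _) (powsum) (linsum _) (N.+2%:R) => A B C E F G H I.
lra.
Qed.

Lemma excess_bound n : (k <= n)%N ->
  D k.-1 * (q ^+ (n - k) * (q ^+ k.+1 - (n.+2 - (k + k))%N%:R * q - powsum)) <= excess n * q ^+ k.
Proof.
move=> kn; have q0 : 0 <= q by rewrite ler0n.
have D1 : 1 <= D k.-1 by apply: D_ge1; lia.
rewrite excess_eq // mulrBl.
have h1 := ar_pow hq k1 (n - k.-1).
rewrite (_ : n - k.-1 + k = n.+1)%N in h1; last by lia.
rewrite (_ : (n - k.-1).+1 - k = n.+2 - (k + k))%N in h1; last by lia.
have {}h1 : D k.-1 * (q ^+ n.+1 - (n.+2 - (k + k))%N%:R * q ^+ (n - k.-1)) <= D k.-1 * (ar w (n - k.-1) * q ^+ k).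
  by rewrite ler_wpM2l //; lra.
have h2 : (\sum_(p <= i < k.-1) D i * hr w (n - i)) * q ^+ k <= D k.-1 * (q ^+ (n - k) * powsum).
  apply: le_trans (_ : \sum_(p <= i < k.-1) D k.-1 * (q ^+ (n - k) * q ^+ (k - i)) <= _).
    rewrite mulr_suml; apply: ler_sum_nat => i ip.
    rewrite -mulrA ler_pM ?D_mono ?mulr_ge0 ?hr_ge0 ?exprn_ge0 //; try lia.
      by have := D_ge1 (i := i); rewrite (_ : (_ && _)); [move=> /(_ isT); lra | lia].
    rewrite -exprD (_ : n - k + (k - i) = n - i)%N; last by lia.
    exact: hr_pow.
  rewrite /powsum (@sum_nat_cat _ _ p k.-1 k); last by lia.
  rewrite -!mulr_sumr ler_wpM2l //; first by lra.
  by rewrite ler_wpM2l ?exprn_ge0 // lerDl; apply: sumr_nat_ge0 => i _; rewrite exprn_ge0.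
have e1 : q ^+ n.+1 = q ^+ (n - k) * q ^+ k.+1 by rewrite -exprD; congr (_ ^+ _); lia.
have e2 : q ^+ (n - k.-1) = q ^+ (n - k) * q by rewrite -exprSr; congr (_ ^+ _); lia.
move: h1 h2; rewrite e1 e2; move: (\sum_(_ <= _ < _) _) (q ^+ (n - k)) (q ^+ k.+1) (q ^+ k) => A B C E.
by move: (_%:R) (ar w _) powsum (D _) => F G H I; lra.
Qed.

(** By [d_bound] and [excess_bound] both sides of the required 4 d <= [excess] carry the factor D(k
    - 1) q^(n-k). The coefficient 5 of [powsum] is 4 from the former and 1 from the latter. *)
Lemma base L : classified w w' p ->
  (forall n, (k <= n < L)%N -> 4%:R * rowp w p (fun s => hr w (n + k - s)) <=
    3%:R * (ar w (n - p) - \sum_(p.+1 <= b < k) ar w (n - b))) ->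
  (forall n b, (k <= n < L)%N -> (p < b < k)%N -> prim w b ->
     4%:R * rowX w p b (fun s => hr w (n + k - s)) <= 3%:R * ar w (n - b)) ->
  (forall n, (k <= n < L)%N ->
     (n.+2 - (k + k))%N%:R * q + 5%:R * powsum + 4%:R * linsum (n.+1 - (k + k)) <= q ^+ k.+1) ->
  forall n, (n < L + k)%N -> e n <= 0.
Proof.
move=> cls rp rX num n.
elim/ltn_ind: n => n IH nL; have [lt|le] := ltnP n (k + k).
  exact: (er_lt2k hq w0 kk p0 pk pp np agree).
have nE : n = (n - k + k)%N by lia.
have nkL : (k <= n - k < L)%N by lia.
have kn : (k <= n - k)%N by lia.
have d0 j : (j <= n - k)%N -> 0 <= d j.
  elim: j => [|j IHj] jn; first by rewrite /d !ar0 ?subrr.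
  have ej : e j.+1 <= 0 by apply: IH; lia.
  by rewrite dS; have := IHj (ltnW jn); move: q2 ej; nra.
have e0 j : (j < n - k + k)%N -> e j <= 0 by move=> jn; apply: IH; lia.
have st := base_step kn e0 d0 cls (rp _ nkL) (fun b => rX _ b nkL).
rewrite nE; suff : 4%:R * d (n - k) <= excess (n - k) by move: st; rewrite /d; lra.
have qk : 0 < q ^+ k by rewrite exprn_gt0 //; have := q2; lra.
rewrite -(ler_pM2r qk); apply: le_trans (excess_bound kn).
have h := d_bound kn.
have D1 : 1 <= D k.-1 by apply: D_ge1; lia.
apply: le_trans (_ : D k.-1 * (q ^+ (n - k - k) * (4%:R * (powsum + linsum ((n - k).+1 - (k + k))))) <= _).
  by move: h; rewrite -mulrA; move: (d _ * _) (q ^+ (_ - _)) => A B; lra.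
rewrite ler_wpM2l //; first by lra.
rewrite ler_wpM2l ?exprn_ge0 ?ler0n //.
by have := num _ nkL; lra.
Qed.
End Base.

(** * The cost of the wrapped pairs in the base range *)

Section Costs.
Variable Omega : finType.
Hypothesis hq : (1 < #|Omega|)%N.
Variable w : seq Omega.
Hypothesis k1 : (1 < size w)%N.
Hypothesis large : (5 <= size w)%N \/ (3 <= #|Omega|)%N.
Variable p : nat.
Hypothesis pk : (p < size w)%N.
Local Notation k := (size w).
Local Notation q := (#|Omega|%:R : rat).

Let w0 : (0 < size w)%N. Proof. exact: ltnW. Qed.
Let q2 : 2 <= q. Proof. by rewrite ler_nat. Qed.

Lemma bracket_ge n : (k <= n)%N ->
  1 + (q - 1) * \sum_(k <= j < k + p) arz w n j <=
  ar w (n - p) - \sum_(p.+1 <= b < k) ar w (n - b).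
Proof.
move=> kn; have pn : (p <= n)%N by lia.
have := arz_window hq k1 pn; rewrite (@sum_nat_cat _ _ p.+1 k (p + k)); last by lia.
have -> : \sum_(p.+1 <= b < k) arz w n b = \sum_(p.+1 <= b < k) ar w (n - b).
  by apply: eq_big_nat => b bk; rewrite arzE //; lia.
have : 0 <= \sum_(p.+1 <= b < k) ar w (n - b) by apply: sumr_nat_ge0 => *; apply: ar_ge0.
rewrite (addnC p); move: (\sum_(_ <= _ < k) _) (\sum_(_ <= _ < k + p) _) => A B A0.
by move: q2; nra.
Qed.

Lemma arz_leS n i : (i.+1 <= n)%N -> arz w n i <= q * arz w n i.+1.
Proof.
move=> le; rewrite !arzE ?(ltnW le) // (_ : n - i = (n - i.+1).+1)%N; last by lia.
exact: ar_leS.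
Qed.

(** The window in [bracket_ge] holds c and a neighbour. If c + 1 is in it, a(n - c) <= q a(n - c -
    1) suffices, as 3 (1 + 1/2) >= 4 for q = 2; when c + 1 > n the constant 1 replaces that term. At
    the right end, c - 1 contributes at least as much as c. *)
Lemma rowp_cost_min n c : (1 < p)%N -> (k <= n)%N -> (k <= c < k + p)%N ->
  4%:R * arz w n c <= 3%:R * (ar w (n - p) - \sum_(p.+1 <= b < k) ar w (n - b)).
Proof.
move=> p1 kn ck; have := bracket_ge kn.
have a0 i : 0 <= arz w n i by apply: arz_ge0.
have [lt|le] := ltnP c.+1 (k + p).
  have : arz w n c + arz w n c.+1 <= \sum_(k <= j < k + p) arz w n j.
    by apply: sum_nat_ge_term2 => //; lia.
  have [cn|nc] := leqP c.+1 n.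
    have := arz_leS cn; move: (a0 c) (a0 c.+1); move: (arz _ _ _) (arz _ _ _) (\sum_(_ <= _ < _) _) => A B C A0 B0 h1 h2.
    have h3 : (q - 1) * (A + B) <= (q - 1) * C by rewrite ler_wpM2l //; have := q2; lra.
    have h4 : q * B <= 2 * (q - 1) * B by rewrite ler_wpM2r //; have := q2; lra.
    have h5 : A <= (q - 1) * A by rewrite ler_peMl //; have := q2; lra.
    by move: h1 h3 h4 h5; lra.
  have : arz w n c <= 1.
    rewrite /arz; case: (leqP c n) => cn; last by rewrite mul0r.
    by rewrite mul1r (_ : n - c = 0)%N ?ar0 //; lia.
  move: (a0 c) (a0 c.+1); move: (arz _ _ _) (arz _ _ _) (\sum_(_ <= _ < _) _) => A B C A0 B0 h1 h2.
  have h3 : A + B <= (q - 1) * C by move: q2; nra.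
  by lra.
have : arz w n c.-1 + arz w n c <= \sum_(k <= j < k + p) arz w n j.
  by apply: sum_nat_ge_term2 => //; lia.
have := arz_nonincr hq k1 n (leq_pred c).
move: (a0 c) (a0 c.-1); move: (arz _ _ _) (arz _ _ _) (\sum_(_ <= _ < _) _) => A B C A0 B0 h1 h2.
have h3 : A + B <= (q - 1) * C by move: q2; nra.
by lra.
Qed.

(** The 16 is 4 times the factor of [rowp_le4]; the window terms k, k + 1, k + 2 give 3 (1 + 15/8 +
    (15/8)^2) > 16. *)
Lemma rowp_cost_shared n : (4 <= p)%N -> (k <= n)%N ->
  16%:R * arz w n (k + 2) <= 3%:R * (ar w (n - p) - \sum_(p.+1 <= b < k) ar w (n - b)).
Proof.
move=> p4 kn; have := bracket_ge kn.
have a0 i : 0 <= arz w n i by apply: arz_ge0.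
have S : arz w n k + arz w n k.+1 + arz w n k.+2 <= \sum_(k <= j < k + p) arz w n j.
  rewrite (@sum_nat_cat _ _ k k.+3); last by lia.
  rewrite 3?big_ltn; try lia.
  by rewrite [\sum_(k.+3 <= _ < k.+3) _]big_geq // addr0 !addrA lerDl; apply: sumr_nat_ge0.
have := arz_ratio hq k1 n k large; have := arz_ratio hq k1 n k.+1 large.
rewrite addn2; move: (a0 k.+2) (a0 k.+1) S.
move: (arz _ _ _) (arz _ _ _) (arz _ _ _) (\sum_(_ <= _ < k + p) _) => A B C S A0 B0 h1 h2 h3 h4.
have h5 : S <= (q - 1) * S by rewrite ler_peMl //; have := q2; lra.
by lra.
Qed.

(** The row is at most twice the term at b + 2, and 8 (8/15)^2 < 3. *)
Lemma rowX_cost g n b : (3 <= g <= p)%N -> (forall b, (0 < b < g)%N -> ~~ per w b) ->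
  (k <= n)%N -> (b < k)%N ->
  4%:R * rowX w p b (fun s => hr w (n + k - s)) <= 3%:R * ar w (n - b).
Proof.
move=> g3 gmin kn bk.
have E0 s : (k <= s < k + k)%N -> 0 <= hr w (n + k - s) by move=> _; apply: hr_ge0.
have h1 := rowX_le hq w0 g3 pk gmin bk E0.
have h2 : \sum_(3 <= c < k) (k <= b + c)%N%:R * hr w (n + k - (b + c)) <= arz w n (b + 2).
  apply: le_trans (arz_tail_shift hq k1 n b 2).
  apply: ler_sum_nat => c _; case: (leqP k (b + c)) => bc; last by rewrite mul0r arz_ge0.
  by rewrite mul1r; apply: hr_le_arz.
have := arz_ratio hq k1 n b large; have := arz_ratio hq k1 n b.+1 large.
rewrite addn2 in h2; rewrite (@arzE _ _ n b) //; last by lia.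
by move: h1 h2 (ar_ge0 w (n - b)); lra.
Qed.
End Costs.

(** * Numerical conditions for the base range *)

Lemma pow2_ge_min k : (12 <= k)%N -> (8 * k ^ 2 + 24 * k <= 3 * 2 ^ (k - 2))%N.
Proof.
move=> /subnK <-; elim: (k - 12)%N => // m IH; rewrite addSn subSn; last by lia.
have Km : (12 <= m + 12)%N := leq_addl _ _.
have := leq_mul (leqnn (m + 12)) Km; move: IH Km; rewrite -!mulnn expnS.
by move: (m + 12)%N (2 ^ _)%N => K Z; lia.
Qed.

(** This is what [num_binary_shared] becomes at N = 4k. It fails at k = 11, whence the limit up to
    which candidates are checked by computation. *)
Lemma pow2_ge_shared k : (12 <= k)%N -> (32 * k ^ 2 + 48 * k <= 11 * 2 ^ (k - 3) + 8)%N.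
Proof.
move=> /subnK <-; elim: (k - 12)%N => // m IH; rewrite addSn subSn; last by lia.
have Km : (12 <= m + 12)%N := leq_addl _ _.
have := leq_mul (leqnn (m + 12)) Km; move: IH Km; rewrite -!mulnn expnS.
by move: (m + 12)%N (2 ^ _)%N => K Z; lia.
Qed.

Lemma pow3_ge k : (5 <= k)%N -> (16 * k ^ 2 + 68 * k + 6 <= 39 * 3 ^ (k - 2))%N.
Proof.
move=> /subnK <-; elim: (k - 5)%N => // m IH; rewrite addSn subSn; last by lia.
have Km : (5 <= m + 5)%N := leq_addl _ _.
have := leq_mul (leqnn (m + 5)) Km; move: IH Km; rewrite -!mulnn expnS.
by move: (m + 5)%N (3 ^ _)%N => K Z; lia.
Qed.

Lemma cast_quad a b k : ((a * k ^ 2 + b * k)%N%:R : rat) = a%:R * (k%:R * k%:R) + b%:R * k%:R.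
Proof. by rewrite natrD !natrM. Qed.

Lemma cast_exp a b m : ((a * b ^ m)%N%:R : rat) = a%:R * b%:R ^+ m.
Proof. by rewrite natrM natrX. Qed.

Section Numeric.
Variable Omega : finType.
Hypothesis hq : (1 < #|Omega|)%N.
Variable w : seq Omega.
Variable p : nat.
Hypothesis pk : (p < size w)%N.
Local Notation k := (size w).
Local Notation q := (#|Omega|%:R : rat).

Lemma linsumE N : 2 * linsum Omega N = 2 * q * N%:R + N%:R * (N%:R + 1).
Proof.
elim: N => [|N IH]; first by rewrite /linsum big_geq // !mulr0 mul0r addr0.
rewrite /linsum big_nat_recr //= -/(linsum Omega N) mulrDr IH -natr1; ring.
Qed.

Lemma powsumE : (q - 1) * powsum w p + q = q ^+ (k - p).+1.
Proof.
rewrite /powsum -(subnK (ltnW pk)); elim: (k - p)%N => [|m IH].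
  by rewrite add0n subnn big_geq // mulr0 add0r.
rewrite addSn big_nat_recr ?leq_addl //= subSnn expr1.
have -> : \sum_(p <= i < m + p) q ^+ ((m + p).+1 - i) = q * \sum_(p <= i < m + p) q ^+ (m + p - i).
  rewrite mulr_sumr; apply: eq_big_nat => i /andP[_ im].
  by rewrite subSn ?exprS // ltnW.
rewrite subSn ?leq_addl // exprS -IH; ring.
Qed.

Lemma powsum_ge0 : 0 <= powsum w p.
Proof. by apply: sumr_nat_ge0 => i _; rewrite exprn_ge0. Qed.

(** The left side is 2 N^2 + 12 N - 8 + 5 2^(k-p+1). For p >= 3 the last term takes at most 5/8 of
    2^(k+1) and leaves 3 2^(k-2) for the quadratic; for p = 2 it alone exceeds 2^(k+1), hence
    [base_two]. *)
Lemma num_binary_min N : #|Omega| = 2%N -> (12 <= k)%N -> (3 <= p)%N -> (N <= 2 * k)%N ->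
  N.+1%:R * q + 5%:R * powsum w p + 4%:R * linsum Omega N <= q ^+ k.+1.
Proof.
move=> qE k12 p3 Nk; have G := powsumE; have L := linsumE N; rewrite qE in G L *.
have Z := pow2_ge_min k12; rewrite -(ler_nat rat) (cast_quad 8 24) (cast_exp 3) in Z.
have E : (2%:R : rat) ^+ k.+1 = 8%:R * 2%:R ^+ (k - 2).
  by rewrite (_ : k.+1 = 3 + (k - 2))%N ?exprD //; lia.
have le : (2%:R : rat) ^+ (k - p).+1 <= 2%:R ^+ (k - 2) by rewrite ler_weXn2l ?ler1n //; lia.
rewrite E -natr1; rewrite -(ler_nat rat) natrM in Nk.
have N0 : 0 <= N%:R :> rat by [].
move: G L Z le Nk N0; move: (2%:R ^+ _) (2%:R ^+ _) (powsum _ _) (linsum _ _) (N%:R) (k%:R) => A B C E' F K.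
move=> G L Z le Nk N0.
have : F * F <= 4%:R * (K * K) by nra.
by move: G L Z le Nk N0; lra.
Qed.

Lemma num_binary_shared N : #|Omega| = 2%N -> (12 <= k)%N -> (4 <= p)%N -> (N <= 4 * k)%N ->
  N.+1%:R * q + 5%:R * powsum w p + 4%:R * linsum Omega N <= q ^+ k.+1.
Proof.
move=> qE k12 p4 Nk; have G := powsumE; have L := linsumE N; rewrite qE in G L *.
have Z := pow2_ge_shared k12; rewrite -(ler_nat rat) (cast_quad 32 48) (natrD _ (11 * 2 ^ (k - 3)) 8) (cast_exp 11) in Z.
have E : (2%:R : rat) ^+ k.+1 = 16%:R * 2%:R ^+ (k - 3).
  by rewrite (_ : k.+1 = 4 + (k - 3))%N ?exprD //; lia.
have le : (2%:R : rat) ^+ (k - p).+1 <= 2%:R ^+ (k - 3) by rewrite ler_weXn2l ?ler1n //; lia.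
rewrite E -natr1; rewrite -(ler_nat rat) natrM in Nk.
have N0 : 0 <= N%:R :> rat by [].
move: G L Z le Nk N0; move: (2%:R ^+ _) (2%:R ^+ _) (powsum _ _) (linsum _ _) (N%:R) (k%:R) => A B C E' F K.
move=> G L Z le Nk N0.
have : F * F <= 16%:R * (K * K) by nra.
by move: G L Z le Nk N0; lra.
Qed.

Lemma num_large N : (3 <= #|Omega|)%N -> (2 <= p)%N ->
  (5 <= k)%N && (N <= 2 * k)%N || (k == 4%N) && (N <= k)%N ->
  N.+1%:R * q + 5%:R * powsum w p + 4%:R * linsum Omega N <= q ^+ k.+1.
Proof.
move=> q3 p2 kN; have G := powsumE; have L := linsumE N.
have q3' : (3%:R : rat) <= q by rewrite ler_nat.
have Z : (30 * N + 6 + 4 * (N * N.+1) <= 39 * 3 ^ (k - 2))%N.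
  case/orP: kN => /andP[k5 Nk]; last first.
    have {}k5 := eqP k5; rewrite k5 in Nk *.
    by move: Nk; case: N {L} => [|[|[|[|[|]]]]].
  apply: leq_trans (pow3_ge k5); rewrite -mulnn; nia.
have cast a b c : ((a * N + b + c * (N * N.+1))%N%:R : rat) =
    a%:R * N%:R + b%:R + c%:R * (N%:R * (N%:R + 1)) by rewrite !natrD !natrM -natr1.
rewrite -(ler_nat rat) (cast 30 6 4) (cast_exp 39) in Z; clear cast.
have E : q ^+ k.+1 = q * q * (q * q ^+ (k - 2)).
  by rewrite (_ : k.+1 = (3 + (k - 2)))%N ?exprD; [ring | lia].
have le : q ^+ (k - p).+1 <= q * q ^+ (k - 2) by rewrite -exprS ler_weXn2l ?ler1n //; lia.
have le3 : (3%:R : rat) ^+ (k - 2) <= q ^+ (k - 2) by rewrite lerXn2r ?nnegrE ?ler0n.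
have N0 : 0 <= N%:R :> rat by [].
have C0 := powsum_ge0.
have A0 : 0 <= q ^+ (k - 2) by rewrite exprn_ge0.
rewrite E -natr1.
move: G L Z le le3 N0 C0 A0 q3'; move: (q ^+ _) (q ^+ _) (powsum _ _) (linsum _ _) (N%:R) (3%:R ^+ _) => A B C D F Y.
move: (#|Omega|%:R : rat) => Q G L Z le le3 N0 C0 A0 Q3.
have Q0 : 0 <= Q by lra.
have h1 : 2 * C + Q <= Q * A.
  have : 2 * C <= (Q - 1) * C by rewrite ler_wpM2r //; lra.
  by move: G le; lra.
have h2 : 9%:R * (Q * A) <= Q * Q * (Q * A).
  by rewrite ler_wpM2r ?mulr_ge0 //; nra.
have h3 : Q * (30%:R * F + 6%:R + 4%:R * (F * (F + 1))) <= Q * (39%:R * A).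
  apply: (ler_wpM2l Q0); apply: (le_trans Z).
  exact: (ler_wpM2l (ler0n _ 39) le3).
have h4 : 3%:R * (4%:R * (F * (F + 1))) <= Q * (4%:R * (F * (F + 1))).
  by rewrite ler_wpM2r // !mulr_ge0 // addr_ge0.
by move: L h1 h2 h3 h4; lra.
Qed.
End Numeric.

(** * Short binary words *)

Section Table.
Local Open Scope nat_scope.
Import BinInt.

Fixpoint dotZ (c : seq bool) (s : seq Z) : Z :=
  match c, s with
  | b :: c', x :: s' => if b then Z.add x (dotZ c' s') else dotZ c' s'
  | _, _ => Z0
  end.

(* Reversed tables of the hitting counts and of the avoiding counts up to length m over a
   binary alphabet, from the period indicators [c] of a word of length [size c]. *)
Fixpoint table (c : seq bool) (m : nat) : seq Z * seq Z :=
  if m is m'.+1 then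
    let (hs, avs) := table c m' in
    let x := Z.sub (nth Z0 avs (size c).-1) (dotZ (behead c) hs) in
    (x :: hs, Z.sub (Z.mul 2 (head Z0 avs)) x :: avs)
  else ([:: Z0], [:: 1%Z]).

Fixpoint leZs (s s' : seq Z) : bool :=
  match s, s' with
  | x :: s1, y :: s1' => Z.leb x y && leZs s1 s1'
  | _, _ => true
  end.

Fixpoint lexgt (c c' : seq bool) : bool :=
  match c, c' with
  | x :: c1, y :: c1' => if x == y then lexgt c1 c1' else x
  | _, _ => false
  end.

Fixpoint bitlists (m : nat) : seq (seq bool) :=
  if m is m'.+1 then [seq b :: c | b <- [:: true; false], c <- bitlists m'] else [:: [::]].

(* Necessary conditions on the set of periods (zero included) of a nonconstant word of length
   k: closure under addition and the Fine-Wilf theorem. *)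
Definition consistent (k : nat) (c : seq bool) : bool :=
  let P := [seq b <- iota 1 k.-1 | nth false c b] in
  [&& nth false c 0, ~~ nth false c 1 &
   all (fun a => all (fun b =>
     ((a + b < k) ==> nth false c (a + b)) &&
     ((a + b <= k + gcdn a b) ==> nth false c (gcdn a b))) P) P].

Definition candidates k := [seq c <- bitlists k | consistent k c].

(** One less than [start1 w + k], which is 5k, or [start2 w + k], which is 7k. A shared least period
    needs k >= 5, so 5k suffices for k = 4. *)
Definition length_bound k := (if k == 4 then 5 * k else 7 * k).-1.

Definition small_ok k :=
  let cs := [seq (c, (table c (length_bound k)).1) | c <- candidates k] in
  all (fun x => all (fun y => lexgt x.1 y.1 ==> leZs x.2 y.2) cs) cs.

Lemma small_lengths_ok : all small_ok (iota 4 8).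
Proof. by vm_compute. Qed.
End Table.

Section SmallLengths.
Local Open Scope nat_scope.
Import BinInt.
Variable Omega : finType.
Hypothesis q2 : #|Omega| = 2.
Implicit Types w : seq Omega.

Definition bits w := mkseq (per w) (size w).

Lemma mkseqS T (f : nat -> T) m : mkseq f m.+1 = f 0 :: mkseq (fun i => f i.+1) m.
Proof. by rewrite /mkseq /= -[1]addn0 iotaDl -map_comp. Qed.

Lemma dotZ_mkseq (c : nat -> bool) (f : nat -> nat) m n :
  dotZ (mkseq c m) (mkseq (fun j => Z.of_nat (f j)) n) =
  Z.of_nat (\sum_(0 <= j < minn m n) c j * f j).
Proof.
elim: m n c f => [|m IH] [|n] c f; try by rewrite ?minn0 ?min0n big_geq.
rewrite minnSS big_nat_recl //=.
have E T (g : nat -> T) l : map g (iota 1 l) = mkseq (g \o succn) l.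
  by rewrite /mkseq -[1]addn0 iotaDl -map_comp; apply: eq_map.
rewrite !E IH; case: (c 0); rewrite ?mul1n ?mul0n //.
rewrite -[\sum_(0 <= j < _) (c \o succn) j * _]/(\sum_(0 <= i < minn m n) c i.+1 * f i.+1).
by move: (\sum_(_ <= _ < _) _)%N => S; lia.
Qed.

Lemma table_spec w m : 0 < size w -> table (bits w) m =
  (mkseq (fun j => Z.of_nat (h w (m - j))) m.+1, mkseq (fun j => Z.of_nat (av w (m - j))) m.+1).
Proof.
move=> w0; have [k' kE] : exists k', size w = k'.+1 by exists (size w).-1; rewrite prednK.
elim: m => [|m IH]; first by rewrite /= /mkseq /= subnn h_small // av0.
have hE : Z.sub (nth Z0 (mkseq (fun j => Z.of_nat (av w (m - j))) m.+1) (size (bits w)).-1)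
    (dotZ (behead (bits w)) (mkseq (fun j => Z.of_nat (h w (m - j))) m.+1)) = Z.of_nat (h w m.+1).
  have -> : behead (bits w) = mkseq (per w \o succn) k'.
    rewrite /bits kE /mkseq /= -[1]addn0 iotaDl -map_comp.
    exact: eq_map.
  rewrite dotZ_mkseq size_mkseq kE -[k'.+1.-1]/k'.
  have [lt|le] := leqP m.+1 k'.
    (* The avoiding count sought lies outside the table, and the default [Z0] yields the correct h(m
       + 1) = 0. *)
    rewrite nth_default ?size_mkseq // h_small ?kE // big1_seq // => j.
    by rewrite mem_index_iota => /andP[_ jk] ; rewrite h_small ?muln0 // kE; lia.
  rewrite nth_mkseq //.
  have := av_decomp (m - k') w0; rewrite kE (@big_ltn _ _ _ 0) // per0 mul1n subn0.
  rewrite (_ : m - k' + k'.+1 = m.+1); last by lia.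
  rewrite big_add1 -[k'.+1.-1]/k' => E.
  have -> : \sum_(0 <= j < k') (per w \o succn) j * h w (m - j) =
            \sum_(0 <= j < k') per w j.+1 * h w (m.+1 - j.+1) by [].
  by rewrite E; move: (\sum_(_ <= _ < _) _)%N => S; lia.
have aE : Z.sub (Z.mul 2 (Z.of_nat (av w m))) (Z.of_nat (h w m.+1)) = Z.of_nat (av w m.+1).
  by have := avS m w0; rewrite q2; lia.
rewrite [table _ _]/= IH hE.
by rewrite [head _ _]/= subn0 aE (mkseqS _ m.+1) [in RHS](mkseqS _ m.+1) !subn0.
Qed.

Lemma leZs_nth s s' n : leZs s s' -> size s = size s' -> n < size s ->
  Z.le (nth Z0 s n) (nth Z0 s' n).
Proof.
elim: s s' n => [|x s IH] [|y s'] [|n] //= /andP[/Z.leb_le xy ss] [sz] lt //.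
exact: IH.
Qed.

Lemma mem_bitlists (c : seq bool) : c \in bitlists (size c).
Proof.
elim: c => //= b c IH; rewrite !mem_cat.
by case: b; rewrite (map_f _ IH) ?orbT.
Qed.

Lemma lexgt_first (c c' : seq bool) p : size c' = size c -> p < size c ->
  nth false c p -> ~~ nth false c' p -> (forall b, b < p -> nth false c b = nth false c' b) ->
  lexgt c c'.
Proof.
elim: c c' p => [|x c IH] [|y c'] [|p] //= [sz] pk pc pc' H.
  by case: eqP => // E; rewrite -E pc in pc'.
have /= -> := H 0 isT; rewrite eqxx; apply: (IH c' p) => // b bp.
exact: (H b.+1).
Qed.

Lemma bits_nth w b : b < size w -> nth false (bits w) b = per w b.
Proof. by move=> lt; rewrite nth_mkseq. Qed.

Lemma bits_consistent w : 1 < size w -> ~~ per w 1 -> consistent (size w) (bits w).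
Proof.
move=> k1 np1; have w0 : 0 < size w by apply: ltnW.
rewrite /consistent !bits_nth // per0 np1 /=.
apply/allP => a; rewrite mem_filter mem_iota => /andP[pa ak].
apply/allP => b; rewrite mem_filter mem_iota => /andP[pb bk].
have ak' : 0 < a <= size w by lia.
have bk' : 0 < b <= size w by lia.
rewrite bits_nth in pa; last by lia.
rewrite bits_nth in pb; last by lia.
apply/andP; split; apply/implyP => le.
  by rewrite bits_nth //; apply: per_add => //; apply: ltnW.
have g : gcdn a b <= a by apply: dvdn_leq (dvdn_gcdl a b); case/andP: ak'.
by rewrite bits_nth; [apply: per_gcd | apply: leq_ltn_trans g _; lia].
Qed.

Lemma small_base w w' p n : 4 <= size w <= 11 -> size w' = size w -> 1 < p < size w ->
  per w p -> ~~ per w' p -> (forall b, b < p -> per w b = per w' b) -> ~~ per w 1 ->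
  n <= length_bound (size w) -> h w n <= h w' n.
Proof.
move=> k4 kk pk pp np agree np1 nL.
have np1' : ~~ per w' 1 by rewrite -agree //; case/andP: pk.
have k1 : 1 < size w by lia.
have k1' : 1 < size w' by rewrite kk.
have k4' : size w \in iota 4 8 by rewrite mem_iota; lia.
have /allP/(_ _ k4') := small_lengths_ok; rewrite /small_ok; cbv zeta.
rewrite all_map => /allP ok; set L := length_bound (size w) in nL ok *.
have mem v : size v = size w -> ~~ per v 1 -> bits v \in candidates (size w).
  move=> sv pv; rewrite mem_filter -sv bits_consistent ?sv //=.
  by have := mem_bitlists (bits v); rewrite size_mkseq sv.
have := ok _ (mem w erefl np1); rewrite [preim _ _ _]/= all_map => /allP ok'.
have := ok' _ (mem w' kk np1'); rewrite [preim _ _ _]/= => /implyP.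
have -> : lexgt (bits w) (bits w').
  apply: (@lexgt_first _ _ p); rewrite ?size_mkseq //; [by lia| | |].
  - by rewrite bits_nth //; lia.
  - by rewrite bits_nth // kk; lia.
  - by move=> b bp; rewrite !bits_nth ?agree // ?kk; lia.
have t v : 0 < size v -> (table (bits v) L).1 = mkseq (fun j => Z.of_nat (h v (L - j))) L.+1.
  by move=> v0; rewrite table_spec.
rewrite !t; try lia.
move=> /(_ isT) /(@leZs_nth _ _ (L - n)); rewrite !size_mkseq => /(_ erefl).
have lt : L - n < L.+1 by rewrite ltnS leq_subr.
by rewrite !nth_mkseq // subKn // => /(_ lt); lia.
Qed.
End SmallLengths.

Section SameLengthPersists.
Variable Omega : finType.
Hypothesis hq : (1 < #|Omega|)%N.
Variables w w' : seq Omega.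
Hypothesis w0 : (0 < size w)%N.
Hypothesis kk : size w' = size w.
Variable p : nat.
Hypothesis p1 : (1 < p)%N.
Hypothesis pk : (p < size w)%N.
Hypothesis pp : per w p.
Hypothesis np : ~~ per w' p.
Hypothesis agree : forall b, (b < p)%N -> per w b = per w' b.
Local Notation k := (size w).
Local Notation q := (#|Omega|%:R : rat).
Local Notation e := (er w w').

Let w0' : (0 < size w')%N. Proof. by rewrite kk. Qed.
Let p0 : (0 < p)%N. Proof. exact: ltnW. Qed.
Let k1 : (1 < k)%N. Proof. by lia. Qed.

Lemma excess_num L :
  (forall n, (k <= n < L)%N -> (n.+1 - (k + k)).+1%:R * q + 5%:R * powsum w p +
     4%:R * linsum Omega (n.+1 - (k + k)) <= q ^+ k.+1) ->
  forall n, (k <= n < L)%N ->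
    (n.+2 - (k + k))%N%:R * q + 5%:R * powsum w p + 4%:R * linsum Omega (n.+1 - (k + k)) <= q ^+ k.+1.
Proof.
move=> H n nL; apply: le_trans (H n nL); rewrite !lerD2r ler_wpM2r ?ler0n // ler_nat; lia.
Qed.

Lemma base_min : (forall b, (0 < b < p)%N -> ~~ per w b) ->
  (#|Omega| = 2%N /\ (12 <= k)%N /\ (3 <= p)%N) \/ ((3 <= #|Omega|)%N /\ (4 <= k)%N) ->
  forall n, (n < start1 w + k)%N -> e n <= 0.
Proof.
move=> pmin H.
have large : (5 <= k)%N \/ (3 <= #|Omega|)%N.
  by case: H => [[_ [k12 _]]|[q3 _]]; [left; lia | right].
have pk' : (0 < p <= k)%N by rewrite p0 ltnW.
apply: (base hq w0 kk p0 pk pp np agree).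
- exact: (classified_min hq w0 kk p1 pk pp np pmin).
- move=> n /andP[kn _]; have [c ck rp] := rowp_min hq w0 kk p1 pk pp np pmin.
  apply: le_trans (rowp_cost_min hq k1 large pk p1 kn ck).
  rewrite ler_pM2l //; apply: le_trans (rp (fun s => hr w (n + k - s)) _) _ => [s _|].
    exact: hr_ge0.
  exact: hr_le_arz.
- move=> n b /andP[kn _] bk pb; have far := prim_far hq w0 pk' pp pmin bk pb.
  have g0 : (0 < gcdn p b)%N by rewrite gcdn_gt0 p0.
  have p3 : (3 <= p <= p)%N by move: (gcdn p b) g0 far => g; lia.
  have bk' : (b < k)%N by lia.
  exact: (rowX_cost hq k1 large pk p3 pmin kn bk').
- apply: excess_num => n; rewrite /start1 => nL.
  case: H => [[qE [k12 p3]]|[q3 k4]].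
    by apply: (num_binary_min hq pk qE k12 p3); rewrite qE eqxx in nL; lia.
  apply: (num_large hq pk q3 p1); case: eqP nL => [qE|_] nL; first by rewrite qE in q3.
  by case: (ltnP 4 k) => k5; apply/orP; [left | right]; apply/andP; split; try apply/eqP; lia.
Qed.

Lemma base_shared g : (1 < g < p)%N -> per w g -> (forall b, (0 < b < g)%N -> ~~ per w b) ->
  (#|Omega| = 2%N /\ (12 <= k)%N) \/ (3 <= #|Omega|)%N ->
  forall n, (n < start2 w + k)%N -> e n <= 0.
Proof.
move=> g1 pg gmin H.
have g3 := g_ge3 hq w0 kk g1 pk pp np agree pg gmin.
have far := gp_far hq w0 kk g1 pk pp np agree pg gmin.
have [k5 p4] : (5 <= k)%N /\ (4 <= p)%N by lia.
have large : (5 <= k)%N \/ (3 <= #|Omega|)%N by left.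
apply: (base hq w0 kk p0 pk pp np agree).
- exact: (classified_shared hq w0 kk g1 pk pp np agree pg gmin).
- move=> n /andP[kn _]; apply: le_trans (rowp_cost_shared hq k1 large pk p4 kn).
  have F0 s : 0 <= arz w n s by apply: arz_ge0.
  have tail : \sum_(g <= b < k) arz w n (p + b) <= 2 * arz w n (p + g).
    rewrite big_ltn; last by lia.
    by have := arz_tail_shift hq k1 n p g; lra.
  have E0 s : (k <= s < k + k)%N -> 0 <= hr w (n + k - s) <= arz w n s.
    by move=> _; rewrite hr_ge0 hr_le_arz.
  have rp := rowp_le4 hq w0 kk g1 pk pp np agree pg gmin F0 tail E0.
  have fg : (k + 2 <= p + g)%N by [].
  by have := arz_nonincr hq k1 n fg; move: rp; lra.
- move=> n b /andP[kn _] bk pb; have bk' : (b < k)%N by lia.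
  exact: (rowX_cost hq k1 large pk g3 gmin kn bk').
- apply: excess_num => n; rewrite /start2 => nL.
  case: H => [[qE k12]|q3].
    by apply: (num_binary_shared hq pk qE k12 p4); rewrite qE eqxx in nL; lia.
  apply: (num_large hq pk q3 p1); case: eqP nL => [qE|_] nL; first by rewrite qE in q3.
  by apply/orP; left; apply/andP; split; lia.
Qed.

(** From e(k + 2) = -1: by Fine-Wilf w' cannot have both periods 3 and 4 without the period 1, so
    e(k + 4) <= -2. From there e(k + i) stays below -(2^(i-4) + 1), and at 2k - 1 this outweighs the
    linear correction in [low] for the next 3k lengths. *)
Lemma base_two : #|Omega| = 2%N -> p = 2%N -> (12 <= k)%N -> ~~ per w 1 ->
  forall n, (n < k + k + 3 * k)%N -> e n <= 0.
Proof.
move=> qE pE k12 np1.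
have qE' : q = 2 by rewrite qE.
have np1' : ~~ per w' 1 by rewrite -agree // pE.
have D2 := er_at_p hq w0 kk p0 pk pp np agree; rewrite pE in D2.
have D3 := er_step hq w0 kk (leq_trans (isT : 4 <= 12)%N k12).
have D4 := er_step hq w0 kk (leq_trans (isT : 5 <= 12)%N k12).
have not34 : pr w' 3 + pr w' 4 <= 1.
  have k3 : (0 < 3 <= size w')%N by rewrite kk; apply: leq_trans k12.
  have k4 : (0 < 4 <= size w')%N by rewrite kk; apply: leq_trans k12.
  rewrite /pr; case p3: (prim w' 3); case p4: (prim w' 4) => //.
  case/negP: np1'; apply: (per_gcd k3 k4); [| |by rewrite kk (leq_trans _ (leq_addr _ _)) //; apply: leq_trans k12].
    by apply: (prim_per hq w0') => //; rewrite kk; apply: leq_trans k12.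
  by apply: (prim_per hq w0') => //; rewrite kk; apply: leq_trans k12.
have e4 : e (k + 4) <= -2.
  rewrite D4 D3 D2 qE'; have := pr_ge0 w 3; have := pr_ge0 w 4.
  by have := pr_le1 w' 3; have := pr_ge0 w' 3; have := pr_ge0 w' 4; move: not34; lra.
have grow i : (i + 4 < k)%N -> e (k + (i + 4)) <= - (2 ^+ i + 1).
  elim: i => [|i IH] ik; first by rewrite add0n.
  rewrite addSn (er_step hq w0 kk); last by lia.
  have := IH (ltnW ik); have := pr_le1 w' (i + 4).+1; have := pr_ge0 w (i + 4).+1.
  by rewrite qE' exprS; lra.
have X n : (k <= n)%N -> xr w w' (n + k) <= 2 ^+ (n - k).
  move=> kn; have := xr_le hq w0 kk (n := n + k); rewrite addnK => /(_ _) h.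
  have kn' : (k + k <= n + k)%N by rewrite leq_add2r.
  apply: le_trans (h kn') _; have qk : 0 < q ^+ k by rewrite qE' exprn_gt0.
  by rewrite -qE' -(ler_pM2r qk) -exprD subnK // -kk; apply: hr_pow; rewrite kk.
have low i : e (k + k.-1 + i.+1) <= 2 ^+ i * (2 * e (k + k.-1) + i.+1%:R).
  elim: i => [|i IH].
    rewrite addn1 erS qE' mul1r lerD2l.
    by have := X k (leqnn k); rewrite subnn (_ : (k + k.-1).+1 = k + k)%N //; lia.
  rewrite addnS erS qE'.
  have h : xr w w' (k + k.-1 + i.+1).+1 <= 2 ^+ i.+1.
    have := X (k + i.+1)%N (leq_addr _ _); rewrite addKn.
    by rewrite (_ : k + i.+1 + k = (k + k.-1 + i.+1).+1)%N //; lia.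
  rewrite exprS -[i.+2%:R]natr1 in h *.
  by move: IH h; move: (2 ^+ i) (e _) (e _) (xr _ _ _) => A B C E; lra.
move=> n nL; have [lt|le] := ltnP n (k + k).
  exact: (er_lt2k hq w0 kk p0 pk pp np agree).
have nE : n = (k + k.-1 + (n - (k + k)).+1)%N by lia.
rewrite nE; apply: le_trans (low _) _; rewrite mulr_ge0_le0 ?exprn_ge0 //.
have g := grow (k - 5)%N; rewrite (_ : k - 5 + 4 = k.-1)%N in g; last by lia.
have {}g : e (k + k.-1) <= - (2 ^+ (k - 5) + 1) by apply: g; lia.
have Z : ((n - (k + k)).+1 <= 2 * 2 ^ (k - 5))%N.
  apply: leq_trans (_ : 3 * k <= _)%N; first by lia.
  rewrite -expnS; move: k12; clear; move=> /subnK <-.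
  elim: (k - 12)%N => // m IH; rewrite addSn subSn; last by lia.
  by rewrite expnS; move: IH; move: (2 ^ _)%N => Z; lia.
rewrite -(ler_nat rat) natrM natrX in Z.
by move: Z g; lra.
Qed.
End SameLengthPersists.

Lemma two_thirds_pow (r : rat) n m : 3 * r = 2 -> (n <= m)%N -> 3 ^+ n * r ^+ m <= 2 ^+ n.
Proof.
move=> rE nm; have r0 : 0 <= r by lra.
rewrite -(subnK nm) addnC exprD mulrA -exprMn rE ler_piMr ?exprn_ge0 // exprn_ile1 //; lra.
Qed.

Lemma quadratic_decay (r : rat) k : 3 * r = 2 -> (7 <= k)%N -> 3 * ((k * k + 4)%:R * r ^+ (2 * k).-1) <= 1.
Proof.
move=> rE /subnK <-; elim: (k - 7)%N => [|m IH].
  by have := two_thirds_pow rE (leqnn 13); rewrite add0n; move: (r ^+ 13) => x; lra.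
have E : (2 * (m.+1 + 7)).-1 = ((2 * (m + 7)).-1 + 2)%N by lia.
have x0 : 0 <= r ^+ (2 * (m + 7)).-1 by apply: exprn_ge0; lra.
rewrite E exprD; apply: le_trans IH; rewrite ler_pM2l // [r ^+ _ * _]mulrC mulrA ler_wpM2r //.
have h : (4 * ((m.+1 + 7) * (m.+1 + 7) + 4) <= 9 * ((m + 7) * (m + 7) + 4))%N by nia.
rewrite -(ler_nat rat) [X in X <= _]natrM [X in _ <= X]natrM in h.
have r2 : 9 * r ^+ 2 = 4.
  have -> : r ^+ 2 = r * r by [].
  have -> : 9 * (r * r) = 3 * r * (3 * r) by ring.
  by rewrite rE; lra.
have {}r2 : r ^+ 2 = 4 / 9 by lra.
by rewrite r2; move: h; move: ((_ + 4)%N%:R) ((_ + 4)%N%:R) => A B; lra.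
Qed.

(** * Assembling the cases *)

Section Assembly.
Variable Omega : finType.
Hypothesis hq : (1 < #|Omega|)%N.
Variables w w' : seq Omega.
Hypothesis w0 : (0 < size w)%N.
Hypothesis kk : size w' = size w.
Variable p : nat.
Hypothesis p0 : (0 < p)%N.
Hypothesis pk : (p < size w)%N.
Hypothesis pp : per w p.
Hypothesis np : ~~ per w' p.
Hypothesis agree : forall b, (b < p)%N -> per w b = per w' b.
Local Notation k := (size w).
Local Notation q := (#|Omega|%:R : rat).
Local Notation e := (er w w').

Let q2 : 2 <= q. Proof. by rewrite ler_nat. Qed.

Lemma step_eq n : (0 < k)%N -> q * e (n + k).-1 - e (n + k) = - xr w w' (n + k).
Proof.
move=> k0; have E : ((n + k).-1.+1 = n + k)%N by rewrite prednK // addn_gt0 k0 orbT.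
by have := erS w w' (n + k).-1; rewrite E => ->; ring.
Qed.

Lemma small_nonpos : #|Omega| = 2%N -> (1 < p)%N -> (4 <= k <= 11)%N -> ~~ per w 1 ->
  forall n, (n < (length_bound k).+1)%N -> e n <= 0.
Proof.
move=> qE p1 k4 n1 n nk; rewrite subr_le0 ler_nat.
by apply: (small_base qE k4 kk _ pp np agree n1) => //; rewrite p1.
Qed.

Lemma two_thirds : exists r : rat, 3 * r = 2.
Proof. by exists (2 / 3); rewrite mulrC divfK. Qed.

Lemma min_persists : (1 < p)%N -> (4 <= k)%N -> (forall b, (0 < b < p)%N -> ~~ per w b) ->
  ~~ per w 1 -> persists w w'.
Proof.
move=> p1 k4 pmin n1 M; have [r rE] := two_thirds.
apply: (persist_growth q2 (n0 := start1 w) (k := k) (K := 1) (r := r)) => //.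
- have a := two_thirds_pow rE (_ : (3 <= k.-1)%N); have b := two_thirds_pow rE (_ : (7 <= (2 * k).-1)%N).
  have {}a := a ltac:(lia); have {}b := b ltac:(lia).
  by move: a b; move: (r ^+ k.-1) (r ^+ (2 * k).-1) => x y; lra.
- have [q3|qlt] := ltnP 2 #|Omega|.
    by apply: (base_min hq w0 kk p1 pk pp np agree pmin); right.
  have qE : #|Omega| = 2%N by apply/eqP; rewrite eqn_leq qlt.
  have [k12|k11] := ltnP 11 k; last first.
    move=> n nk; apply: (small_nonpos qE p1) => //; first by rewrite k4.
    apply: leq_trans nk _; rewrite /length_bound /start1 qE eqxx.
    by case: ifP => _; lia.
  have [p3|p2] := ltnP 2 p.
    by apply: (base_min hq w0 kk p1 pk pp np agree pmin); left.
  move=> n nk; apply: (base_two hq w0 kk _ pk pp np agree) => //; first by lia.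
  by move: nk; rewrite /start1 qE eqxx; lia.
- move=> n B n0 B0 small; rewrite (step_eq _ w0).
  have [c /andP[ck cp] st] := step_min hq w0 kk p1 pk pp np agree pmin n0.
  apply: le_trans st _; rewrite mul1r lerD2l ge_max B0 andbT; apply: small.
  have : (c <= n)%N by move: n0; rewrite /start1; case: ifP => _; lia.
  by lia.
Qed.

Lemma shared_persists g : (1 < g < p)%N -> per w g -> (forall b, (0 < b < g)%N -> ~~ per w b) ->
  ~~ per w 1 -> persists w w'.
Proof.
move=> g1 pg gmin n1 M; have [r rE] := two_thirds.
have far := gp_far hq w0 kk g1 pk pp np agree pg gmin.
have p1 : (1 < p)%N by lia.
have k5 : (5 <= k)%N by have := g_ge3 hq w0 kk g1 pk pp np agree pg gmin; lia.
have small : forall n, (n < start2 w + k)%N -> e n <= 0.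
  have [q3|qlt] := ltnP 2 #|Omega|.
    by apply: (base_shared hq w0 kk p1 pk pp np agree g1 pg gmin); right.
  have qE : #|Omega| = 2%N by apply/eqP; rewrite eqn_leq qlt.
  have [k12|k11] := ltnP 11 k.
    by apply: (base_shared hq w0 kk p1 pk pp np agree g1 pg gmin); left.
  move=> n nk; apply: (small_nonpos qE p1) => //; first by rewrite k11 ltnW.
  apply: leq_trans nk _; rewrite /length_bound /start2 qE eqxx.
  by case: ifP => [/eqP k4|_]; lia.
have [s|s] : single w p g \/ ~ single w p g.
  case: (boolP (all (fun a => prim w a ==> (a == g)) (iota 0 p))) => s; [left | right].
    by move=> a ap pa; have /allP/(_ a) := s; rewrite mem_iota pa /= => /(_ ap)/eqP.
  move=> t; case/negP: s; apply/allP => a; rewrite mem_iota => ap.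
  by apply/implyP => pa; apply/eqP; apply: t.
- apply: (persist_growth q2 (n0 := start2 w) (k := k) (K := 4) (r := r)) => //.
    have a := two_thirds_pow rE (_ : (4 <= k.-1)%N); have b := two_thirds_pow rE (_ : (9 <= (2 * k).-1)%N).
    have {}a := a ltac:(lia); have {}b := b ltac:(lia).
    by move: a b; move: (r ^+ k.-1) (r ^+ (2 * k).-1) => x y; lra.
  move=> n B n0 B0 mb; rewrite (step_eq _ w0).
  by apply: (step_single hq w0 kk g1 pk pp np agree pg gmin s n0).
- have [g4 p6 far3 k7] := multi_ge hq w0 kk g1 pk pp np agree pg gmin s.
  apply: (persist_growth q2 (n0 := start2 w) (k := k) (K := (k * k + 4)%N%:R) (r := r)) => //.
    have a := two_thirds_pow rE (_ : (6 <= k.-1)%N); have b := quadratic_decay rE k7.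
    have {}a := a ltac:(lia).
    by move: a b; move: (r ^+ k.-1) ((k * k + 4)%N%:R * _) => x y; lra.
  move=> n B n0 B0 mb; rewrite (step_eq _ w0).
  by apply: (step_multi hq w0 kk g1 pk pp np agree pg gmin s n0).
Qed.

Lemma same_length_persists : persists w w'.
Proof.
have [n1|n1] := boolP (per w 1); first exact: (constant_persists hq w0 kk p0 pk pp np agree).
have [/hasP[b0]|/hasPn nob] := boolP (has (per w') (iota 1 k.-1)); last first.
  apply: (no_period_persists hq w0 kk p0 pk pp np agree) => b b1; apply: nob.
  by rewrite mem_iota; lia.
rewrite mem_iota => bk pb.
have p1 : (1 < p)%N.
  by case: p p0 pp n1 => [|[|m]] // _ ->.
(* Otherwise k = 3 and p = 2; a period of w' would be 2, which is excluded, or 1, which w would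
   share. *)
have k4 : (4 <= k)%N.
  case: (ltnP 3 k) => // k3.
  have pE : p = 2%N by lia.
  have : b0 = 1%N \/ b0 = 2%N by lia.
  case=> bE; last by move: pb; rewrite bE -pE (negbTE np).
  by case/negP: n1; rewrite agree // -bE.
have ex : exists b, (0 < b)%N && per w b by exists p; rewrite p0.
case: (ex_minnP ex) => g /andP[g0 pg] gle.
have gmin b : (0 < b < g)%N -> ~~ per w b.
  by case/andP=> b0' bg; apply/negP => pb'; have := gle b; rewrite b0' pb' leqNgt bg => /(_ isT).
have g1 : (1 < g)%N by case: g g0 pg {gle gmin} => [|[|m]] // _ h; rewrite h in n1.
have := gle p; rewrite p0 pp leq_eqVlt => /(_ isT)/orP[/eqP gp|gp].
  by apply: min_persists => // b; rewrite -gp; apply: gmin.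
by apply: (shared_persists (g := g)) => //; rewrite g1.
Qed.
End Assembly.

Theorem theorem2p1 (Omega : finType) (hq : (2 <= #|Omega|)%N)
  (w w' : seq Omega) (hk : (1 <= size w)%N) (hk' : (1 <= size w')%N)
  (hcor : (cor w' < cor w)%N) :
  exists N : nat, (size w < N)%N /\
    (forall n : nat, (n < N)%N -> (h w n)%:Z - (h w' n)%:Z <= 0) /\
    (forall n : nat, (N < n)%N -> (h w n)%:Z - (h w' n)%:Z > 0).
Proof.
have := cor_size hcor; rewrite leq_eqVlt => /orP[/eqP kk|lt].
  have [p [/andP[p0 pk] pp np agree]] := cor_first_diff kk hcor.
  apply: (sign_change hq hk hk' (j0 := size w + p)).
  - by move=> n nk; rewrite er_small.
  - by rewrite (er_at_p hq hk kk p0 pk pp np agree) oppr_lt0.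
  - exact: (same_length_persists hq hk kk p0 pk pp np agree).
apply: (sign_change hq hk hk' (j0 := size w')).
- by move=> n nk; apply: (longer_nonpos hq hk' (ltnW lt)).
- exact: longer_neg.
- exact: longer_persists.
Qed.
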